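(* With $S_1,S_2$ as in the context, $$S_1(q)=3\frac{(q^6;q^6)_\infty (q^{18},q^{27},q^{45};q^{45})_\infty}{(q^3;q^3)_\infty^2} -\frac{(q^4,q^6,q^{10};q^{10})_\infty(q,q^5,q^{11},q^{19},q^{25},q^{29};q^{30})_\infty}{(q^3;q^3)_\infty (q^3,q^{27};q^{30})_\infty},$$ $$S_2(q)=3q^2\frac{(q^6;q^6)_\infty (q^9,q^{36},q^{45};q^{45})_\infty}{(q^3;q^3)_\infty^2} +\frac{(q^2,q^8,q^{10};q^{10})_\infty (q^5,q^7,q^{13},q^{17},q^{23},q^{25};q^{30})_\infty}{(q^3;q^3)_\infty (q^9,q^{21};q^{30})_\infty}.$$
   Context: Let $|q|<1$ and use standard $q$-Pochhammer notation $(a;q)_n=\prod_{k=0}^{n-1}(1-aq^k)$, $(a;q)_\infty=\prod_{k\ge0}(1-aq^k)$, $(a_1,\dots,a_m;q)_\infty=(a_1;q)_\infty\cdots(a_m;q)_\infty$. Define $$S_1(q)=\sum_{i,j\geq 0}\frac{q^{\frac{1}{2}i^2-ij+2j^2-\frac{1}{2}i+2j}}{(q^3;q^3)_i(q^3;q^3)_j},\qquad S_2(q)=\sum_{i,j\geq 0}\frac{q^{\frac{1}{2}i^2-ij+2j^2+\frac{3}{2}i}}{(q^3;q^3)_i (q^3;q^3)_j}.$$ *)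

(* Defs.v *)
From Stdlib Require Import Reals ZArith.
From Coquelicot Require Import Coquelicot.
Open Scope C_scope.

Definition Cpowz (q : Complex.C) (z : Z) : Complex.C :=
  if (0 <=? z)%Z then q ^ Z.to_nat z else / (q ^ Z.to_nat (- z)).

(* limit (in C) of a sequence; meaningful when the sequence converges *)
Definition Clim (u : nat -> Complex.C) : Complex.C :=
  @lim (CompleteNormedModule.CompleteSpace _ C_CompleteNormedModule)
       (filtermap u eventually).

Fixpoint qpoch (a q : Complex.C) (n : nat) : Complex.C :=
  match n with
  | O => 1
  | S m => qpoch a q m * (1 - a * q ^ m)
  end.

Definition qpoch_inf (a q : Complex.C) : Complex.C := Clim (qpoch a q).

(* exponent 1/2 i^2 - i j + 2 j^2 - 1/2 i + 2 j, an integer since i(i-1) is even *)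
Definition e1 (i j : nat) : Z :=
  let i := Z.of_nat i in let j := Z.of_nat j in
  ((i * i - i) / 2 - i * j + 2 * j * j + 2 * j)%Z.

(* exponent 1/2 i^2 - i j + 2 j^2 + 3/2 i, an integer since i(i+3) is even *)
Definition e2 (i j : nat) : Z :=
  let i := Z.of_nat i in let j := Z.of_nat j in
  ((i * i + 3 * i) / 2 - i * j + 2 * j * j)%Z.

Definition term (e : nat -> nat -> Z) (q : Complex.C) (i j : nat) : Complex.C :=
  Cpowz q (e i j) / (qpoch (q ^ 3) (q ^ 3) i * qpoch (q ^ 3) (q ^ 3) j).

Fixpoint csum (f : nat -> Complex.C) (N : nat) : Complex.C :=
  match N with
  | O => 0
  | S M => csum f M + f M
  end.

Definition sq_partial (f : nat -> nat -> Complex.C) (N : nat) : Complex.C :=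
  csum (fun i => csum (fun j => f i j) N) N.

(* Main.v *)
(* Put [p = q^3], [s = p^2], [w = s^2] and [tri n = n (n - 1) / 2].  In terms of [d = i - j] the exponents
   are [tri d + a d + 3 tri (j + 1)] with [a = 0] for [S_1] and [a = 2] for [S_2].  Expanding
   [1 / (p;p)_j = (p^{j+1};p)_oo / (p;p)_oo] by Euler's identity and summing over [i] with Gauss's
   evaluation of [sum_m (-1)^m / ((p;p)_{k-m} (p;p)_m)] turns [(p;p)_oo S_a] into
   [sum_{k,J} q^{Q(k,J)} / (p^2;p^2)_k] with [Q] positive definite, and splitting by the parity of [k] gives
   theta series in [q] times sums such as [sum_n s^{n^2} / (s;s)_{2n}].  These are Rogers-Slater sums, which
   Bailey's lemma evaluates as products.  After the products are cleared, both sides are combinations of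
   products of two theta series; separating exponents modulo 3 leaves four identities in [p], and each
   follows from changes of variables in the lattice Z^2.  The case [q = 0] is treated separately, since the
   shifts above use negative powers of [q]. *)
Require Import Defs.
From Stdlib Require Import Reals ZArith Lia Lra List Permutation.
From Stdlib Require Import Classical ClassicalDescription.
From Coquelicot Require Import Coquelicot.
From Stdlib Require Import ssreflect.
Open Scope C_scope.

(** * Unconditional sums of complex families *)

(** All series run over Z or Z^2: [ip] lets 1/(p;p)_n vanish for n < 0, so that shifts and shears
    leave no boundary terms, and [tsum] is unconditional because substitutions in a lattice respect
    no order of summation. Euler's expansion is applied to 1/(p;p)_j for every integer j, also for
    negative j, where it yields 0; only then does J = j + m run over all of Z and produce full theta
    series. It combines well with the exponent because i - j does not change when i and j both grow
    by m, while 3 tri (j + 1) absorbs the powers of p that Euler contributes. In J and k = i + m the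
    exponent is free of m, and the sum over m is Gauss's. For fixed k the exponent is smallest near
    J = k / 4, so the variables separate after an integral shift only once k is fixed modulo 4.
    Gauss's sum removes odd k; the parity of the halved index does the rest. The factor 3 in both
    formulas is 2 + 1: the lattice identities give twice one component of the theta series in q
    modulo 3, and completing that series to a product uses one more copy. *)

Definition lsum {I : Type} (f : I -> Complex.C) (l : list I) : Complex.C :=
  fold_right (fun i acc => f i + acc) 0 l.

Definition asum {I : Type} (f : I -> Complex.C) (l : list I) : R :=
  fold_right (fun i acc => (Cmod (f i) + acc)%R) 0%R l.

Definition summable {I : Type} (f : I -> Complex.C) : Prop :=
  exists B : R, forall l, NoDup l -> (asum f l <= B)%R.

Definition has_sum {I : Type} (f : I -> Complex.C) (s : Complex.C) : Prop :=
  forall eps : R, (0 < eps)%R -> exists l0, NoDup l0 /\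
    forall l, NoDup l -> incl l0 l -> (Cmod (lsum f l - s) < eps)%R.

(** A total function obtained by definite description; its value carries information only when some
    [has_sum f s] holds. *)
Definition tsum {I : Type} (f : I -> Complex.C) : Complex.C :=
  @iota (CompleteNormedModule.CompleteSpace _ C_CompleteNormedModule) (has_sum f).

Section FiniteSums.
Context {I : Type}.
Implicit Types (f g : I -> Complex.C) (l : list I).

Lemma asum_ge0 f l : (0 <= asum f l)%R.
Proof.
  elim: l => [|a l IH] /=; first lra.
  have := Cmod_ge_0 (f a); lra.
Qed.

Lemma lsum_app f l1 l2 : lsum f (l1 ++ l2) = lsum f l1 + lsum f l2.
Proof. elim: l1 => [|a l IH] /=; [ring | rewrite IH; ring]. Qed.

Lemma asum_app f l1 l2 : asum f (l1 ++ l2) = (asum f l1 + asum f l2)%R.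
Proof. elim: l1 => [|a l IH] /=; [ring | rewrite IH; ring]. Qed.

Lemma lsum_perm f l1 l2 : Permutation l1 l2 -> lsum f l1 = lsum f l2.
Proof. induction 1 => //=; congruence || ring. Qed.

Lemma asum_perm f l1 l2 : Permutation l1 l2 -> asum f l1 = asum f l2.
Proof. induction 1 => //=; congruence || ring. Qed.

Lemma lsum_plus f g l : lsum (fun i => f i + g i) l = lsum f l + lsum g l.
Proof. elim: l => [|a l IH] /=; [ring | rewrite IH; ring]. Qed.

Lemma lsum_scal c f l : lsum (fun i => c * f i) l = c * lsum f l.
Proof. elim: l => [|a l IH] /=; [ring | rewrite IH; ring]. Qed.

Lemma lsum_ext_in f g l : (forall i, In i l -> f i = g i) -> lsum f l = lsum g l.
Proof.
  elim: l => [|a l IH] //= H. rewrite H; last by left.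
  rewrite IH //. move=> i Hi; apply: H; by right.
Qed.

Lemma lsum_zero f l : (forall i, In i l -> f i = 0) -> lsum f l = 0.
Proof.
  elim: l => [|a l IH] //= H. rewrite H; last by left.
  rewrite IH; last by move=> i Hi; apply: H; right. ring.
Qed.

Lemma asum_le f g l : (forall i, In i l -> (Cmod (f i) <= Cmod (g i))%R) ->
  (asum f l <= asum g l)%R.
Proof.
  elim: l => [|a l IH] //= H; first lra.
  apply: Rplus_le_compat; first by apply: H; left.
  apply: IH => i Hi; apply: H; by right.
Qed.

Lemma Cmod_lsum f l : (Cmod (lsum f l) <= asum f l)%R.
Proof.
  elim: l => [|a l IH] /=; first by rewrite Cmod_0; lra.
  have := Cmod_triangle (f a) (lsum f l); lra.
Qed.

Lemma NoDup_incl_split l0 l : NoDup l0 -> incl l0 l ->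
  exists l', Permutation l (l0 ++ l').
Proof.
  elim: l0 l => [|a l0 IH] l nd inc; first by exists l.
  destruct (in_split a l) as [l1 [l2 El]]; first by apply: inc; left.
  inversion nd as [|? ? na nd0]; subst.
  have inc' : incl l0 (l1 ++ l2).
  { move=> x Hx. have := inc x (or_intror Hx).
    rewrite !in_app_iff /= => -[|[E|]]; [by left| |by right].
    by subst. }
  have [l' Hl'] := IH _ nd0 inc'.
  exists l'. rewrite -Permutation_middle /=. by constructor.
Qed.

Lemma asum_incl f l0 l : NoDup l0 -> incl l0 l -> (asum f l0 <= asum f l)%R.
Proof.
  move=> nd inc. have [l' P] := NoDup_incl_split _ _ nd inc.
  rewrite (asum_perm _ _ _ P) asum_app. have := asum_ge0 f l'; lra.
Qed.

(** Index types are arbitrary, so duplicates are removed with classical equality. *)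
Definition lunion (l : list I) : list I :=
  nodup (fun x y => excluded_middle_informative (x = y)) l.

Lemma lunion_NoDup l : NoDup (lunion l).
Proof. exact: NoDup_nodup. Qed.

Lemma lunion_In l x : In x (lunion l) <-> In x l.
Proof. exact: nodup_In. Qed.

Lemma has_sum_unique f s t : has_sum f s -> has_sum f t -> s = t.
Proof.
  move=> Hs Ht. apply: NNPP => ne.
  have pos : (0 < Cmod (s - t) / 2)%R.
  { apply: Rdiv_lt_0_compat; last lra. apply Cmod_gt_0 => E. apply: ne.
    replace s with (s - t + t) by ring. rewrite E; ring. }
  have [l1 [_ H1]] := Hs _ pos. have [l2 [_ H2]] := Ht _ pos.
  have nd := lunion_NoDup (l1 ++ l2).
  have {}H1 := H1 _ nd. have {}H2 := H2 _ nd.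
  have i1 : incl l1 (lunion (l1 ++ l2)).
  { move=> x Hx; apply/lunion_In; apply: in_or_app; by left. }
  have i2 : incl l2 (lunion (l1 ++ l2)).
  { move=> x Hx; apply/lunion_In; apply: in_or_app; by right. }
  have {}H1 := H1 i1. have {}H2 := H2 i2.
  set L := lsum f _ in H1 H2.
  have := Cmod_triangle (- (L - s)) (L - t). rewrite Cmod_opp.
  replace (- (L - s) + (L - t)) with (s - t) by ring. lra.
Qed.

Lemma has_sum_tsum f s : has_sum f s -> tsum f = s.
Proof.
  move=> H. apply: iota_unique => // t Ht. exact: has_sum_unique Ht H.
Qed.

Lemma has_sum_ext f g s : (forall i, f i = g i) -> has_sum f s -> has_sum g s.
Proof.
  move=> E H eps pos. have [l0 [nd H0]] := H _ pos. exists l0; split=> // l ndl inc.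
  rewrite -(lsum_ext_in f g) //. exact: H0.
Qed.

Lemma has_sum_plus f g s t :
  has_sum f s -> has_sum g t -> has_sum (fun i => f i + g i) (s + t).
Proof.
  move=> Hs Ht eps pos. have pos2 : (0 < eps / 2)%R by lra.
  have [l1 [_ H1]] := Hs _ pos2. have [l2 [_ H2]] := Ht _ pos2.
  exists (lunion (l1 ++ l2)); split; first exact: lunion_NoDup.
  move=> l nd inc. rewrite lsum_plus.
  have {}H1 : (Cmod (lsum f l - s) < eps / 2)%R.
  { apply: H1 => // x Hx; apply: inc; apply/lunion_In; apply: in_or_app; by left. }
  have {}H2 : (Cmod (lsum g l - t) < eps / 2)%R.
  { apply: H2 => // x Hx; apply: inc; apply/lunion_In; apply: in_or_app; by right. }
  replace (lsum f l + lsum g l - (s + t)) with ((lsum f l - s) + (lsum g l - t)) by ring.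
  have := Cmod_triangle (lsum f l - s) (lsum g l - t); lra.
Qed.

Lemma has_sum_scal c f s : has_sum f s -> has_sum (fun i => c * f i) (c * s).
Proof.
  move=> Hs eps pos.
  have pc : (0 < Cmod c + 1)%R by have := Cmod_ge_0 c; lra.
  have [l0 [nd H0]] := Hs (eps / (Cmod c + 1))%R (Rdiv_lt_0_compat _ _ pos pc).
  exists l0; split=> // l ndl inc. rewrite lsum_scal.
  replace (c * lsum f l - c * s) with (c * (lsum f l - s)) by ring.
  rewrite Cmod_mult. have {}H0 := H0 _ ndl inc.
  apply: (Rle_lt_trans _ ((Cmod c + 1) * Cmod (lsum f l - s))).
  - have := Cmod_ge_0 (lsum f l - s); have := Cmod_ge_0 c; nra.
  - apply: (Rlt_le_trans _ ((Cmod c + 1) * (eps / (Cmod c + 1)))).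
    + exact: Rmult_lt_compat_l.
    + right; field; lra.
Qed.

Lemma summable_le f g : (forall i, (Cmod (f i) <= Cmod (g i))%R) -> summable g -> summable f.
Proof.
  move=> H [B HB]; exists B => l nd. apply: Rle_trans (HB l nd). exact: asum_le.
Qed.

Lemma summable_ext f g : (forall i, f i = g i) -> summable g -> summable f.
Proof. move=> H; apply: summable_le => i; rewrite H; lra. Qed.

Lemma summable_scal c f : summable f -> summable (fun i => c * f i).
Proof.
  move=> [B HB]; exists (Cmod c * B)%R => l nd.
  have -> : asum (fun i => c * f i) l = (Cmod c * asum f l)%R.
  { elim: l {nd} => [|a l IH] /=; [ring | rewrite IH Cmod_mult; ring]. }
  apply Rmult_le_compat_l; [exact: Cmod_ge_0 | exact: HB].
Qed.

Lemma summable_plus f g : summable f -> summable g -> summable (fun i => f i + g i).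
Proof.
  move=> [B HB] [D HD]; exists (B + D)%R => l nd.
  have : (asum (fun i => f i + g i)%C l <= asum f l + asum g l)%R.
  { elim: l {nd} => [|a l IH] /=; first lra.
    have := Cmod_triangle (f a) (g a); lra. }
  have := HB _ nd; have := HD _ nd; lra.
Qed.

(** The sum is the supremum of the finite sums, which are monotone in the index set. *)
Lemma has_sum_nonneg (f : I -> R) : (forall i, 0 <= f i)%R ->
  summable (fun i => RtoC (f i)) -> exists s : R, has_sum (fun i => RtoC (f i)) (RtoC s).
Proof.
  move=> pos [B HB].
  pose F := fun i => RtoC (f i).
  have FE l : lsum F l = RtoC (asum F l).
  { elim: l => [|a l IH] //=. rewrite IH /F Cmod_R Rabs_pos_eq // RtoC_plus //. }
  pose E := fun x : R => exists l, NoDup l /\ x = asum F l.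
  have bE : bound E by exists B => x [l [nd ->]]; exact: HB.
  have neE : exists x, E x by exists 0%R; exists nil; split=> //; constructor.
  have [s [ub lub]] := completeness E bE neE.
  exists s => eps epos.
  have [l0 [nd0 H0]] : exists l, NoDup l /\ (s - eps < asum F l)%R.
  { apply: NNPP => H. have : (s <= s - eps)%R; last lra.
    apply: lub => x [l [nd ->]]. apply: Rnot_lt_le => Hx. apply: H. by exists l. }
  exists l0; split=> // l nd inc. fold F. rewrite FE -RtoC_minus Cmod_R.
  have h1 := asum_incl F _ _ nd0 inc.
  have h2 : (asum F l <= s)%R by apply: ub; exists l.
  apply: Rabs_def1; lra.
Qed.

(** Real and imaginary parts are each split into positive and negative parts; all four are dominated
    by [Cmod (f i)], so [has_sum_nonneg] applies to them. *)
Lemma summable_has_sum f : summable f -> has_sum f (tsum f).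
Proof.
  move=> Sf.
  suff [s Hs] : exists s, has_sum f s by rewrite (has_sum_tsum _ _ Hs).
  have real (u : I -> R) : (forall i, (Rabs (u i) <= Cmod (f i))%R) ->
    exists s : R, has_sum (fun i => RtoC (u i)) (RtoC s).
  { move=> Hu.
    have pos_part (v : I -> R) : (forall i, (Rabs (v i) <= Cmod (f i))%R) ->
      exists t : R, has_sum (fun i => RtoC (Rmax (v i) 0)) (RtoC t).
    { move=> Hv. apply: has_sum_nonneg => [i|]; first exact: Rmax_r.
      apply: summable_le Sf => i. rewrite Cmod_R. apply: Rle_trans (Hv i).
      rewrite /Rmax; case: Rle_dec => _; last lra.
      rewrite Rabs_R0; exact: Rabs_pos. }
    have [s1 H1] := pos_part u Hu.
    have [s2 H2] : exists t : R, has_sum (fun i => RtoC (Rmax (- u i) 0)) (RtoC t).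
    { apply: (pos_part (fun i => (- u i)%R)) => i. by rewrite Rabs_Ropp. }
    exists (s1 - s2)%R.
    have H := has_sum_plus _ _ _ _ H1 (has_sum_scal (- (1)) _ _ H2).
    replace (RtoC (s1 - s2)) with (RtoC s1 + - (1) * RtoC s2)
      by (rewrite RtoC_minus; ring).
    apply: has_sum_ext H => i /=.
    rewrite /Rmax; case: Rle_dec => h1; case: Rle_dec => h2.
    - have -> : u i = 0%R by lra. ring.
    - rewrite RtoC_opp; ring.
    - ring.
    - exfalso; lra. }
  have [a Ha] := real (fun i => Re (f i)) (fun i => re_le_Cmod (f i)).
  have [b Hb] := real (fun i => Im (f i))
    (fun i => Rle_trans _ _ _ (Rmax_r _ _) (Rmax_Cmod (f i))).
  exists (RtoC a + Ci * RtoC b).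
  apply: has_sum_ext (has_sum_plus _ _ _ _ Ha (has_sum_scal Ci _ _ Hb)) => i.
  case: (f i) => x y. rewrite /Re /Im /Ci /RtoC /Cmult /Cplus /=. f_equal; ring.
Qed.

Lemma tsum_ext f g : (forall i, f i = g i) -> tsum f = tsum g.
Proof.
  move=> H. rewrite /tsum. f_equal.
  have -> // : f = g. apply: FunctionalExtensionality.functional_extensionality. exact: H.
Qed.

Lemma tsum_plus f g : summable f -> summable g ->
  tsum (fun i => f i + g i) = tsum f + tsum g.
Proof.
  move=> Sf Sg. apply: has_sum_tsum. by apply: has_sum_plus; apply: summable_has_sum.
Qed.

Lemma tsum_scal c f : summable f -> tsum (fun i => c * f i) = c * tsum f.
Proof.
  move=> Sf. apply: has_sum_tsum. by apply: has_sum_scal; apply: summable_has_sum.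
Qed.

Lemma has_sum_finite f l : NoDup l -> (forall i, ~ In i l -> f i = 0) -> has_sum f (lsum f l).
Proof.
  move=> nd H eps pos. exists l; split=> // l1 nd1 inc.
  have [l' P] := NoDup_incl_split _ _ nd inc.
  rewrite (lsum_perm _ _ _ P) lsum_app (lsum_zero f l').
  - replace (lsum f l + 0 - lsum f l) with (RtoC 0) by ring. by rewrite Cmod_0.
  - move=> i Hi; apply: H => Hl.
    have := Permutation_NoDup P nd1 => /NoDup_app_remove_l.
    have nd2 := Permutation_NoDup P nd1.
    move=> _. move: nd2. clear -Hi Hl. elim: l Hl => //= a l IH [->|Hl] nd.
    + inversion nd; subst. apply: H1. apply: in_or_app; by right.
    + inversion nd; subst. by apply: IH.
Qed.

Lemma summable_finite f l : NoDup l -> (forall i, ~ In i l -> f i = 0) -> summable f.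
Proof.
  move=> nd H. exists (asum f l) => l1 nd1.
  have [l2 [nd2 [inc [_ ->]]]] : exists l2, NoDup l2 /\ incl l2 l /\ incl l2 l1 /\
    asum f l1 = asum f l2.
  { elim: l1 nd1 => [|a l1 IH] nd1.
    - exists nil; split; first by constructor. by repeat split => //.
    - inversion nd1 as [|? ? na nd1']; subst.
      have [l2 [nd2 [i2 [i1 E]]]] := IH nd1'.
      case: (classic (In a l)) => Ha.
      + exists (a :: l2); split; [|split; [|split]].
        * constructor=> // /i1; exact: na.
        * by move=> x [<-|/i2].
        * move=> x [<-|/i1 ?]; by [left|right].
        * by rewrite /= E.
      + exists l2; split=> //; split=> //; split.
        * move=> x /i1; by right.
        * rewrite /= E H // Cmod_0; ring. }
  exact: asum_incl.
Qed.

Lemma tsum_single f i0 : (forall i, i <> i0 -> f i = 0) -> tsum f = f i0.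
Proof.
  move=> H. have nd : NoDup (i0 :: nil) by constructor=> //; constructor.
  rewrite (has_sum_tsum _ _ (has_sum_finite f (i0 :: nil) nd _)) /=; first by ring.
  move=> i Hi; apply: H => E; apply: Hi; by left.
Qed.

Lemma tsum_zero f : (forall i, f i = 0) -> tsum f = 0.
Proof.
  move=> H. rewrite (has_sum_tsum _ _ (has_sum_finite f nil _ _)) //; by constructor.
Qed.

End FiniteSums.

Definition Ccv (u : nat -> Complex.C) (l : Complex.C) : Prop :=
  forall eps : R, (0 < eps)%R -> exists N : nat, forall n, (N <= n)%nat ->
    (Cmod (u n - l) < eps)%R.

Section Reindexing.
Context {I J : Type}.
Implicit Types (f : I -> Complex.C) (e : J -> I).

Definition injective_map e : Prop := forall x y, e x = e y -> x = y.

Lemma NoDup_map_inj e l : injective_map e -> NoDup l -> NoDup (map e l).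
Proof.
  move=> inj. elim: l => [|a l IH] nd /=; first by constructor.
  inversion nd; subst. constructor; last exact: IH.
  move=> /in_map_iff [x [/inj -> ?]]. contradiction.
Qed.

Lemma summable_comp f e : injective_map e -> summable f -> summable (fun j => f (e j)).
Proof.
  move=> inj [B HB]; exists B => l nd.
  have -> : asum (fun j => f (e j)) l = asum f (map e l) by elim: l {nd} => //= a l ->.
  apply: HB. exact: NoDup_map_inj.
Qed.

(** The list [l'] enumerates the preimages of the members of [l]; members outside the image of [e]
    contribute nothing for a family that vanishes there. *)
Lemma preimage_list e l : injective_map e -> NoDup l -> exists l', NoDup l' /\
  (forall j, In j l' <-> In (e j) l) /\
  forall f, (forall i, (forall j, e j <> i) -> f i = 0) ->
    lsum f l = lsum (fun j => f (e j)) l' /\ asum f l = asum (fun j => f (e j)) l'.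
Proof.
  move=> inj. elim: l => [|a l IH] nd.
  - exists nil; split; first by constructor. by split.
  - inversion nd as [|? ? na nd']; subst.
    have [l' [nl' [Hl' E]]] := IH nd'.
    case: (classic (exists j, e j = a)) => [[j Hj]|Hn].
    + exists (j :: l'); split; [|split].
      * constructor=> // /Hl'. by rewrite Hj.
      * move=> k /=; split.
        -- move=> [<-|/Hl' ?]; [by left | by right].
        -- move=> [E1|/Hl' ?]; [left; apply: inj; congruence | by right].
      * move=> f Hf /=. have [-> ->] := E f Hf. by rewrite Hj.
    + exists l'; split=> //; split.
      * move=> k; split=> [/Hl' ?|/= [E1|/Hl' //]]; first by right.
        exfalso; apply: Hn; by exists k.
      * move=> f Hf /=. have [-> ->] := E f Hf.
        rewrite Hf; first by rewrite Cmod_0; split; ring.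
        move=> j Hj; apply: Hn; by exists j.
Qed.

Lemma has_sum_extend f e : injective_map e -> (forall i, (forall j, e j <> i) -> f i = 0) ->
  summable (fun j => f (e j)) -> has_sum f (tsum (fun j => f (e j))).
Proof.
  move=> inj H0 /summable_has_sum Hs eps pos.
  have [l0 [nd0 Hl0]] := Hs _ pos.
  exists (map e l0); split; first exact: NoDup_map_inj.
  move=> l nd inc. have [l' [nd' [Hl' E]]] := preimage_list e l inj nd.
  have [-> _] := E f H0. apply: Hl0 => // x Hx. apply/Hl'. apply: inc.
  exact: in_map.
Qed.

Lemma tsum_extend f e : injective_map e -> (forall i, (forall j, e j <> i) -> f i = 0) ->
  summable (fun j => f (e j)) -> tsum f = tsum (fun j => f (e j)).
Proof. move=> *; apply: has_sum_tsum; exact: has_sum_extend. Qed.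

End Reindexing.

Lemma tsum_bij {I J : Type} (f : I -> Complex.C) (e : J -> I) (d : I -> J) :
  (forall j, d (e j) = j) -> (forall i, e (d i) = i) -> summable f ->
  tsum f = tsum (fun j => f (e j)).
Proof.
  move=> de ed Sf. have inj : injective_map e by move=> x y E; rewrite -(de x) E de.
  apply: tsum_extend => //; last exact: summable_comp.
  move=> i Hi. by case: (Hi (d i)).
Qed.

(** [f] is the sum of its two restrictions, each extended by zero to the whole index type. *)
Lemma tsum_split2 {I J K : Type} (f : I -> Complex.C) (e0 : J -> I) (e1 : K -> I) :
  injective_map e0 -> injective_map e1 -> (forall j k, e0 j <> e1 k) ->
  (forall i, (exists j, e0 j = i) \/ (exists k, e1 k = i)) -> summable f ->
  tsum f = tsum (fun j => f (e0 j)) + tsum (fun k => f (e1 k)).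
Proof.
  move=> inj0 inj1 dis cov Sf.
  pose f0 i := match excluded_middle_informative (exists j, e0 j = i) with left _ => f i | right _ => 0 end.
  pose f1 i := match excluded_middle_informative (exists j, e1 j = i) with left _ => f i | right _ => 0 end.
  have E0 j : f0 (e0 j) = f (e0 j).
  { rewrite /f0; case: excluded_middle_informative => // H. exfalso; apply: H; by exists j. }
  have E1 j : f1 (e1 j) = f (e1 j).
  { rewrite /f1; case: excluded_middle_informative => // H. exfalso; apply: H; by exists j. }
  have S0 : summable f0.
  { apply: summable_le Sf => i. rewrite /f0; case: excluded_middle_informative => _; first lra.
    rewrite Cmod_0; exact: Cmod_ge_0. }
  have S1 : summable f1.
  { apply: summable_le Sf => i. rewrite /f1; case: excluded_middle_informative => _; first lra.
    rewrite Cmod_0; exact: Cmod_ge_0. }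
  rewrite -(tsum_ext _ _ E0) -(tsum_ext _ _ E1).
  rewrite -(tsum_extend f0 e0) //; first last.
  - exact: summable_comp.
  - move=> i Hi. rewrite /f0; case: excluded_middle_informative => // -[j /Hi] //.
  rewrite -(tsum_extend f1 e1) //; first last.
  - exact: summable_comp.
  - move=> i Hi. rewrite /f1; case: excluded_middle_informative => // -[j /Hi] //.
  rewrite -tsum_plus //. apply: tsum_ext => i. rewrite /f0 /f1.
  case: excluded_middle_informative => [[j Hj]|H0]; case: excluded_middle_informative => [[k Hk]|H1].
  - exfalso; apply: (dis j k); congruence.
  - ring.
  - ring.
  - by case: (cov i).
Qed.

Section Fubini.
Context {A B : Type}.

Lemma row_summable (f : A * B -> Complex.C) a : summable f -> summable (fun b => f (a, b)).
Proof. apply: (summable_comp f (fun b => (a, b))). by move=> x y [=]. Qed.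

(** Finitely many cells replace finitely many full rows at a cost of [eta] per row. The bound on
    absolute values gives summability of the row sums, the bound on the difference gives Fubini;
    [L0] stands for cells on which the total is already nearly attained. *)
Lemma rows_approx (f : A * B -> Complex.C) (L0 : list (A * B)) (eta : R) (lA : list A) :
  summable f -> (0 < eta)%R -> NoDup lA -> exists L, NoDup L /\
  (forall x, In x L -> In (fst x) lA) /\
  (forall x, In x L0 -> In (fst x) lA -> In x L) /\
  (Cmod (lsum f L - lsum (fun a => tsum (fun b => f (a, b))) lA) <= eta * INR (length lA))%R /\
  (asum (fun a => tsum (fun b => f (a, b))) lA <= asum f L + eta * INR (length lA))%R.
Proof.
  move=> Sf epos. elim: lA => [|a lA IH] nd.
  - exists nil; split; first by constructor.
    do 2 (split=> //). split; rewrite /= ?Rmult_0_r; last lra.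
    replace (0 - 0) with (RtoC 0) by ring. rewrite Cmod_0; lra.
  - inversion nd as [|? ? na nd']; subst. have [L [nL [H1 [H2 [H3 H4]]]]] := IH nd'.
    have [l0 [nl0 Hl0]] := summable_has_sum _ (row_summable f a Sf) _ epos.
    (* Taking every second coordinate of [L0] guarantees that the cells of [L0] lying in row [a] are
       among those chosen. *)
    pose la := lunion (l0 ++ map snd L0).
    have nla : NoDup la by exact: lunion_NoDup.
    have {}Hl0 : (Cmod (lsum (fun b => f (a, b)) la - tsum (fun b => f (a, b))) < eta)%R.
    { apply: Hl0 => // x Hx. apply/lunion_In; apply: in_or_app; by left. }
    have El : lsum f (map (pair a) la) = lsum (fun b => f (a, b)) la.
    { elim: la {nla Hl0} => //= b la ->. done. }
    have Ea : asum f (map (pair a) la) = asum (fun b => f (a, b)) la.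
    { elim: la {nla Hl0 El} => //= b la ->. done. }
    exists (map (pair a) la ++ L); split; [|split; [|split; [|split]]].
    + apply: NoDup_app => //.
      * apply: NoDup_map_inj => //. by move=> x y [=].
      * move=> x /in_map_iff [b [<- _]] /H1. exact: na.
    + move=> x /in_app_iff [/in_map_iff [b [<- _]]|/H1 ?]; [by left | by right].
    + move=> x Hx /= [E|Hin]; apply/in_app_iff; [left | right; exact: H2].
      apply/in_map_iff; exists (snd x); split; first by rewrite E; case: (x).
      apply/lunion_In; apply: in_or_app; right. exact: in_map.
    + rewrite lsum_app El [length _]/= S_INR /=.
      set g := (fun a : A => _) in H3 *. set s := tsum _ in Hl0 *.
      replace (lsum (fun b => f (a, b)) la + lsum f L - (s + lsum g lA))
        with ((lsum (fun b => f (a, b)) la - s) + (lsum f L - lsum g lA)) by ring.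
      have := Cmod_triangle (lsum (fun b => f (a, b)) la - s) (lsum f L - lsum g lA). lra.
    + rewrite asum_app Ea [length _]/= S_INR /=.
      set s := tsum _ in Hl0 *.
      have h := Cmod_lsum (fun b => f (a, b)) la.
      have := Cmod_triangle (lsum (fun b => f (a, b)) la) (- (lsum (fun b => f (a, b)) la - s)).
      rewrite Cmod_opp.
      replace (lsum (fun b => f (a, b)) la + - (lsum (fun b => f (a, b)) la - s)) with s by ring.
      lra.
Qed.

Lemma summable_rows (f : A * B -> Complex.C) : summable f ->
  summable (fun a => tsum (fun b => f (a, b))).
Proof.
  move=> Sf. have [M HM] := Sf. exists M => lA nd.
  apply: le_epsilon => eps pos.
  have pl : (0 < INR (length lA) + 1)%R by have := pos_INR (length lA); lra.
  have [L [nL [_ [_ [_ H]]]]] := rows_approx f nil (eps / (INR (length lA) + 1)) lA Sf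
    (Rdiv_lt_0_compat _ _ pos pl) nd.
  have := HM _ nL.
  have : (eps / (INR (length lA) + 1) * INR (length lA) <= eps)%R.
  { have E : (eps = eps / (INR (length lA) + 1) * (INR (length lA) + 1))%R by field; lra.
    rewrite {2}E. apply Rmult_le_compat_l; last lra. left; exact: Rdiv_lt_0_compat. }
  lra.
Qed.

Lemma tsum_fubini (f : A * B -> Complex.C) : summable f ->
  tsum f = tsum (fun a => tsum (fun b => f (a, b))).
Proof.
  move=> Sf. symmetry. apply: has_sum_tsum => eps pos.
  have pos2 : (0 < eps / 2)%R by lra.
  have [L0 [nL0 H0]] := summable_has_sum _ Sf _ pos2.
  exists (lunion (map fst L0)); split; first exact: lunion_NoDup.
  move=> lA nd inc.
  have pl : (0 < INR (length lA) + 1)%R by have := pos_INR (length lA); lra.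
  have [L [nL [_ [H2 [H3 _]]]]] := rows_approx f L0 (eps / 2 / (INR (length lA) + 1)) lA Sf
    (Rdiv_lt_0_compat _ _ pos2 pl) nd.
  have inc' : incl L0 L.
  { move=> x Hx; apply: H2 => //; apply: inc; apply/lunion_In; exact: in_map. }
  have {}H0 := H0 _ nL inc'.
  have h : (eps / 2 / (INR (length lA) + 1) * INR (length lA) <= eps / 2)%R.
  { have E : (eps / 2 = eps / 2 / (INR (length lA) + 1) * (INR (length lA) + 1))%R by field; lra.
    rewrite {2}E. apply Rmult_le_compat_l; last lra. left; exact: Rdiv_lt_0_compat. }
  set g := (fun a : A => _) in H3 *.
  have := Cmod_triangle (- (lsum f L - lsum g lA)) (lsum f L - tsum f). rewrite Cmod_opp.
  replace (- (lsum f L - lsum g lA) + (lsum f L - tsum f)) with (lsum g lA - tsum f) by ring.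
  lra.
Qed.

Lemma summable_prod (f : A -> Complex.C) (g : B -> Complex.C) : summable f -> summable g ->
  summable (fun x : A * B => f (fst x) * g (snd x)).
Proof.
  move=> [M HM] [N HN]. exists (M * N)%R => l nd.
  set F := (fun x : A * B => _).
  pose la := lunion (map fst l). pose lb := lunion (map snd l).
  have inc : incl l (list_prod la lb).
  { move=> [a b] Hx. apply/in_prod_iff; split; apply/lunion_In.
    - exact: (in_map fst _ _ Hx).
    - exact: (in_map snd _ _ Hx). }
  apply: Rle_trans (asum_incl F _ _ nd inc) _.
  have -> : asum F (list_prod la lb) = (asum f la * asum g lb)%R.
  { elim: la {inc} => [|a la IH] /=; first ring.
    rewrite asum_app IH Rmult_plus_distr_r. f_equal.
    elim: lb {IH} => [|b lb IH] /=; first ring.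
    rewrite IH /F /= Cmod_mult. ring. }
  apply: Rmult_le_compat; try exact: asum_ge0.
  - apply: HM; exact: lunion_NoDup.
  - apply: HN; exact: lunion_NoDup.
Qed.

Lemma tsum_prod (f : A -> Complex.C) (g : B -> Complex.C) : summable f -> summable g ->
  tsum (fun x : A * B => f (fst x) * g (snd x)) = tsum f * tsum g.
Proof.
  move=> Sf Sg. rewrite tsum_fubini /=; last exact: summable_prod.
  rewrite (tsum_ext _ (fun a => tsum g * f a)); first by rewrite tsum_scal // Cmult_comm.
  move=> a. by rewrite tsum_scal // Cmult_comm.
Qed.

End Fubini.

Lemma tsum_swap {A B : Type} (f : A * B -> Complex.C) : summable f ->
  tsum (fun a => tsum (fun b => f (a, b))) = tsum (fun b => tsum (fun a => f (a, b))).
Proof.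
  move=> Sf. rewrite -tsum_fubini //.
  have inj : injective_map (fun x : B * A => (snd x, fst x)) by move=> [a b] [c d] [= -> ->].
  rewrite (tsum_bij f (fun x => (snd x, fst x)) (fun x => (snd x, fst x))) //; try by case.
  by rewrite tsum_fubini; last exact: (summable_comp f _ inj Sf).
Qed.

(** * Dominated convergence for unconditional sums *)

Section Tannery.
Context {I : Type}.

(** The finite set is chosen for the dominating family [G] alone, hence it serves all dominated
    families uniformly; this is what interchanging limit and sum requires. *)
Lemma summable_tail (G : I -> Complex.C) eps : summable G -> (0 < eps)%R ->
  exists l0, NoDup l0 /\ forall h : I -> Complex.C, (forall i, (Cmod (h i) <= Cmod (G i))%R) ->
    (Cmod (tsum h - lsum h l0) <= eps)%R.
Proof.
  move=> SG pos. have [B HB] := SG.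
  pose E := fun x : R => exists l, NoDup l /\ x = asum G l.
  have bE : bound E by exists B => x [l [nd ->]]; exact: HB.
  have neE : exists x, E x by exists 0%R; exists nil; split=> //; constructor.
  have [s [ub lub]] := completeness E bE neE.
  have [l0 [nd0 H0]] : exists l, NoDup l /\ (s - eps < asum G l)%R.
  { apply: NNPP => H. have : (s <= s - eps)%R; last lra.
    apply: lub => x [l [nd ->]]. apply: Rnot_lt_le => Hx. apply: H. by exists l. }
  exists l0; split=> // h Hh.
  have Sh : summable h by exact: summable_le SG.
  apply: le_epsilon => d dpos.
  have [l1 [nd1 H1]] := summable_has_sum _ Sh _ dpos.
  pose l := lunion (l0 ++ l1). have ndl : NoDup l by exact: lunion_NoDup.
  have {}H1 : (Cmod (lsum h l - tsum h) < d)%R.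
  { apply: H1 => // x Hx; apply/lunion_In; apply: in_or_app; by right. }
  have [l' P] : exists l', Permutation l (l0 ++ l').
  { apply: NoDup_incl_split => // x Hx; apply/lunion_In; apply: in_or_app; by left. }
  have h1 : (asum G l <= s)%R by apply: ub; exists l.
  rewrite (asum_perm _ _ _ P) asum_app in h1.
  rewrite (lsum_perm _ _ _ P) lsum_app in H1.
  have h2 := Cmod_lsum h l'. have h3 := asum_le h G l' (fun i _ => Hh i).
  have := Cmod_triangle (- (lsum h l0 + lsum h l' - tsum h)) (lsum h l').
  rewrite Cmod_opp.
  replace (- (lsum h l0 + lsum h l' - tsum h) + lsum h l') with (tsum h - lsum h l0) by ring.
  lra.
Qed.

Lemma lsum_cv (u : nat -> I -> Complex.C) (f : I -> Complex.C) l :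
  (forall i, Ccv (fun n => u n i) (f i)) -> Ccv (fun n => lsum (u n) l) (lsum f l).
Proof.
  move=> H. elim: l => [|a l IH] eps pos.
  - exists 0%nat => n _ /=. replace (0 - 0) with (RtoC 0) by ring. by rewrite Cmod_0.
  - have pos2 : (0 < eps / 2)%R by lra.
    have [N1 H1] := H a _ pos2. have [N2 H2] := IH _ pos2.
    exists (N1 + N2)%nat => n Hn /=.
    have {}H1 := H1 n ltac:(lia). have {}H2 := H2 n ltac:(lia).
    have := Cmod_triangle (u n a - f a) (lsum (u n) l - lsum f l).
    replace (u n a - f a + (lsum (u n) l - lsum f l))
      with (u n a + lsum (u n) l - (f a + lsum f l)) by ring. lra.
Qed.

Lemma Ccv_Cmod_le (u : nat -> Complex.C) l M : Ccv u l -> (forall n, (Cmod (u n) <= M)%R) ->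
  (Cmod l <= M)%R.
Proof.
  move=> H HM. apply: le_epsilon => eps pos. have [N HN] := H _ pos.
  have {}HN := HN N (Nat.le_refl _). have h := HM N.
  have := Cmod_triangle (u N) (- (u N - l)). rewrite Cmod_opp.
  replace (u N + - (u N - l)) with l by ring. lra.
Qed.

Lemma tannery (u : nat -> I -> Complex.C) (f G : I -> Complex.C) : summable G ->
  (forall n i, (Cmod (u n i) <= Cmod (G i))%R) -> (forall i, Ccv (fun n => u n i) (f i)) ->
  Ccv (fun n => tsum (u n)) (tsum f).
Proof.
  move=> SG HG Hc eps pos.
  have pos3 : (0 < eps / 4)%R by lra.
  have [l0 [nd H0]] := summable_tail G _ SG pos3.
  have [N HN] := lsum_cv u f l0 Hc _ pos3.
  exists N => n /HN h1. have h2 := H0 (u n) (HG n).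
  have h3 : (Cmod (tsum f - lsum f l0) <= eps / 4)%R.
  { apply: H0 => i. exact: (Ccv_Cmod_le _ _ _ (Hc i) (fun n => HG n i)). }
  have t1 := Cmod_triangle (tsum (u n) - lsum (u n) l0) (lsum (u n) l0 - lsum f l0).
  have t2 := Cmod_triangle (tsum (u n) - lsum (u n) l0 + (lsum (u n) l0 - lsum f l0))
    (- (tsum f - lsum f l0)).
  rewrite Cmod_opp in t2.
  replace (tsum (u n) - tsum f) with
    (tsum (u n) - lsum (u n) l0 + (lsum (u n) l0 - lsum f l0) + - (tsum f - lsum f l0)) by ring.
  lra.
Qed.

End Tannery.

Lemma csum_lsum f N : csum f N = lsum f (List.seq 0 N).
Proof.
  elim: N => [|N IH]; first by [].
  rewrite List.seq_S lsum_app /= IH. ring.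
Qed.

Lemma NoDup_list_prod {A B : Type} (la : list A) (lb : list B) :
  NoDup la -> NoDup lb -> NoDup (list_prod la lb).
Proof.
  move=> nda ndb. elim: nda => [|a l na nd IH] /=; first by constructor.
  apply: NoDup_app => //.
  - apply: NoDup_map_inj => //. by move=> x y [=].
  - by move=> [x y] /in_map_iff [b [[<- _] _]] /in_prod_iff [].
Qed.

Lemma lsum_list_prod {A B : Type} (f : A * B -> Complex.C) la lb :
  lsum f (list_prod la lb) = lsum (fun a => lsum (fun b => f (a, b)) lb) la.
Proof.
  elim: la => [|a la IH] //=. rewrite lsum_app IH. f_equal.
  elim: lb {IH} => [|b lb IH] //=. by rewrite IH.
Qed.

(** Every finite set of index pairs is contained in all sufficiently large squares. *)
Lemma sq_partial_cv (f : nat -> nat -> Complex.C) :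
  summable (fun x : nat * nat => f (fst x) (snd x)) ->
  Ccv (sq_partial f) (tsum (fun x : nat * nat => f (fst x) (snd x))).
Proof.
  set F := (fun x : nat * nat => _). move=> SF eps pos.
  have [l0 [nd0 H0]] := summable_has_sum _ SF _ pos.
  have E N : sq_partial f N = lsum F (list_prod (List.seq 0 N) (List.seq 0 N)).
  { rewrite /sq_partial csum_lsum lsum_list_prod. apply: lsum_ext_in => i _.
    by rewrite csum_lsum. }
  have [N HN] : exists N, forall x, In x l0 -> (fst x < N /\ snd x < N)%nat.
  { elim: l0 {nd0 H0} => [|a l [N IH]]; first by exists 0%nat.
    exists (S (N + fst a + snd a))%nat => x [<-|/IH]; lia. }
  exists N => n Hn. rewrite E. apply: H0.
  - apply: NoDup_list_prod; exact: seq_NoDup.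
  - move=> [x y] /HN /= h. apply/in_prod_iff; rewrite !in_seq; lia.
Qed.

(** * Limits *)

Lemma Ccv_unique u l l' : Ccv u l -> Ccv u l' -> l = l'.
Proof.
  move=> H H'. apply: NNPP => ne.
  have pos : (0 < Cmod (l - l') / 2)%R.
  { apply: Rdiv_lt_0_compat; last lra. apply Cmod_gt_0 => E. apply: ne.
    replace l with (l - l' + l') by ring. rewrite E; ring. }
  have [N HN] := H _ pos. have [M HM] := H' _ pos.
  have {}HN := HN (N + M)%nat ltac:(lia). have {}HM := HM (N + M)%nat ltac:(lia).
  have := Cmod_triangle (- (u (N + M)%nat - l)) (u (N + M)%nat - l'). rewrite Cmod_opp.
  replace (- (u (N + M)%nat - l) + (u (N + M)%nat - l')) with (l - l') by ring. lra.
Qed.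

Lemma Ccv_ext u v l : (forall n, u n = v n) -> Ccv u l -> Ccv v l.
Proof. move=> E H eps /H [N HN]; exists N => n /HN. by rewrite E. Qed.

Lemma Ccv_const c : Ccv (fun _ => c) c.
Proof.
  move=> eps pos; exists 0%nat => n _. replace (c - c) with (RtoC 0) by ring. by rewrite Cmod_0.
Qed.

Lemma Ccv_scal c u l : Ccv u l -> Ccv (fun n => c * u n) (c * l).
Proof.
  move=> H eps pos.
  have pc : (0 < Cmod c + 1)%R by have := Cmod_ge_0 c; lra.
  have [N HN] := H (eps / (Cmod c + 1))%R (Rdiv_lt_0_compat _ _ pos pc).
  exists N => n /HN h. replace (c * u n - c * l) with (c * (u n - l)) by ring.
  rewrite Cmod_mult.
  apply: (Rle_lt_trans _ ((Cmod c + 1) * Cmod (u n - l))).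
  - have := Cmod_ge_0 (u n - l); have := Cmod_ge_0 c; nra.
  - apply: (Rlt_le_trans _ ((Cmod c + 1) * (eps / (Cmod c + 1)))).
    + exact: Rmult_lt_compat_l.
    + right; field; lra.
Qed.

Lemma Ccv_plus u v l m : Ccv u l -> Ccv v m -> Ccv (fun n => u n + v n) (l + m).
Proof.
  move=> Hu Hv eps pos. have pos2 : (0 < eps / 2)%R by lra.
  have [N1 H1] := Hu _ pos2. have [N2 H2] := Hv _ pos2.
  exists (N1 + N2)%nat => n Hn.
  have {}H1 := H1 n ltac:(lia). have {}H2 := H2 n ltac:(lia).
  have := Cmod_triangle (u n - l) (v n - m).
  replace (u n - l + (v n - m)) with (u n + v n - (l + m)) by ring. lra.
Qed.

Lemma Ccv_mult0 u v : Ccv u 0 -> Ccv v 0 -> Ccv (fun n => u n * v n) 0.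
Proof.
  move=> Hu Hv eps pos. have [N1 H1] := Hu _ pos. have [N2 H2] := Hv 1%R Rlt_0_1.
  exists (N1 + N2)%nat => n Hn.
  have {}H1 := H1 n ltac:(lia). have {}H2 := H2 n ltac:(lia). move: H1 H2.
  replace (u n - 0) with (u n) by ring. replace (v n - 0) with (v n) by ring.
  replace (u n * v n - 0) with (u n * v n) by ring. rewrite Cmod_mult.
  have := Cmod_ge_0 (u n). have := Cmod_ge_0 (v n). nra.
Qed.

Lemma Ccv_minus u l : Ccv u l -> Ccv (fun n => u n - l) 0.
Proof.
  move=> H eps /H [N HN]; exists N => n /HN. by replace (u n - l - 0) with (u n - l) by ring.
Qed.

Lemma Ccv_mult u v l m : Ccv u l -> Ccv v m -> Ccv (fun n => u n * v n) (l * m).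
Proof.
  move=> Hu Hv.
  have H0 := Ccv_mult0 _ _ (Ccv_minus _ _ Hu) (Ccv_minus _ _ Hv).
  have H := Ccv_plus _ _ _ _ (Ccv_plus _ _ _ _ (Ccv_scal l _ _ Hv) (Ccv_scal m _ _ (Ccv_minus _ _ Hu))) H0.
  replace (l * m) with (l * m + m * 0 + 0) by ring.
  apply: Ccv_ext H => n. ring.
Qed.

Lemma Ccv_inv1 u : Ccv u 1 -> Ccv (fun n => / u n) 1.
Proof.
  move=> H eps pos.
  have pm : (0 < Rmin (1 / 2) (eps / 2))%R by apply: Rmin_glb_lt; lra.
  have [N HN] := H _ pm. exists N => n /HN h.
  have h1 : (Cmod (u n - 1) < 1 / 2)%R by apply: Rlt_le_trans h (Rmin_l _ _).
  have h2 : (Cmod (u n - 1) < eps / 2)%R by apply: Rlt_le_trans h (Rmin_r _ _).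
  have h3 : (1 / 2 <= Cmod (u n))%R.
  { have := Cmod_triangle (u n) (- (u n - 1)). rewrite Cmod_opp.
    replace (u n + - (u n - 1)) with (RtoC 1) by ring. rewrite Cmod_1; lra. }
  have nz : u n <> 0 by move=> E; rewrite E Cmod_0 in h3; lra.
  replace (/ u n - 1) with (- (u n - 1) * / u n) by (field; exact: nz).
  rewrite Cmod_mult Cmod_opp Cmod_inv //.
  have h4 : (/ Cmod (u n) <= 2)%R.
  { replace 2%R with (/ (1 / 2))%R by field. apply: Rinv_le_contravar; lra. }
  have := Cmod_ge_0 (u n - 1). nra.
Qed.

Lemma Ccv_subseq u l (k : nat) : (0 < k)%nat -> Ccv u l -> Ccv (fun n => u (k * n)%nat) l.
Proof. move=> pk H eps /H [N HN]; exists N => n Hn. apply: HN. nia. Qed.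

Lemma Ccv_filterlim u l : Ccv u l -> filterlim u eventually (locally l).
Proof.
  move=> H. apply filterlim_locally => eps.
  have [N HN] := H _ (cond_pos eps). exists N => n /HN h.
  exact: C_NormedModule_mixin_compat1.
Qed.

Lemma Clim_eq u l : Ccv u l -> Clim u = l.
Proof.
  move=> H. have Hf := Ccv_filterlim _ _ H.
  have PF : ProperFilter (filtermap u eventually) by apply: filtermap_proper_filter; exact: eventually_filter.
  apply: (Ccv_unique u) => // eps pos.
  (* The balls of C as a product space control each coordinate separately; passing from them to
     [Cmod] costs a factor [sqrt 2]. *)
  have ps : (0 < sqrt 2)%R by apply: sqrt_lt_R0; lra.
  have pe : (0 < eps / (sqrt 2))%R by exact: Rdiv_lt_0_compat.
  have := @complete_cauchy (CompleteNormedModule.CompleteSpace _ C_CompleteNormedModule)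
    (filtermap u eventually) PF.
  move=> /(_ _ (mkposreal _ pe)) [].
  - move=> e. exists l. exact: (Hf _ (locally_ball l e)).
  - move=> N HN. exists N => n Hn.
    have := C_NormedModule_mixin_compat2 _ _ _ (HN n Hn) => /=.
    by replace (sqrt 2 * (eps / sqrt 2))%R with eps by (field; lra).
Qed.

(** * Integer powers and the summability of theta series *)

Infix "^^" := Cpowz (at level 30, right associativity) : C_scope.

Implicit Types (q z : Complex.C).

Lemma Cpowz_nat q n : q ^^ Z.of_nat n = q ^ n.
Proof.
  rewrite /Cpowz. have -> : (0 <=? Z.of_nat n)%Z = true by apply/Z.leb_le; lia.
  by rewrite Nat2Z.id.
Qed.

Lemma Cpowz_pos q n : (0 <= n)%Z -> q ^^ n = q ^ Z.to_nat n.
Proof. move=> H. by rewrite -Cpowz_nat Z2Nat.id. Qed.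

Lemma Cpowz_0 q : q ^^ 0 = 1.
Proof. by []. Qed.

Lemma Cpowz_1 q : q ^^ 1 = q.
Proof. rewrite Cpowz_pos //=. ring. Qed.

Lemma Cpowz_succ q n : q <> 0 -> q ^^ (n + 1) = q * q ^^ n.
Proof.
  move=> nz. rewrite /Cpowz.
  case: (Z.leb_spec 0 n) => h.
  - have -> : (0 <=? n + 1)%Z = true by apply/Z.leb_le; lia.
    have -> : Z.to_nat (n + 1) = S (Z.to_nat n) by lia. by rewrite Cpow_S.
  - case: (Z.leb_spec 0 (n + 1)) => h1.
    + have -> : n = (- 1)%Z by lia. rewrite Cpow_1_r /=. field. exact: nz.
    + have -> : Z.to_nat (- n) = S (Z.to_nat (- (n + 1))) by lia.
      rewrite Cpow_S. field. split=> //. exact: Cpow_nz.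
Qed.

Lemma Cpowz_nz q n : q <> 0 -> q ^^ n <> 0.
Proof.
  move=> nz. rewrite /Cpowz. case: (Z.leb_spec 0 n) => h; first exact: Cpow_nz.
  move=> E. have h1 : q ^ Z.to_nat (- n) <> 0 by exact: Cpow_nz.
  have : q ^ Z.to_nat (- n) * / q ^ Z.to_nat (- n) = 1 by field.
  rewrite E Cmult_0_r => /(f_equal fst) /=; lra.
Qed.

Lemma Cpowz_add q m n : q <> 0 -> q ^^ (m + n) = q ^^ m * q ^^ n.
Proof.
  move=> nz. elim/Z.peano_ind: n m => [|n IH|n IH] m.
  - rewrite Z.add_0_r Cpowz_0; ring.
  - have -> : (m + Z.succ n = (m + n) + 1)%Z by lia. rewrite Cpowz_succ // IH.
    rewrite -Z.add_1_r Cpowz_succ //. ring.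
  - have E : forall k, q ^^ Z.pred k = / q * q ^^ k.
    { move=> k. have {2}-> : (k = Z.pred k + 1)%Z by lia. rewrite Cpowz_succ //. by field. }
    have -> : (m + Z.pred n = Z.pred (m + n))%Z by lia. rewrite !E IH. ring.
Qed.

Lemma Cpowz_opp q n : q <> 0 -> q ^^ (- n) = / q ^^ n.
Proof.
  move=> nz. have h := Cpowz_nz q n nz.
  have : q ^^ n * q ^^ (- n) = 1 by rewrite -Cpowz_add // Z.add_opp_diag_r.
  move=> E. replace (q ^^ (- n)) with (/ q ^^ n * (q ^^ n * q ^^ (- n))) by (field; exact: h).
  rewrite E; ring.
Qed.

Lemma Cpowz_sub q m n : q <> 0 -> q ^^ (m - n) = q ^^ m / q ^^ n.
Proof. move=> nz. by rewrite -Z.add_opp_r Cpowz_add // Cpowz_opp. Qed.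

Lemma Cpowz_mul q m n : q <> 0 -> (q ^^ m) ^^ n = q ^^ (m * n).
Proof.
  move=> nz. have nz' := Cpowz_nz q m nz.
  elim/Z.peano_ind: n => [|n IH|n IH].
  - by rewrite Z.mul_0_r.
  - by rewrite -Z.add_1_r Cpowz_add // IH Cpowz_1 -Cpowz_add //; f_equal; lia.
  - by rewrite -Z.sub_1_r Cpowz_sub // IH Cpowz_1 -Cpowz_sub //; f_equal; lia.
Qed.

Lemma Cpowz_mul_base (x y : Complex.C) n : x <> 0 -> y <> 0 -> (x * y) ^^ n = x ^^ n * y ^^ n.
Proof.
  move=> nx ny. rewrite /Cpowz. case: (0 <=? n)%Z; first exact: Cpow_mult_l.
  rewrite Cpow_mult_l. field. split; exact: Cpow_nz.
Qed.

Lemma Cpowz_pow q k n : q <> 0 -> (q ^ k) ^^ n = q ^^ (Z.of_nat k * n).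
Proof. move=> nz. by rewrite -Cpowz_nat Cpowz_mul. Qed.

Lemma Cm1_nz : - (1) <> 0.
Proof. move=> /(f_equal fst) /=; lra. Qed.

Lemma sgn_even n : (- (1)) ^^ (2 * n) = 1.
Proof.
  have nz := Cm1_nz. rewrite -Cpowz_mul //.
  have -> : (- (1)) ^^ 2 = 1 by rewrite Cpowz_pos //=; ring.
  rewrite /Cpowz. case: (0 <=? n)%Z; rewrite Cpow_1_l //. field.
Qed.

Lemma Cpowz_opp_base (x : Complex.C) n : x <> 0 -> (- x) ^^ n = (- (1)) ^^ n * x ^^ n.
Proof.
  move=> nz. rewrite -Cpowz_mul_base //; last exact: Cm1_nz. f_equal; ring.
Qed.

Lemma Cmod_Cpowz q n : (0 <= n)%Z -> Cmod (q ^^ n) = (Cmod q ^ Z.to_nat n)%R.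
Proof. move=> H. by rewrite Cpowz_pos // Cmod_pow. Qed.

Lemma Cmod_sgn n : Cmod ((- (1)) ^^ n) = 1%R.
Proof.
  have nz := Cm1_nz. rewrite /Cpowz. case: (0 <=? n)%Z.
  - by rewrite Cmod_pow Cmod_m1 pow1.
  - rewrite Cmod_inv; last exact: Cpow_nz. by rewrite Cmod_pow Cmod_m1 pow1 Rinv_1.
Qed.

Definition tri (n : Z) : Z := (n * (n - 1) / 2)%Z.

Lemma tri2 n : (2 * tri n = n * (n - 1))%Z.
Proof.
  rewrite /tri. have [k [->|->]] : exists k, (n = 2 * k \/ n = 2 * k + 1)%Z.
  { exists (n / 2)%Z. have := Z.div_mod n 2. have := Z.mod_pos_bound n 2. lia. }
  - have -> : (2 * k * (2 * k - 1) = (k * (2 * k - 1)) * 2)%Z by ring.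
    rewrite Z.div_mul //. ring.
  - have -> : ((2 * k + 1) * (2 * k + 1 - 1) = ((2 * k + 1) * k) * 2)%Z by ring.
    rewrite Z.div_mul //. ring.
Qed.

(* Generalising each [tri x] with [2 * tri x = x * (x - 1)] leaves a goal linear in the monomials. *)
Ltac trilia :=
  repeat match goal with
  | |- context [tri ?x] =>
      let t := fresh "t" in let E := fresh "E" in
      pose proof (tri2 x) as E; set (t := tri x) in *; clearbody t
  end; try lia; try nia.

Lemma tri_succ n : tri (n + 1) = (tri n + n)%Z.
Proof. trilia. Qed.

Lemma tri_nonneg n : (0 <= tri n)%Z.
Proof. have := tri2 n. have [h|h] : (n <= 0 \/ 1 <= n)%Z by lia. all: nia. Qed.

(** The difference of the two sides is [tri (n - k)]. *)
Lemma tri_ge n k : (k * n - tri (k + 1) <= tri n)%Z.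
Proof. have := tri_nonneg (n - k). trilia. Qed.

Definition geo (r : R) (n : Z) : Complex.C := RtoC (r ^ Z.abs_nat n).

Lemma pow_le_anti r m n : (0 <= r <= 1)%R -> (m <= n)%nat -> (r ^ n <= r ^ m)%R.
Proof.
  move=> H Hmn. have -> : n = (m + (n - m))%nat by lia. rewrite pow_add.
  have h1 : (0 <= r ^ m)%R by apply: pow_le; lra.
  have h2 : (r ^ (n - m) <= 1)%R by rewrite -(pow1 (n - m)); apply: pow_incr; lra.
  nra.
Qed.

Lemma geo_sum_bound r N : (0 <= r < 1)%R ->
  (asum (fun k : nat => RtoC (r ^ k)) (List.seq 0 N) <= / (1 - r))%R.
Proof.
  move=> H. have -> : asum (fun k : nat => RtoC (r ^ k)) (List.seq 0 N) = ((1 - r ^ N) / (1 - r))%R.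
  { elim: N => [|N IH]; first by rewrite /=; field; lra.
    rewrite List.seq_S asum_app IH /= Cmod_R Rabs_pos_eq; last by apply: pow_le; lra.
    field; lra. }
  have h : (0 <= r ^ N)%R by apply: pow_le; lra.
  rewrite -[X in (_ <= X)%R]Rmult_1_l. apply Rmult_le_compat_r; last lra.
  left; apply: Rinv_0_lt_compat; lra.
Qed.

Lemma summable_geo r : (0 <= r < 1)%R -> summable (geo r).
Proof.
  move=> H. exists (/ (1 - r) + / (1 - r))%R => l nd.
  have [N HN] : exists N, forall x, In x l -> (Z.abs_nat x < N)%nat.
  { elim: l {nd} => [|a l [N IH]]; first by exists 0%nat.
    exists (S (N + Z.abs_nat a))%nat => x [<-|/IH]; lia. }
  pose L := map Z.of_nat (List.seq 0 N) ++ map (fun k => (- Z.of_nat k)%Z) (List.seq 0 N).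
  have inc : incl l L.
  { move=> x /HN h. apply/in_app_iff. case: (Z.leb_spec 0 x) => hx; [left | right];
    apply/in_map_iff; exists (Z.abs_nat x); (split; [lia | apply/in_seq; lia]). }
  apply: Rle_trans (asum_incl _ _ _ nd inc) _.
  rewrite asum_app. apply: Rplus_le_compat.
  - apply: Rle_trans (geo_sum_bound r N H). right.
    elim: (List.seq 0 N) => //= k s ->. by rewrite /geo Zabs2Nat.id.
  - apply: Rle_trans (geo_sum_bound r N H). right.
    elim: (List.seq 0 N) => //= k s ->. rewrite /geo. by have -> : Z.abs_nat (- Z.of_nat k) = k by lia.
Qed.

Lemma summable_geo2 r : (0 <= r < 1)%R ->
  summable (fun x : Z * Z => geo r (fst x) * geo r (snd x)).
Proof. move=> H. apply: (summable_prod (geo r) (geo r)); exact: summable_geo. Qed.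

Lemma Cmod_geo r n : (0 <= r)%R -> Cmod (geo r n) = (r ^ Z.abs_nat n)%R.
Proof. move=> H. rewrite /geo Cmod_R Rabs_pos_eq //. exact: pow_le. Qed.

Lemma exists_pow_lt r eps : (0 <= r < 1)%R -> (0 < eps)%R -> exists N, (r ^ N < eps)%R.
Proof.
  move=> H pos. have ha : (Rabs r < 1)%R by rewrite Rabs_pos_eq; lra.
  have [N HN] := pow_lt_1_zero r ha eps pos. exists N.
  have := HN N (Nat.le_refl _). rewrite Rabs_pos_eq //. apply: pow_le; lra.
Qed.

(** Quadratic growth beats linear growth: [M] bounds both |z| and 1/|z|, [N] is taken so large that
    |q|^N M < 1, and [tri_ge] gives tri n >= N |n| - c with [c = tri (N + 1)]. Negative n are
    reached through tri n = tri (1 - n). *)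
Lemma theta_term_bound q z : q <> 0 -> z <> 0 -> (Cmod q < 1)%R -> exists K r, (0 < K)%R /\
  (0 <= r < 1)%R /\ forall n, (Cmod (q ^^ tri n * z ^^ n) <= K * r ^ Z.abs_nat n)%R.
Proof.
  move=> nq nz lq.
  have hq : (0 <= Cmod q < 1)%R by split=> //; exact: Cmod_ge_0.
  have pq : (0 < Cmod q)%R by apply Cmod_gt_0.
  have pz : (0 < Cmod z)%R by apply Cmod_gt_0.
  pose M := (Cmod z + / Cmod z)%R.
  have piz : (0 < / Cmod z)%R by exact: Rinv_0_lt_compat.
  have pM : (0 < M)%R by rewrite /M; lra.
  have [N HN] := exists_pow_lt (Cmod q) (/ M) hq (Rinv_0_lt_compat _ pM).
  pose r := (Cmod q ^ N * M)%R.
  have pN : (0 < Cmod q ^ N)%R by apply: pow_lt.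
  have hr : (0 <= r < 1)%R.
  { rewrite /r; split; first by left; exact: Rmult_lt_0_compat.
    rewrite -(Rinv_l M); last lra. exact: Rmult_lt_compat_r. }
  pose c := tri (Z.of_nat N + 1).
  exists (/ (Cmod q ^ Z.to_nat c))%R, r.
  have pc : (0 < Cmod q ^ Z.to_nat c)%R by exact: pow_lt.
  split; first exact: Rinv_0_lt_compat. split=> // n.
  have key : (Z.of_nat N * Z.abs n <= tri n + c)%Z.
  { case: (Z.leb_spec 0 n) => hn.
    - have := tri_ge n (Z.of_nat N). rewrite Z.abs_eq //. rewrite /c; lia.
    - have -> : tri n = tri (1 - n) by trilia.
      have := tri_ge (1 - n) (Z.of_nat N). rewrite Z.abs_neq; last lia. rewrite /c; nia. }
  have h1 : (Cmod q ^ Z.to_nat c * Cmod (q ^^ tri n) <= (Cmod q ^ N) ^ Z.abs_nat n)%R.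
  { rewrite Cmod_Cpowz //; last exact: tri_nonneg.
    rewrite -pow_add -pow_mult. apply: pow_le_anti; first lra.
    have := tri_nonneg n. have := tri_nonneg (Z.of_nat N + 1). rewrite -/c. nia. }
  have h2 : (Cmod (z ^^ n) <= M ^ Z.abs_nat n)%R.
  { rewrite /Cpowz. case: (Z.leb_spec 0 n) => hn.
    - rewrite Cmod_pow. have -> : Z.to_nat n = Z.abs_nat n by lia.
      apply: pow_incr. rewrite /M; lra.
    - rewrite Cmod_inv; last exact: Cpow_nz. rewrite Cmod_pow -pow_inv.
      have -> : Z.to_nat (- n) = Z.abs_nat n by lia.
      apply: pow_incr. rewrite /M; lra. }
  rewrite Cmod_mult /r Rpow_mult_distr.
  have h3 := Cmod_ge_0 (z ^^ n). have h4 := Cmod_ge_0 (q ^^ tri n).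
  have h5 : (0 <= (Cmod q ^ N) ^ Z.abs_nat n)%R by apply: pow_le; lra.
  have h6 : (Cmod (q ^^ tri n) <= / Cmod q ^ Z.to_nat c * (Cmod q ^ N) ^ Z.abs_nat n)%R.
  { apply: (Rmult_le_reg_l (Cmod q ^ Z.to_nat c)) => //.
    rewrite -Rmult_assoc Rinv_r ?Rmult_1_l //. lra. }
  rewrite -Rmult_assoc. apply: Rmult_le_compat => //.
Qed.

Lemma summable_theta q z : q <> 0 -> z <> 0 -> (Cmod q < 1)%R ->
  summable (fun n => q ^^ tri n * z ^^ n).
Proof.
  move=> nq nz lq. have [K [r [pK [hr H]]]] := theta_term_bound q z nq nz lq.
  apply: (summable_le _ (fun n => RtoC K * geo r n)).
  - move=> n. rewrite [X in (_ <= X)%R]Cmod_mult Cmod_R (Rabs_pos_eq K) ?Cmod_geo; try lra. exact: H.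
  - apply: summable_scal. exact: summable_geo.
Qed.

(** * q-Pochhammer symbols, Euler's identities and the triple product *)

Lemma one_minus_nz a : (Cmod a < 1)%R -> 1 - a <> 0.
Proof.
  move=> H E. have : a = 1 by replace a with (1 - (1 - a)) by ring; rewrite E; ring.
  move=> E1. rewrite E1 Cmod_1 in H. lra.
Qed.

Lemma Cmod_mul_pow_lt a q n : (Cmod q < 1)%R -> (Cmod a < 1)%R -> (Cmod (a * q ^ n) < 1)%R.
Proof.
  move=> lq la. rewrite Cmod_mult Cmod_pow.
  have h : (Cmod q ^ n <= 1)%R.
  { rewrite -(pow1 n); apply: pow_incr; split; [exact: Cmod_ge_0 | lra]. }
  have h0 : (0 <= Cmod q ^ n)%R by apply: pow_le; exact: Cmod_ge_0.
  have := Cmod_ge_0 a. nra.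
Qed.

Lemma qpoch_nz a q n : (Cmod q < 1)%R -> (Cmod a < 1)%R -> qpoch a q n <> 0.
Proof.
  move=> lq la. elim: n => [|n IH] /=.
  - move=> /(f_equal fst) /=; lra.
  - apply: Cmult_neq_0 => //. apply: one_minus_nz. exact: Cmod_mul_pow_lt.
Qed.

Lemma geo_partial_lt r n : (0 <= r < 1)%R -> (sum_f_R0 (fun k => r ^ k) n <= / (1 - r))%R.
Proof.
  move=> H. have e : r <> 1%R by lra.
  rewrite tech3 // /Rdiv -[X in (_ <= X)%R]Rmult_1_l. apply Rmult_le_compat_r.
  - left; apply: Rinv_0_lt_compat; lra.
  - have := pow_le r (S n); lra.
Qed.

(** Each factor is bounded by 1 + x <= exp x, and the exponents form a geometric series. *)
Lemma qpoch_bound a q : (Cmod q < 1)%R ->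
  exists K, (0 < K)%R /\ forall n, (Cmod (qpoch a q n) <= K)%R.
Proof.
  move=> lq. have hq : (0 <= Cmod q < 1)%R by split=> //; exact: Cmod_ge_0.
  have ha := Cmod_ge_0 a.
  have H n : (Cmod (qpoch a q (S n)) <= exp (Cmod a * sum_f_R0 (fun k => Cmod q ^ k) n))%R.
  { have step k : (Cmod (1 - a * q ^ k) <= exp (Cmod a * Cmod q ^ k))%R.
    { apply: Rle_trans (exp_ineq1_le _).
      have := Cmod_triangle 1 (- (a * q ^ k)). rewrite Cmod_1 Cmod_opp Cmod_mult Cmod_pow. done. }
    elim: n => [|n IH].
    - rewrite [qpoch _ _ _]/= -[X in (X <= _)%R]/(Cmod (1 * (1 - a * q ^ 0))) Cmult_1_l. exact: step.
    - rewrite [qpoch _ _ _]/= Cmod_mult [sum_f_R0 _ _]/= Rmult_plus_distr_l exp_plus.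
      apply: Rmult_le_compat; try exact: Cmod_ge_0; [exact: IH | exact: (step (S n))]. }
  exists (exp (Cmod a * / (1 - Cmod q))); split; first exact: exp_pos.
  have m : forall n, (exp (Cmod a * sum_f_R0 (fun k => Cmod q ^ k) n) <= exp (Cmod a * / (1 - Cmod q)))%R.
  { move=> n. have h := geo_partial_lt _ n hq.
    case: (Rmult_le_compat_l _ _ _ ha h) => [l|->]; [left; exact: exp_increasing | right; done]. }
  case=> [|n]; last by apply: Rle_trans (H n) (m n).
  rewrite /= Cmod_1. apply: Rle_trans (exp_ineq1_le _).
  have : (0 <= Cmod a * / (1 - Cmod q))%R; last lra.
  apply: Rmult_le_pos => //. left; apply: Rinv_0_lt_compat; lra.
Qed.

(** For 0 <= t <= 1 the chord bound 1/(1 - |a| t) <= 1 + d t holds with [d = |a| / (1 - |a|)]; with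
    t = |q|^k the argument continues as in [qpoch_bound]. *)
Lemma qpoch_inv_bound a q : (Cmod q < 1)%R -> (Cmod a < 1)%R ->
  exists K, (0 < K)%R /\ forall n, (Cmod (/ qpoch a q n) <= K)%R.
Proof.
  move=> lq la. have hq : (0 <= Cmod q < 1)%R by split=> //; exact: Cmod_ge_0.
  have ha := Cmod_ge_0 a.
  pose d := (Cmod a / (1 - Cmod a))%R.
  have pd : (0 <= d)%R by apply: Rmult_le_pos => //; left; apply: Rinv_0_lt_compat; lra.
  have H n : (Cmod (/ qpoch a q (S n)) <= exp (d * sum_f_R0 (fun k => Cmod q ^ k) n))%R.
  { have step k : (Cmod (/ (1 - a * q ^ k)) <= exp (d * Cmod q ^ k))%R.
    { apply: Rle_trans (exp_ineq1_le _).
      have l := Cmod_mul_pow_lt a q k lq la.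
      rewrite Cmod_inv; last exact: one_minus_nz.
      have h : (1 - Cmod a * Cmod q ^ k <= Cmod (1 - a * q ^ k))%R.
      { have := Cmod_triangle (1 - a * q ^ k) (a * q ^ k).
        replace (1 - a * q ^ k + a * q ^ k) with (RtoC 1) by ring.
        rewrite Cmod_1 Cmod_mult Cmod_pow; lra. }
      have h0 : (0 <= Cmod q ^ k <= 1)%R.
      { split; first by apply: pow_le; lra. rewrite -(pow1 k); apply: pow_incr; lra. }
      have p : (0 < 1 - Cmod a * Cmod q ^ k)%R by nra.
      apply: Rle_trans (Rinv_le_contravar _ _ p h) _.
      apply: (Rmult_le_reg_l (1 - Cmod a * Cmod q ^ k)) => //.
      rewrite Rinv_r; last lra.
      have e : (0 <= Cmod a * d * Cmod q ^ k * (1 - Cmod q ^ k))%R.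
      { clearbody d. do 3 (apply: Rmult_le_pos; try lra). }
      have e2 : (d * Cmod q ^ k = Cmod a * Cmod q ^ k + Cmod a * d * Cmod q ^ k)%R.
      { rewrite /d; field; lra. }
      lra. }
    elim: n => [|n IH].
    - rewrite [qpoch _ _ _]/= -[X in (Cmod (/ X) <= _)%R]/(1 * (1 - a * q ^ 0)) Cmult_1_l. exact: step.
    - rewrite -[qpoch _ _ _]/(qpoch a q (S n) * (1 - a * q ^ (S n))) [sum_f_R0 _ _]/= Rmult_plus_distr_l exp_plus.
      have -> : / (qpoch a q (S n) * (1 - a * q ^ S n)) = / qpoch a q (S n) * / (1 - a * q ^ S n).
      { field. split; first by apply: one_minus_nz; exact: Cmod_mul_pow_lt. exact: qpoch_nz. }
      rewrite Cmod_mult.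
      apply: Rmult_le_compat; try exact: Cmod_ge_0; [exact: IH | exact: (step (S n))]. }
  exists (exp (d * / (1 - Cmod q))); split; first exact: exp_pos.
  have m : forall n, (exp (d * sum_f_R0 (fun k => Cmod q ^ k) n) <= exp (d * / (1 - Cmod q)))%R.
  { move=> n. have h := geo_partial_lt _ n hq.
    case: (Rmult_le_compat_l _ _ _ pd h) => [l|->]; [left; exact: exp_increasing | right; done]. }
  case=> [|n]; last by apply: Rle_trans (H n) (m n).
  have -> : / qpoch a q 0 = 1 by rewrite /=; field.
  rewrite Cmod_1. apply: Rle_trans (exp_ineq1_le _).
  have : (0 <= d * / (1 - Cmod q))%R; last lra.
  apply: Rmult_le_pos => //. left; apply: Rinv_0_lt_compat; lra.
Qed.

(* [1 / (q;q)_n], extended by [0] to negative [n] so that [ip_pred] holds for every integer. *)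
Definition ip q (n : Z) : Complex.C :=
  match n with Zneg _ => 0 | _ => / qpoch q q (Z.to_nat n) end.

Lemma ip_neg q n : (n < 0)%Z -> ip q n = 0.
Proof. by case: n. Qed.

Lemma ip_nonneg q n : (0 <= n)%Z -> ip q n = / qpoch q q (Z.to_nat n).
Proof. by case: n. Qed.

Lemma ip_0 q : ip q 0 = 1.
Proof. rewrite /ip /=. field. Qed.

Lemma ip_pred q n : (Cmod q < 1)%R -> ip q (n - 1) = (1 - q ^^ n) * ip q n.
Proof.
  move=> lq. have [h|[->|h]] : (n < 0 \/ n = 0 \/ 0 < n)%Z by lia.
  - rewrite !ip_neg //; try lia. ring.
  - rewrite Cpowz_0 /=. ring.
  - rewrite !ip_nonneg; try lia.
    have -> : Z.to_nat n = S (Z.to_nat (n - 1)) by lia.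
    rewrite Cpowz_pos; last lia. have -> : Z.to_nat n = S (Z.to_nat (n - 1)) by lia.
    rewrite -[qpoch q q (S _)]/(qpoch q q (Z.to_nat (n - 1)) * (1 - q * q ^ Z.to_nat (n - 1))) Cpow_S.
    field. split; last exact: qpoch_nz.
    apply: one_minus_nz. exact: Cmod_mul_pow_lt.
Qed.

Lemma ip_bound q : (Cmod q < 1)%R -> exists K, (0 < K)%R /\ forall n, (Cmod (ip q n) <= K)%R.
Proof.
  move=> lq. have [K [pK H]] := qpoch_inv_bound q q lq lq.
  exists K; split=> // n. case: (Z.ltb_spec n 0) => h.
  - rewrite ip_neg // Cmod_0; lra.
  - by rewrite ip_nonneg.
Qed.

Lemma tsum_shift (f : Z -> Complex.C) k : summable f -> tsum f = tsum (fun n => f (n + k)%Z).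
Proof.
  move=> S. apply: (tsum_bij f (fun n => n + k)%Z (fun n => n - k)%Z) => // n; lia.
Qed.

Lemma tsum_reflect (f : Z -> Complex.C) k : summable f -> tsum f = tsum (fun n => f (k - n)%Z).
Proof.
  move=> S. apply: (tsum_bij f (fun n => k - n)%Z (fun n => k - n)%Z) => // n; lia.
Qed.

Lemma summable_shift (f : Z -> Complex.C) k : summable f -> summable (fun n => f (n + k)%Z).
Proof. apply: summable_comp => x y; lia. Qed.

Lemma summable_mul_bounded {I : Type} (f g : I -> Complex.C) K :
  (forall i, (Cmod (g i) <= K)%R) -> summable f -> summable (fun i => f i * g i).
Proof.
  move=> H Sf. apply: (summable_le _ (fun i => RtoC K * f i)); last exact: summable_scal.
  move=> i. rewrite !Cmod_mult Cmod_R. have := H i. have := Rle_abs K.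
  have := Cmod_ge_0 (f i). have := Cmod_ge_0 (g i). nra.
Qed.

Lemma Ccv_pow q : (Cmod q < 1)%R -> Ccv (fun n => q ^ n) 0.
Proof.
  move=> lq eps pos. have hq : (0 <= Cmod q < 1)%R by split=> //; exact: Cmod_ge_0.
  have [N HN] := exists_pow_lt _ _ hq pos. exists N => n Hn.
  replace (q ^ n - 0) with (q ^ n) by ring. rewrite Cmod_pow.
  apply: Rle_lt_trans HN. apply: pow_le_anti => //. lra.
Qed.

Lemma Ccv_bounded_mul0 u v K : (forall n, (Cmod (v n) <= K)%R) -> Ccv u 0 ->
  Ccv (fun n => u n * v n) 0.
Proof.
  move=> HK H eps pos.
  have pK : (0 < K + 1)%R by have := Cmod_ge_0 (v 0%nat); have := HK 0%nat; lra.
  have [N HN] := H _ (Rdiv_lt_0_compat _ _ pos pK). exists N => n /HN.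
  replace (u n * v n - 0) with (u n * v n) by ring.
  replace (u n - 0) with (u n) by ring. rewrite Cmod_mult => h.
  apply: (Rle_lt_trans _ (Cmod (u n) * (K + 1))).
  - have := Cmod_ge_0 (u n). have := HK n. nra.
  - apply: (Rlt_le_trans _ (eps / (K + 1) * (K + 1))); last by (right; field; lra).
    exact: Rmult_lt_compat_r.
Qed.

Lemma Cmod_qN_le1 q N n : q <> 0 -> (Cmod q < 1)%R -> (0 <= n)%Z ->
  (Cmod (q ^^ (Z.of_nat N * n)) <= 1)%R.
Proof.
  move=> nq lq hn. rewrite Cmod_Cpowz //; last nia.
  rewrite -(pow1 (Z.to_nat (Z.of_nat N * n))). apply: pow_incr. split; [exact: Cmod_ge_0 | lra].
Qed.

(** The damping factor removes every term with n > 0 in the limit and terms with n < 0 are absent,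
    so only n = 0 survives. This closes each of the arguments below that iterate a functional
    equation. *)
Lemma cv_scaled q (u : nat -> Z -> Complex.C) (G : Z -> Complex.C) l :
  q <> 0 -> (Cmod q < 1)%R -> summable G -> (forall N n, (Cmod (u N n) <= Cmod (G n))%R) ->
  (forall N n, (n < 0)%Z -> u N n = 0) -> Ccv (fun N => u N 0%Z) l ->
  Ccv (fun N => tsum (fun n => q ^^ (Z.of_nat N * n) * u N n)) l.
Proof.
  move=> nq lq SG HG Hneg H0.
  have E : tsum (fun n => if (n =? 0)%Z then l else 0) = l.
  { rewrite (tsum_single _ 0%Z) // => n Hn. by have -> : (n =? 0)%Z = false by apply/Z.eqb_neq. }
  rewrite -E. apply: (tannery _ _ G) => //.
  - move=> N n. case: (Z.ltb_spec n 0) => h.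
    + rewrite Hneg // Cmult_0_r Cmod_0. exact: Cmod_ge_0.
    + rewrite Cmod_mult. have := Cmod_qN_le1 q N n nq lq h. have := HG N n.
      have := Cmod_ge_0 (u N n). have := Cmod_ge_0 (q ^^ (Z.of_nat N * n)). nra.
  - move=> n. have [h|[->|h]] : (n < 0 \/ n = 0 \/ 0 < n)%Z by lia.
    + have -> : (n =? 0)%Z = false by apply/Z.eqb_neq; lia.
      apply: (Ccv_ext (fun _ => 0)); last exact: Ccv_const.
      move=> N. rewrite Hneg //; ring.
    + rewrite /=. apply: Ccv_ext H0 => N. rewrite Z.mul_0_r Cpowz_0; ring.
    + have -> : (n =? 0)%Z = false by apply/Z.eqb_neq; lia.
      apply: (Ccv_bounded_mul0 _ _ (Cmod (G n))) => //.
      move=> eps pos. have [N0 HN0] := Ccv_pow q lq eps pos. exists N0 => N HN.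
      have := HN0 N HN.
      replace (q ^^ (Z.of_nat N * n) - 0) with (q ^^ (Z.of_nat N * n)) by ring.
      replace (q ^ N - 0) with (q ^ N) by ring. apply: Rle_lt_trans.
      rewrite Cmod_Cpowz //; last nia. rewrite Cmod_pow. apply: pow_le_anti; last nia.
      split; [exact: Cmod_ge_0 | lra].
Qed.

Definition euler_term q z (n : Z) : Complex.C := q ^^ tri n * z ^^ n * ip q n.

Lemma summable_euler q z : q <> 0 -> z <> 0 -> (Cmod q < 1)%R -> summable (euler_term q z).
Proof.
  move=> nq nz lq. have [K [pK HK]] := ip_bound q lq.
  apply: (summable_mul_bounded (fun n => q ^^ tri n * z ^^ n) _ K) => //. exact: summable_theta.
Qed.

(** Write 1/(q;q)_n as q^n/(q;q)_n + 1/(q;q)_(n-1); a shift of n in the second part returns z times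
    the series at q z. *)
Lemma euler_step q z : q <> 0 -> z <> 0 -> (Cmod q < 1)%R ->
  tsum (euler_term q z) = (1 + z) * tsum (euler_term q (q * z)).
Proof.
  move=> nq nz lq. have nqz : q * z <> 0 by exact: Cmult_neq_0.
  have S1 := summable_euler q z nq nz lq. have S2 := summable_euler q (q * z) nq nqz lq.
  rewrite (tsum_ext (euler_term q z)
    (fun n => euler_term q (q * z) n + q ^^ tri n * z ^^ n * ip q (n - 1))); last first.
  { move=> n. rewrite ip_pred // /euler_term Cpowz_mul_base //. ring. }
  have S3 : summable (fun n => q ^^ tri n * z ^^ n * ip q (n - 1)).
  { apply: (summable_ext _ (fun n => euler_term q z n + (- (1)) * euler_term q (q * z) n)).
    - move=> n. rewrite ip_pred // /euler_term Cpowz_mul_base //. ring.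
    - apply: summable_plus => //. exact: summable_scal. }
  rewrite tsum_plus // (tsum_shift (fun n => q ^^ tri n * z ^^ n * ip q (n - 1)) 1) //.
  rewrite [X in _ + X](tsum_ext _ (fun n => z * euler_term q (q * z) n)); last first.
  { move=> n. rewrite tri_succ Z.add_simpl_r /euler_term Cpowz_mul_base // !Cpowz_add // Cpowz_1. ring. }
  rewrite tsum_scal //. ring.
Qed.

Lemma euler_iter q z N : q <> 0 -> z <> 0 -> (Cmod q < 1)%R ->
  tsum (euler_term q z) = qpoch (- z) q N * tsum (euler_term q (q ^ N * z)).
Proof.
  move=> nq nz lq. elim: N => [|N IH].
  - rewrite /= !Cmult_1_l. done.
  - rewrite IH (euler_step q (q ^ N * z)) //; last by apply: Cmult_neq_0 => //; exact: Cpow_nz.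
    rewrite -[qpoch _ _ (S N)]/(qpoch (- z) q N * (1 - - z * q ^ N)) Cpow_S.
    rewrite Cmult_assoc -[q * q ^ N * z]Cmult_assoc. ring.
Qed.

Lemma euler_limit q z : q <> 0 -> z <> 0 -> (Cmod q < 1)%R ->
  Ccv (fun N => tsum (euler_term q (q ^ N * z))) 1.
Proof.
  move=> nq nz lq.
  apply: (Ccv_ext (fun N => tsum (fun n => q ^^ (Z.of_nat N * n) * euler_term q z n))).
  { move=> N. apply: tsum_ext => n. rewrite /euler_term Cpowz_mul_base //; last exact: Cpow_nz.
    rewrite Cpowz_pow //. ring. }
  apply: (cv_scaled q (fun _ => euler_term q z) (euler_term q z)) => //.
  - exact: summable_euler.
  - move=> N n; lra.
  - move=> _ n h. rewrite /euler_term ip_neg //. ring.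
  - have E : euler_term q z 0 = 1 by rewrite /euler_term ip_0 (_ : tri 0 = 0%Z) // !Cpowz_0; ring.
    rewrite E; exact: Ccv_const.
Qed.

Lemma Ccv_factor_limit u v c : (forall n, u n * v n = c) -> Ccv v 1 -> Ccv u c.
Proof.
  move=> H Hv. have Hi := Ccv_inv1 _ Hv. have := Ccv_scal c _ _ Hi. rewrite Cmult_1_r => Hc.
  have h2 : (0 < 1 / 2)%R by lra. have [N HN] := Hv _ h2.
  move=> eps /Hc [M HM]. exists (N + M)%nat => n Hn.
  have nz : v n <> 0.
  { move=> E. have h : (N <= n)%nat by lia. have := HN n h. rewrite E.
    replace (0 - 1) with (- (1)) by ring. rewrite Cmod_m1; lra. }
  have h : (M <= n)%nat by lia. have := HM n h.
  by replace (c * / v n) with (u n) by (rewrite -(H n); field; exact: nz).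
Qed.

(** The finite products times a sequence tending to 1 are constant, so convergence of the infinite
    product comes together with its value. *)
Lemma euler_product q z : q <> 0 -> z <> 0 -> (Cmod q < 1)%R ->
  Ccv (qpoch (- z) q) (tsum (euler_term q z)).
Proof.
  move=> nq nz lq. apply: Ccv_factor_limit (euler_limit q z nq nz lq) => N.
  by rewrite -euler_iter.
Qed.

Lemma qpoch_inf_cv (a : Complex.C) q : q <> 0 -> a <> 0 -> (Cmod q < 1)%R -> Ccv (qpoch a q) (qpoch_inf a q).
Proof.
  move=> nq na lq. have na' : - a <> 0.
  { move=> E; apply: na. replace a with (- - a) by ring. rewrite E; ring. }
  have := euler_product q (- a) nq na' lq. replace (- - a) with a by ring.
  move=> H. by rewrite /qpoch_inf (Clim_eq _ _ H).
Qed.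

Lemma euler_sum q z : q <> 0 -> z <> 0 -> (Cmod q < 1)%R ->
  tsum (euler_term q z) = qpoch_inf (- z) q.
Proof. move=> nq nz lq. symmetry. apply: Clim_eq. exact: euler_product. Qed.

Lemma summable_pow_ip q z : q <> 0 -> z <> 0 -> (Cmod q < 1)%R -> (Cmod z < 1)%R ->
  summable (fun n => z ^^ n * ip q n).
Proof.
  move=> nq nz lq lz. have [K [pK HK]] := ip_bound q lq.
  have hz : (0 <= Cmod z < 1)%R by split=> //; exact: Cmod_ge_0.
  apply: (summable_le _ (fun n => RtoC K * geo (Cmod z) n)); last first.
  { apply: summable_scal. exact: summable_geo. }
  move=> n. rewrite [X in (_ <= X)%R]Cmod_mult Cmod_R Cmod_geo ?(Rabs_pos_eq K); try lra.
  have p : (0 <= Cmod z ^ Z.abs_nat n)%R by apply: pow_le; lra.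
  case: (Z.ltb_spec n 0) => h.
  - rewrite ip_neg // Cmult_0_r Cmod_0. nra.
  - rewrite Cmod_mult Cmod_Cpowz //. have -> : Z.to_nat n = Z.abs_nat n by lia.
    have := HK n. nra.
Qed.

(** One factor 1 - z q^N at a time: (1 - q^n)/(q;q)_n = 1/(q;q)_(n-1) turns multiplication by 1 - y
    into the substitution of q y for y. *)
Lemma pow_ip_iter q z N : q <> 0 -> z <> 0 -> (Cmod q < 1)%R -> (Cmod z < 1)%R ->
  qpoch z q N * tsum (fun n => z ^^ n * ip q n) = tsum (fun n => q ^^ (Z.of_nat N * n) * (z ^^ n * ip q n)).
Proof.
  move=> nq nz lq lz. elim: N => [|N IH].
  - rewrite Cmult_1_l. apply: tsum_ext => n. rewrite /= Cpowz_0. ring.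
  - rewrite -[qpoch _ _ (S N)]/(qpoch z q N * (1 - z * q ^ N)).
    set y := z * q ^ N.
    have ny : y <> 0 by apply: Cmult_neq_0 => //; exact: Cpow_nz.
    have ly : (Cmod y < 1)%R by exact: Cmod_mul_pow_lt.
    have E M n : q ^^ (Z.of_nat M * n) * (z ^^ n * ip q n) = (z * q ^ M) ^^ n * ip q n.
    { rewrite Cpowz_mul_base // ?Cpowz_pow //; last exact: Cpow_nz. ring. }
    rewrite (tsum_ext _ _ (E N)) in IH. rewrite (tsum_ext _ _ (E (S N))) -/y.
    have -> : z * q ^ S N = q * y by rewrite /y Cpow_S; ring.
    have Sy := summable_pow_ip q y nq ny lq ly.
    transitivity (tsum (fun n => y ^^ n * ip q n) * (1 - y)); first by rewrite -IH; ring.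
    rewrite (tsum_ext (fun n => (q * y) ^^ n * ip q n)
      (fun n => y ^^ n * ip q n + - y * (y ^^ (n - 1) * ip q (n - 1)))); last first.
    { move=> n. rewrite ip_pred // Cpowz_mul_base // Cpowz_sub // Cpowz_1. field. exact: ny. }
    have Sy1 := summable_shift _ (-1) Sy.
    rewrite tsum_plus //; last exact: summable_scal.
    rewrite (tsum_scal (- y) (fun n => y ^^ (n - 1) * ip q (n - 1))) //.
    rewrite [X in _ = _ + _ * X](_ : _ = tsum (fun n => y ^^ n * ip q n)); first ring.
    by rewrite [RHS](tsum_shift _ (-1)).
Qed.

Lemma pow_ip_cv q z : q <> 0 -> z <> 0 -> (Cmod q < 1)%R -> (Cmod z < 1)%R ->
  qpoch_inf z q * tsum (fun n => z ^^ n * ip q n) = 1.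
Proof.
  move=> nq nz lq lz.
  apply: (Ccv_unique (fun N => qpoch z q N * tsum (fun n => z ^^ n * ip q n))).
  - apply: Ccv_mult; [exact: qpoch_inf_cv | exact: Ccv_const].
  - apply: (Ccv_ext _ _ _ (fun N => eq_sym (pow_ip_iter q z N nq nz lq lz))).
    apply: (cv_scaled q (fun _ n => z ^^ n * ip q n) (fun n => z ^^ n * ip q n)) => //.
    + exact: summable_pow_ip.
    + move=> N n; lra.
    + move=> _ n h. rewrite ip_neg //. ring.
    + rewrite ip_0 Cpowz_0 Cmult_1_l. exact: Ccv_const.
Qed.

(** The product has an explicit inverse, the series of [pow_ip_cv]. *)
Lemma qpoch_inf_nz (a : Complex.C) q : q <> 0 -> a <> 0 -> (Cmod q < 1)%R -> (Cmod a < 1)%R ->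
  qpoch_inf a q <> 0.
Proof.
  move=> nq na lq la E. have := pow_ip_cv q a nq na lq la.
  rewrite E Cmult_0_l => /(f_equal fst) /=; lra.
Qed.

Lemma pow_ip_sum q z : q <> 0 -> z <> 0 -> (Cmod q < 1)%R -> (Cmod z < 1)%R ->
  tsum (fun n => z ^^ n * ip q n) = / qpoch_inf z q.
Proof.
  move=> nq nz lq lz. have h := qpoch_inf_nz z q nq nz lq lz.
  rewrite -[LHS]Cmult_1_l -(Cinv_l _ h) -Cmult_assoc pow_ip_cv //. ring.
Qed.

Lemma Cmult_cancel_l (x a b : Complex.C) : x <> 0 -> x * a = x * b -> a = b.
Proof.
  move=> nx E. replace a with (/ x * (x * a)) by (field; exact: nx). rewrite E. by field.
Qed.

Lemma Cpowz_m_nz q n : q <> 0 -> - q ^^ n <> 0.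
Proof.
  move=> nq E. apply: (Cpowz_nz q n nq). replace (q ^^ n) with (- - q ^^ n) by ring.
  rewrite E; ring.
Qed.

(* The product [(q^{n+1}; q)_oo], which vanishes for [n < 0], expanded by Euler. *)
Lemma euler_ip q n : q <> 0 -> (Cmod q < 1)%R ->
  tsum (euler_term q (- q ^^ (n + 1))) = qpoch_inf q q * ip q n.
Proof.
  move=> nq lq.
  have step k : tsum (euler_term q (- q ^^ k)) = (1 - q ^^ k) * tsum (euler_term q (- q ^^ (k + 1))).
  { rewrite euler_step //; last exact: Cpowz_m_nz. rewrite Cpowz_add // Cpowz_1.
    replace (q * - q ^^ k) with (- (q ^^ k * q)) by ring. ring. }
  have nn k : (0 < k)%Z -> 1 - q ^^ k <> 0.
  { move=> hk. apply: one_minus_nz. rewrite Cpowz_pos; last lia.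
    have -> : Z.to_nat k = S (Z.to_nat (k - 1)) by lia. rewrite Cpow_S. exact: Cmod_mul_pow_lt. }
  have [h|h] : (0 <= n \/ n <= -1)%Z by lia.
  - move: n h. apply: natlike_ind.
    + rewrite ip_0 Z.add_0_l Cpowz_1 euler_sum //.
      * replace (- - q) with q by ring. ring.
      * move=> E; apply: nq. replace q with (- - q) by ring. rewrite E; ring.
    + move=> n hn IH. rewrite -Z.add_1_r.
      have := ip_pred q (n + 1) lq. rewrite Z.add_simpl_r => E.
      have h1 : (0 < n + 1)%Z by lia. have nz := nn _ h1.
      rewrite step E in IH.
      apply: (Cmult_cancel_l _ _ _ nz). rewrite IH; ring.
  (* At exponent 0 the factor 1 - q^0 is zero, and the recursion carries this zero to all lower
     exponents. *)
  - have Z0 : tsum (euler_term q (- q ^^ 0)) = 0 by rewrite step Cpowz_0; ring.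
    have -> : ip q n = 0 by apply: ip_neg; lia.
    rewrite Cmult_0_r.
    have [k [hk ->]] : exists k, (0 <= k)%Z /\ n = (- 1 - k)%Z by exists (- 1 - n)%Z; lia.
    move: k hk. apply: natlike_ind; first exact: Z0.
    move=> k hk IH. rewrite step.
    have -> : (-1 - Z.succ k + 1 + 1 = -1 - k + 1)%Z by lia. rewrite IH; ring.
Qed.

(** Multiply the theta series by the series of 1/(v;q)_oo, where q = u v, and replace the theta
    index by n + m. The sum over m is Euler's series at -q^(n+1), which equals (q;q)_oo/(q;q)_n and
    vanishes for n < 0; what remains is Euler's series for (u;q)_oo. *)
Lemma jacobi_triple (u v : Complex.C) : u <> 0 -> v <> 0 -> (Cmod v < 1)%R -> (Cmod (u * v) < 1)%R ->
  tsum (fun n => (u * v) ^^ tri n * (- u) ^^ n) =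
  qpoch_inf u (u * v) * qpoch_inf v (u * v) * qpoch_inf (u * v) (u * v).
Proof.
  move=> nu nv lv luv. set q := u * v in luv *.
  have nq : q <> 0 by exact: Cmult_neq_0.
  have nu' : - u <> 0 by move=> E; apply: nu; replace u with (- - u) by ring; rewrite E; ring.
  have St := summable_theta q (- u) nq nu' luv.
  have Sv := summable_pow_ip q v nq nv luv lv.
  pose F (x : Z * Z) := (q ^^ tri (fst x) * (- u) ^^ fst x) * (v ^^ snd x * ip q (snd x)).
  have SP : summable F := summable_prod _ _ St Sv.
  have nzv := qpoch_inf_nz v q nq nv luv lv.
  set T := tsum (fun n => _).
  have E1 : tsum F = T * / qpoch_inf v q.
  { rewrite -pow_ip_sum //. exact: tsum_prod. }
  have inj : injective_map (fun x : Z * Z => ((fst x + snd x)%Z, snd x)).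
  { move=> [a b] [c d] [=] /= *. f_equal; lia. }
  rewrite (tsum_bij F (fun x => ((fst x + snd x)%Z, snd x)) (fun x => ((fst x - snd x)%Z, snd x))) // in E1;
    try by move=> [a b] /=; f_equal; lia.
  rewrite tsum_fubini /= in E1; last exact: (summable_comp F _ inj SP).
  have E2 n : tsum (fun m => F ((n + m)%Z, m)) = qpoch_inf q q * (q ^^ tri n * (- u) ^^ n * ip q n).
  { rewrite (tsum_ext _ (fun m => (q ^^ tri n * (- u) ^^ n) * euler_term q (- q ^^ (n + 1)) m)).
    - rewrite tsum_scal ?euler_ip //; first ring.
      apply: summable_euler => //. exact: Cpowz_m_nz.
    - move=> m. rewrite /F /euler_term /=.
      have -> : tri (n + m) = (tri n + tri m + n * m)%Z by trilia.
      have -> : - q ^^ (n + 1) = - u * v * q ^^ n.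
      { rewrite Cpowz_succ //. rewrite {1}/q. ring. }
      have nuv : - u * v <> 0 by exact: Cmult_neq_0.
      rewrite !Cpowz_add // !Cpowz_mul_base // ?Cpowz_mul //; first ring; try apply: Cmult_neq_0; exact: Cpowz_nz. }
  rewrite (tsum_ext _ _ E2) tsum_scal in E1; last exact: summable_euler.
  have E3 := euler_sum q (- u) nq nu' luv. rewrite /euler_term in E3.
  rewrite E3 in E1. replace (- - u) with u in E1 by ring.
  replace T with (T * / qpoch_inf v q * qpoch_inf v q) by (field; exact: nzv).
  rewrite -E1. ring.
Qed.

(** * Splitting infinite products into residue classes *)

Fixpoint cprod (f : nat -> Complex.C) (k : nat) : Complex.C :=
  match k with O => 1 | S j => cprod f j * f j end.

Lemma cprod_ext f g k : (forall i, f i = g i) -> cprod f k = cprod g k.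
Proof. move=> E. elim: k => //= k ->. by rewrite E. Qed.

Lemma cprod_mul f g k : cprod (fun i => f i * g i) k = cprod f k * cprod g k.
Proof. elim: k => [|k IH] /=; [ring | rewrite IH; ring]. Qed.

Lemma Ccv_cprod (u : nat -> nat -> Complex.C) l k : (forall i, Ccv (fun n => u n i) (l i)) ->
  Ccv (fun n => cprod (u n) k) (cprod l k).
Proof. move=> H. elim: k => [|k IH] /=; [exact: Ccv_const | exact: Ccv_mult]. Qed.

Lemma qpoch_inf_split (a : Complex.C) q k : q <> 0 -> a <> 0 -> (Cmod q < 1)%R -> (0 < k)%nat ->
  qpoch_inf a q = cprod (fun i => qpoch_inf (a * q ^ i) (q ^ k)) k.
Proof.
  move=> nq na lq hk. have nqk : q ^ k <> 0 by exact: Cpow_nz.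
  have lqk : (Cmod (q ^ k) < 1)%R.
  { have -> : k = S (k - 1) by lia. rewrite Cpow_S. exact: Cmod_mul_pow_lt. }
  apply: (Ccv_unique (fun n => qpoch a q (k * n))).
  - apply: Ccv_subseq; [lia | exact: qpoch_inf_cv].
  - apply: (Ccv_ext (fun n => cprod (fun i => qpoch (a * q ^ i) (q ^ k) n) k)).
    + elim=> [|n IH].
      * rewrite Nat.mul_0_r /=. elim: {1}k => //= j ->. ring.
      * rewrite (cprod_ext _ (fun i => qpoch (a * q ^ i) (q ^ k) n * (1 - a * q ^ i * (q ^ k) ^ n))) //.
        rewrite cprod_mul IH. have -> : (k * S n = k * n + k)%nat by lia.
        (* The induction runs over the number of factors only; the [k] in [q ^ k] and in [k * n]
           stays fixed. *)
        elim: {3 5}k => [|j IHj]; first by rewrite Nat.add_0_r /= Cmult_1_r.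
        rewrite Nat.add_succ_r -[qpoch a q (S _)]/(qpoch a q (k * n + j) * (1 - a * q ^ (k * n + j))) -IHj /=.
        rewrite -Cpow_mult_r Cpow_add_r. ring.
    + apply: Ccv_cprod => i. apply: qpoch_inf_cv => //. apply: Cmult_neq_0 => //. exact: Cpow_nz.
Qed.

Lemma qpoch_inf_sqr (a : Complex.C) q : q <> 0 -> a <> 0 -> (Cmod q < 1)%R ->
  qpoch_inf a q * qpoch_inf (- a) q = qpoch_inf (a ^ 2) (q ^ 2).
Proof.
  move=> nq na lq. have nq2 : q ^ 2 <> 0 by exact: Cpow_nz.
  have na' : - a <> 0 by move=> E; apply: na; replace a with (- - a) by ring; rewrite E; ring.
  have lq2 : (Cmod (q ^ 2) < 1)%R.
  { rewrite /= Cmult_1_r. have := Cmod_mul_pow_lt q q 1 lq lq. by rewrite /= Cmult_1_r. }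
  apply: (Ccv_unique (fun n => qpoch a q n * qpoch (- a) q n)).
  - by apply: Ccv_mult; apply: qpoch_inf_cv.
  - apply: (Ccv_ext (qpoch (a ^ 2) (q ^ 2))); last by apply: qpoch_inf_cv => //; exact: Cpow_nz.
    elim=> [|n IH]; first by rewrite /= Cmult_1_r.
    rewrite -[qpoch (a ^ 2) (q ^ 2) (S n)]/(qpoch (a ^ 2) (q ^ 2) n * (1 - a ^ 2 * (q ^ 2) ^ n)) IH.
    rewrite -[qpoch a q (S n)]/(qpoch a q n * (1 - a * q ^ n)).
    rewrite -[qpoch (- a) q (S n)]/(qpoch (- a) q n * (1 - - a * q ^ n)).
    rewrite -Cpow_mult_r Nat.mul_comm Cpow_mult_r. ring.
Qed.

(** * Gauss's alternating sum of q-binomial coefficients *)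

Lemma Zinterval_NoDup a n : NoDup (map (fun k => (a + Z.of_nat k)%Z) (List.seq 0 n)).
Proof. apply: NoDup_map_inj; last exact: seq_NoDup. move=> x y; lia. Qed.

Lemma summable_Zbounded (f : Z -> Complex.C) a b :
  (forall n, (n < a \/ b < n)%Z -> f n = 0) -> summable f.
Proof.
  move=> H. apply: (summable_finite f _ (Zinterval_NoDup a (Z.to_nat (b - a + 1)))).
  move=> n Hn. apply: H. case: (Z.ltb_spec n a) => h1; first by left.
  case: (Z.ltb_spec b n) => h2; first by right. exfalso. apply: Hn.
  apply/in_map_iff. exists (Z.to_nat (n - a)). split; first lia. apply/in_seq; lia.
Qed.

Lemma ip_prod_0 q a b : (a < 0 \/ b < 0)%Z -> ip q a * ip q b = 0.
Proof. case=> h; [rewrite (ip_neg q a) // | rewrite (ip_neg q b) //]; ring. Qed.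

(** The q-Pascal rule for binomial coefficients divided by (q;q)_(a+b), from 1 - q^(a+b) = (1 - q^a)
    + q^a (1 - q^b). *)
Lemma ip_pascal q a b : q <> 0 -> (Cmod q < 1)%R ->
  (1 - q ^^ (a + b)) * (ip q a * ip q b) = ip q (a - 1) * ip q b + q ^^ a * (ip q a * ip q (b - 1)).
Proof. move=> nq lq. rewrite !ip_pred // Cpowz_add //. ring. Qed.

(** The alternating sum of the k-th row of q-binomial coefficients, divided by (q;q)_k. *)
Definition gauss_sum q (k : Z) : Complex.C :=
  tsum (fun m => (- (1)) ^^ m * (ip q (k - m) * ip q m)).

Lemma summable_gauss q k : summable (fun m => (- (1)) ^^ m * (ip q (k - m) * ip q m)).
Proof.
  apply: (summable_Zbounded _ 0 k) => m h. rewrite ip_prod_0; [ring | lia].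
Qed.

(** Pascal's rule gives two sums. The first, shifted, is minus the value at k - 1. In the second,
    q^m/(q;q)_m = 1/(q;q)_m - 1/(q;q)_(m-1) gives the values at k - 1 and at k - 2, so the values at
    k - 1 cancel. *)
Lemma gauss_sum_rec q k : q <> 0 -> (Cmod q < 1)%R ->
  (1 - q ^^ k) * gauss_sum q k = gauss_sum q (k - 2).
Proof.
  move=> nq lq. have ns := Cm1_nz. rewrite /gauss_sum.
  have S0 := summable_gauss q k. have S1 := summable_gauss q (k - 1). have S2 := summable_gauss q (k - 2).
  rewrite -tsum_scal //.
  have S1q : summable (fun m => (- (1)) ^^ m * (q ^^ m * (ip q (k - 1 - m) * ip q m))).
  { apply: (summable_Zbounded _ 0 (k - 1)) => m h. rewrite ip_prod_0; [ring | lia]. }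
  have Sb : summable (fun m => (- (1)) ^^ m * (ip q (k - m) * ip q (m - 1))).
  { apply: (summable_Zbounded _ 1 k) => m h. rewrite ip_prod_0; [ring | lia]. }
  have Sb1 : summable (fun m => (- (1)) ^^ m * (ip q (k - 1 - m) * ip q (m - 1))).
  { apply: (summable_Zbounded _ 1 k) => m h. rewrite ip_prod_0; [ring | lia]. }
  rewrite (tsum_ext _ (fun m => (- (1)) ^^ m * (ip q (k - m) * ip q (m - 1)) +
     (- (1)) ^^ m * (q ^^ m * (ip q (k - 1 - m) * ip q m)))); last first.
  { move=> m. have := ip_pascal q m (k - m) nq lq. have -> : (m + (k - m) = k)%Z by lia.
    have -> : (k - m - 1 = k - 1 - m)%Z by lia. move=> E.
    transitivity ((- (1)) ^^ m * ((1 - q ^^ k) * (ip q m * ip q (k - m)))); first ring.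
    rewrite E; ring. }
  rewrite tsum_plus //; last first.
  have -> : tsum (fun m => (- (1)) ^^ m * (ip q (k - m) * ip q (m - 1))) =
    - (1) * tsum (fun m => (- (1)) ^^ m * (ip q (k - 1 - m) * ip q m)).
  { rewrite -tsum_scal // (tsum_shift _ 1) //. apply: tsum_ext => m.
    have -> : (k - (m + 1) = k - 1 - m)%Z by lia. have -> : (m + 1 - 1 = m)%Z by lia.
    rewrite Cpowz_succ //. ring. }
  have -> : tsum (fun m => (- (1)) ^^ m * (q ^^ m * (ip q (k - 1 - m) * ip q m))) =
    tsum (fun m => (- (1)) ^^ m * (ip q (k - 1 - m) * ip q m)) +
    - (1) * tsum (fun m => (- (1)) ^^ m * (ip q (k - 1 - m) * ip q (m - 1))).
  { rewrite -tsum_scal // -tsum_plus //; last exact: summable_scal.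
    apply: tsum_ext => m. rewrite (ip_pred q m) //. ring. }
  rewrite (tsum_shift (fun m => (- (1)) ^^ m * (ip q (k - 1 - m) * ip q (m - 1))) 1) //.
  rewrite (tsum_ext (fun n => (- (1)) ^^ (n + 1) * _) (fun m => - (1) * ((- (1)) ^^ m * (ip q (k - 2 - m) * ip q m)))).
  - rewrite tsum_scal //. ring.
  - move=> m. have -> : (k - 1 - (m + 1) = k - 2 - m)%Z by lia. have -> : (m + 1 - 1 = m)%Z by lia.
    rewrite Cpowz_succ //. ring.
Qed.

Lemma Cpowz_1_minus_nz q k : q <> 0 -> (Cmod q < 1)%R -> (0 < k)%Z -> 1 - q ^^ k <> 0.
Proof.
  move=> nq lq hk. apply: one_minus_nz. rewrite Cpowz_pos; last lia.
  have -> : Z.to_nat k = S (Z.to_nat (k - 1)) by lia. rewrite Cpow_S. exact: Cmod_mul_pow_lt.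
Qed.

Lemma gauss_sum_neg q k : (k < 0)%Z -> gauss_sum q k = 0.
Proof.
  move=> h. apply: tsum_zero => m. rewrite ip_prod_0; [ring | lia].
Qed.

Lemma gauss_sum_odd q k : q <> 0 -> (Cmod q < 1)%R -> gauss_sum q (2 * k + 1) = 0.
Proof.
  move=> nq lq. have [h|h] : (k < 0 \/ 0 <= k)%Z by lia.
  - apply: gauss_sum_neg; lia.
  - move: k h. apply: natlike_ind => [|k h IH].
    + apply: (Cmult_cancel_l _ _ _ (Cpowz_1_minus_nz q 1 nq lq ltac:(lia))).
      rewrite gauss_sum_rec // gauss_sum_neg //. ring.
    + have h1 : (0 < 2 * Z.succ k + 1)%Z by lia.
      apply: (Cmult_cancel_l _ _ _ (Cpowz_1_minus_nz q _ nq lq h1)).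
      rewrite gauss_sum_rec //. have -> : (2 * Z.succ k + 1 - 2 = 2 * k + 1)%Z by lia.
      rewrite IH. ring.
Qed.

Lemma Cmod_sqr_lt q : (Cmod q < 1)%R -> (Cmod (q ^ 2) < 1)%R.
Proof.
  move=> lq. rewrite /= Cmult_1_r. have := Cmod_mul_pow_lt q q 1 lq lq. by rewrite /= Cmult_1_r.
Qed.

Lemma gauss_sum_even q k : q <> 0 -> (Cmod q < 1)%R -> gauss_sum q (2 * k) = ip (q ^ 2) k.
Proof.
  move=> nq lq. have [h|h] : (k < 0 \/ 0 <= k)%Z by lia.
  - rewrite ip_neg //. apply: gauss_sum_neg; lia.
  - move: k h. apply: natlike_ind => [|k h IH].
    + rewrite ip_0 /gauss_sum (tsum_single _ 0%Z).
      * rewrite !ip_0 Cpowz_0. ring.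
      * move=> m hm. rewrite ip_prod_0; [ring | lia].
    + have h1 : (0 < 2 * Z.succ k)%Z by lia.
      apply: (Cmult_cancel_l _ _ _ (Cpowz_1_minus_nz q _ nq lq h1)).
      rewrite gauss_sum_rec //. have -> : (2 * Z.succ k - 2 = 2 * k)%Z by lia.
      rewrite IH. have := ip_pred (q ^ 2) (Z.succ k) (Cmod_sqr_lt q lq).
      have -> : (Z.succ k - 1 = k)%Z by lia. move=> ->. rewrite Cpowz_pow //.
Qed.

(** * Bailey's lemma *)

Lemma Ccv_inv u (l : Complex.C) : l <> 0 -> Ccv u l -> Ccv (fun n => / u n) (/ l).
Proof.
  move=> nl H. have H1 : Ccv (fun n => / l * u n) 1.
  { rewrite -(Cinv_l l nl). exact: Ccv_scal. }
  have H2 := Ccv_scal (/ l) _ _ (Ccv_inv1 _ H1). rewrite Cmult_1_r in H2.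
  have [N HN] := H _ (proj1 (Cmod_gt_0 l) nl).
  move=> eps /H2 [M HM]. exists (N + M)%nat => n Hn.
  have h : (M <= n)%nat by lia. have := HM n h.
  have nz : u n <> 0.
  { move=> E. have h' : (N <= n)%nat by lia. have := HN n h'. rewrite E.
    replace (0 - l) with (- l) by ring. rewrite Cmod_opp; lra. }
  replace (/ l * / (/ l * u n)) with (/ u n); first done.
  field. by split.
Qed.

Lemma qpoch_add (a : Complex.C) q m n : qpoch a q (m + n) = qpoch a q m * qpoch (a * q ^ m) q n.
Proof.
  elim: n => [|n IH]; first by rewrite Nat.add_0_r /= Cmult_1_r.
  rewrite Nat.add_succ_r -[qpoch a q (S _)]/(qpoch a q (m + n) * (1 - a * q ^ (m + n))) IH.
  rewrite -[qpoch (a * q ^ m) q (S n)]/(qpoch (a * q ^ m) q n * (1 - a * q ^ m * q ^ n)).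
  rewrite Cpow_add_r. ring.
Qed.

Lemma qpoch_inf_shift (a : Complex.C) q m : q <> 0 -> a <> 0 -> (Cmod q < 1)%R ->
  qpoch_inf a q = qpoch a q m * qpoch_inf (a * q ^ m) q.
Proof.
  move=> nq na lq. apply: (Ccv_unique (fun n => qpoch a q (m + n))).
  - move=> eps pos. have [N HN] := qpoch_inf_cv a q nq na lq eps pos.
    exists N => n Hn. apply: HN; lia.
  - apply: (Ccv_ext (fun n => qpoch a q m * qpoch (a * q ^ m) q n)).
    + move=> n. by rewrite qpoch_add.
    + apply: Ccv_scal. apply: qpoch_inf_cv => //. apply: Cmult_neq_0 => //. exact: Cpow_nz.
Qed.

(** For c >= 0 this is the summand of the basic hypergeometric series 1phi1 (A; q^(c+1); q, B),
    divided by (q;q)_c. The form with [ip] remains defined as c moves. *)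
Definition phi11_term q (A B : Complex.C) (c m : Z) : Complex.C :=
  qpoch A q (Z.to_nat m) * (- (1)) ^^ m * (q ^^ tri m * B ^^ m) * (ip q m * ip q (m + c)).

Lemma phi11_bound q (A : Complex.C) : (Cmod q < 1)%R -> exists K, (0 < K)%R /\ forall c m,
  (Cmod (qpoch A q (Z.to_nat m) * (- (1)) ^^ m * (ip q m * ip q (m + c))) <= K)%R.
Proof.
  move=> lq. have [K1 [p1 H1]] := qpoch_bound A q lq. have [K2 [p2 H2]] := ip_bound q lq.
  exists (K1 * (K2 * K2))%R; split; first by repeat apply: Rmult_lt_0_compat.
  move=> c m. rewrite !Cmod_mult Cmod_sgn Rmult_1_r.
  apply: Rmult_le_compat; try exact: Cmod_ge_0; first apply: Rmult_le_pos; try exact: Cmod_ge_0.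
  - exact: H1.
  - by apply: Rmult_le_compat; try exact: Cmod_ge_0.
Qed.

Lemma summable_phi11 q (A B : Complex.C) c : q <> 0 -> B <> 0 -> (Cmod q < 1)%R ->
  summable (phi11_term q A B c).
Proof.
  move=> nq nB lq. have [K [pK HK]] := phi11_bound q A lq.
  apply: (summable_ext _ (fun m => (q ^^ tri m * B ^^ m) *
    (qpoch A q (Z.to_nat m) * (- (1)) ^^ m * (ip q m * ip q (m + c))))).
  - move=> m. rewrite /phi11_term. ring.
  - apply: (summable_mul_bounded _ _ K) => //. exact: summable_theta.
Qed.

(** The two summands differ by T m - T (m + 1), which telescopes over Z. The hypothesis is
    inherited, since A (q B) = q^(c+2). *)
Lemma phi11_step q (A B : Complex.C) c : q <> 0 -> B <> 0 -> (Cmod q < 1)%R -> A * B = q ^^ (c + 1) ->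
  tsum (phi11_term q A B c) = (1 - B) * tsum (phi11_term q A (q * B) (c + 1)).
Proof.
  move=> nq nB lq AB. have nqB : q * B <> 0 by exact: Cmult_neq_0.
  pose T m := (1 - q ^^ m) * phi11_term q A B c m.
  have ST : summable T.
  { apply: (summable_ext _ (fun m => phi11_term q A B c m + - (1) * phi11_term q A (q * B) c m)).
    - move=> m. rewrite /T /phi11_term Cpowz_mul_base //. ring.
    - apply: summable_plus; first exact: summable_phi11. apply: summable_scal. exact: summable_phi11. }
  have ST1 := summable_shift _ 1 ST.
  have S' := summable_phi11 q A (q * B) (c + 1) nq nqB lq.
  rewrite -tsum_scal // (tsum_ext (phi11_term q A B c) (fun m => (1 - B) * phi11_term q A (q * B) (c + 1) m +
    (T m + - (1) * T (m + 1)%Z))).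
  - rewrite tsum_plus; first last.
    + apply: summable_plus => //. exact: summable_scal.
    + exact: summable_scal.
    rewrite (tsum_plus T) //; last exact: summable_scal.
    rewrite (tsum_scal _ (fun m => T (m + 1)%Z)) // -(tsum_shift T 1) //. ring.
  - move=> m. rewrite /T /phi11_term.
    have E1 := ip_pred q (m + c + 1) lq. rewrite Z.add_simpl_r in E1.
    have E2 := ip_pred q (m + 1) lq. rewrite Z.add_simpl_r in E2.
    have [h|h] : (m < 0 \/ 0 <= m)%Z by lia.
    + rewrite (ip_neg q m) // in E2 *.
      transitivity (- (1) * qpoch A q (Z.to_nat (m + 1)) * (- (1)) ^^ (m + 1) * (q ^^ tri (m + 1) * B ^^ (m + 1)) *
        (((1 - q ^^ (m + 1)) * ip q (m + 1)) * ip q (m + 1 + c))); last by ring.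
      rewrite -E2; ring.
    + have -> : Z.to_nat (m + 1) = S (Z.to_nat m) by lia.
      rewrite -[qpoch A q (S _)]/(qpoch A q (Z.to_nat m) * (1 - A * q ^ Z.to_nat m)).
      rewrite -Cpowz_pos //.
      have -> : (m + 1 + c = m + c + 1)%Z by lia. have -> : (m + (c + 1) = m + c + 1)%Z by lia.
      rewrite E1 E2 tri_succ Cpowz_mul_base //.
      have E3 : q ^^ (m + c + 1) = A * B * q ^^ m by rewrite AB -Cpowz_add //; f_equal; lia.
      rewrite E3 (Cpowz_add q (tri m) m) // !Cpowz_succ //; last exact: Cm1_nz.
      ring.
Qed.

Lemma phi11_iter q (A B : Complex.C) c N : q <> 0 -> B <> 0 -> (Cmod q < 1)%R -> A * B = q ^^ (c + 1) ->
  tsum (phi11_term q A B c) = qpoch B q N * tsum (phi11_term q A (q ^ N * B) (c + Z.of_nat N)).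
Proof.
  move=> nq nB lq AB. elim: N => [|N IH].
  - by rewrite /= !Cmult_1_l Z.add_0_r.
  - rewrite IH phi11_step //.
    + rewrite -[qpoch B q (S N)]/(qpoch B q N * (1 - B * q ^ N)).
      have -> : (c + Z.of_nat N + 1 = c + Z.of_nat (S N))%Z by lia.
      rewrite Cpow_S -[q * q ^ N * B]Cmult_assoc. ring.
    + apply: Cmult_neq_0 => //. exact: Cpow_nz.
    + have -> : (c + Z.of_nat N + 1 = c + 1 + Z.of_nat N)%Z by lia.
      rewrite (Cpowz_add q (c + 1)) // Cpowz_nat -AB. ring.
Qed.

Lemma ip_cv q c : q <> 0 -> (Cmod q < 1)%R -> (0 <= c)%Z ->
  Ccv (fun N => ip q (c + Z.of_nat N)) (/ qpoch_inf q q).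
Proof.
  move=> nq lq hc. apply: (Ccv_ext (fun N => / qpoch q q (Z.to_nat c + N))).
  - move=> N. rewrite ip_nonneg; last lia. do 2 f_equal; lia.
  - have H := Ccv_inv _ _ (qpoch_inf_nz q q nq nq lq lq) (qpoch_inf_cv q q nq nq lq).
    move=> eps /H [N HN]. exists N => n Hn. apply: HN. lia.
Qed.

(** Heine's limiting case, where the argument of 1phi1 is the quotient of its parameters. Iterating
    [phi11_step] replaces B by q^N B and c by c + N; the remaining series tends to its term m = 0,
    that is to 1/(q;q)_oo. *)
Lemma phi11_sum q (A B : Complex.C) c : q <> 0 -> B <> 0 -> (Cmod q < 1)%R -> A * B = q ^^ (c + 1) ->
  (0 <= c)%Z -> tsum (phi11_term q A B c) = qpoch_inf B q / qpoch_inf q q.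
Proof.
  move=> nq nB lq AB hc.
  have lim : Ccv (fun N => tsum (phi11_term q A (q ^ N * B) (c + Z.of_nat N))) (/ qpoch_inf q q).
  { have [K [pK HK]] := phi11_bound q A lq.
    apply: (Ccv_ext (fun N => tsum (fun m => q ^^ (Z.of_nat N * m) * phi11_term q A B (c + Z.of_nat N) m))).
    { move=> N. apply: tsum_ext => m. rewrite /phi11_term Cpowz_mul_base //; last exact: Cpow_nz.
      rewrite Cpowz_pow //. ring. }
    apply: (cv_scaled q (fun N m => phi11_term q A B (c + Z.of_nat N) m)
      (fun m => RtoC K * (q ^^ tri m * B ^^ m))) => //.
    - apply: summable_scal. exact: summable_theta.
    - move=> N m. rewrite /phi11_term.
      replace (qpoch A q (Z.to_nat m) * (- (1)) ^^ m * (q ^^ tri m * B ^^ m) * (ip q m * ip q (m + (c + Z.of_nat N))))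
        with ((qpoch A q (Z.to_nat m) * (- (1)) ^^ m * (ip q m * ip q (m + (c + Z.of_nat N)))) * (q ^^ tri m * B ^^ m)) by ring.
      rewrite Cmod_mult [X in (_ <= X)%R]Cmod_mult Cmod_R (Rabs_pos_eq K); last lra.
      apply Rmult_le_compat_r; [exact: Cmod_ge_0 | exact: HK].
    - move=> N m h. rewrite /phi11_term (ip_neg q m) //. ring.
    - apply: Ccv_ext (ip_cv q c nq lq hc) => N.
      rewrite /phi11_term ip_0 (_ : tri 0 = 0%Z) // !Cpowz_0 /=. ring. }
  apply: (Ccv_unique (fun N => qpoch B q N * tsum (phi11_term q A (q ^ N * B) (c + Z.of_nat N)))).
  - apply: (Ccv_ext (fun _ => tsum (phi11_term q A B c))); last exact: Ccv_const.
    move=> N. exact: phi11_iter.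
  - apply: Ccv_mult lim. exact: qpoch_inf_cv.
Qed.

(** The conjugate Bailey pair in base s^2 relative to a = s^(2 e), with one parameter at infinity
    and the other equal to x = -s^(1+e), the root of x^2 = a s^2 that makes the two arguments of
    [phi11_sum] coincide after the substitution of n + rho for n. *)
Lemma conjugate_bailey (s : Complex.C) (e rho : Z) : s <> 0 -> (Cmod s < 1)%R -> (0 <= e <= 1)%Z ->
  tsum (fun n => s ^^ (n * n + e * n) * qpoch (- s ^^ (1 + e)) (s ^ 2) (Z.to_nat n) *
    (ip (s ^ 2) (n - rho) * ip (s ^ 2) (n + e + rho))) =
  s ^^ (rho * rho + e * rho) * (qpoch_inf (- s ^^ (1 + e)) (s ^ 2) / qpoch_inf (s ^ 2) (s ^ 2)).
Proof.
  move=> ns ls he. set q := s ^ 2. have nq : q <> 0 by exact: Cpow_nz.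
  have lq : (Cmod q < 1)%R by exact: Cmod_sqr_lt.
  set x := - s ^^ (1 + e). have nx : x <> 0 by exact: Cpowz_m_nz.
  have main rh : (0 <= rh)%Z -> has_sum (fun n => s ^^ (n * n + e * n) * qpoch x q (Z.to_nat n) *
    (ip q (n - rh) * ip q (n + e + rh))) (s ^^ (rh * rh + e * rh) * (qpoch_inf x q / qpoch_inf q q)).
  { move=> h. set F := (fun n => _).
    pose A := x * q ^ Z.to_nat rh.
    have nA : A <> 0 by apply: Cmult_neq_0 => //; exact: Cpow_nz.
    have Aq : A = - s ^^ (1 + e + 2 * rh).
    { rewrite /A /x /q -Cpowz_pos // Cpowz_pow // (Cpowz_add s (1 + e) (2 * rh)) // -[Z.of_nat 2]/2%Z. ring. }
    have AA : A * A = q ^^ (2 * rh + e + 1).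
    { rewrite Aq /q Cpowz_pow //. replace (- s ^^ (1 + e + 2 * rh) * - s ^^ (1 + e + 2 * rh))
        with (s ^^ (1 + e + 2 * rh) * s ^^ (1 + e + 2 * rh)) by ring.
      rewrite -Cpowz_add //. f_equal; lia. }
    have E n : F (n + rh)%Z = s ^^ (rh * rh + e * rh) * qpoch x q (Z.to_nat rh) * phi11_term q A A (2 * rh + e) n.
    { rewrite /F /phi11_term. have -> : (n + rh - rh = n)%Z by lia.
      have -> : (n + rh + e + rh = n + (2 * rh + e))%Z by lia.
      have [hn|hn] : (n < 0 \/ 0 <= n)%Z by lia.
      { rewrite (ip_neg q n) //; ring. }
      have -> : Z.to_nat (n + rh) = (Z.to_nat rh + Z.to_nat n)%nat by lia.
      rewrite qpoch_add -/A {3}Aq (Cpowz_opp_base (s ^^ (1 + e + 2 * rh))); last exact: Cpowz_nz.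
      rewrite Cpowz_mul // /q Cpowz_pow // -/q.
      transitivity (qpoch x q (Z.to_nat rh) * qpoch A q (Z.to_nat n) * (ip q n * ip q (n + (2 * rh + e))) *
        (s ^^ (rh * rh + e * rh) * s ^^ (Z.of_nat 2 * tri n) * s ^^ ((1 + e + 2 * rh) * n)) *
        ((- (1)) ^^ n * (- (1)) ^^ n)); last by ring.
      rewrite -!Cpowz_add //; last exact: Cm1_nz.
      (* One sign comes from the summand of [phi11_term], the other from the power of the negative
         number [A]; they cancel. *)
      have -> : (n + n = 2 * n)%Z by lia. rewrite sgn_even.
      have -> : ((n + rh) * (n + rh) + e * (n + rh) = rh * rh + e * rh + Z.of_nat 2 * tri n + (1 + e + 2 * rh) * n)%Z
        by trilia.
      ring. }
    have SF : summable F.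
    { apply: (summable_ext _ (fun n => s ^^ (rh * rh + e * rh) * qpoch x q (Z.to_nat rh) *
        phi11_term q A A (2 * rh + e) (n - rh))).
      - move=> n. by rewrite -E Z.sub_add.
      - apply: summable_scal. apply: (summable_shift _ (- rh)). exact: summable_phi11. }
    have -> : s ^^ (rh * rh + e * rh) * (qpoch_inf x q / qpoch_inf q q) = tsum F.
    { rewrite (tsum_shift F rh) // (tsum_ext _ _ E) tsum_scal; last exact: summable_phi11.
      rewrite phi11_sum //; last lia. rewrite (qpoch_inf_shift x q (Z.to_nat rh)) // -/A.
      rewrite /Cdiv. ring. }
    exact: summable_has_sum. }
  (* Both sides are invariant under rho -> -e - rho, which exchanges the two [ip] factors. *)
  have [h|h] : (0 <= rho \/ 0 <= - e - rho)%Z by lia.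
  - apply: has_sum_tsum. exact: main.
  - have := main _ h. move=> /has_sum_tsum.
    have -> : ((- e - rho) * (- e - rho) + e * (- e - rho) = rho * rho + e * rho)%Z by ring.
    move=> <-. apply: tsum_ext => n.
    have -> : (n - (- e - rho) = n + e + rho)%Z by lia.
    have -> : (n + e + (- e - rho) = n - rho)%Z by lia. ring.
Qed.

Lemma conj_term_bound (s : Complex.C) (e : Z) : s <> 0 -> (Cmod s < 1)%R -> (0 <= e <= 1)%Z ->
  exists K, (0 < K)%R /\ forall a n,
  (Cmod (s ^^ (n * n + e * n) * qpoch (- s ^^ (1 + e)) (s ^ 2) (Z.to_nat n) *
    (ip (s ^ 2) (n - a) * ip (s ^ 2) (n + e + a))) <= K * Cmod s ^ Z.abs_nat n)%R.
Proof.
  move=> ns ls he. have hs : (0 <= Cmod s < 1)%R by split=> //; exact: Cmod_ge_0.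
  have lq := Cmod_sqr_lt s ls.
  have [K1 [p1 H1]] := qpoch_bound (- s ^^ (1 + e)) _ lq. have [K2 [p2 H2]] := ip_bound _ lq.
  exists (K1 * (K2 * K2))%R; split; first by repeat apply: Rmult_lt_0_compat.
  move=> a n. have [h|h] : (n < 0 \/ 0 <= n)%Z by lia.
  - rewrite (ip_prod_0 _ (n - a)); last lia. rewrite Cmult_0_r Cmod_0.
    apply: Rmult_le_pos; first by left; repeat apply: Rmult_lt_0_compat.
    apply: pow_le; lra.
  - rewrite !Cmod_mult (Rmult_comm (Cmod _)) -Rmult_assoc.
    rewrite Cmod_Cpowz //; last nia.
    have a3 : (Cmod (qpoch (- s ^^ (1 + e)) (s ^ 2) (Z.to_nat n)) *
      (Cmod (ip (s ^ 2) (n - a)) * Cmod (ip (s ^ 2) (n + e + a))) <= K1 * (K2 * K2))%R.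
    { apply: Rmult_le_compat; try exact: Cmod_ge_0; try exact: H1.
      - by apply: Rmult_le_pos; exact: Cmod_ge_0.
      - by apply: Rmult_le_compat; try exact: Cmod_ge_0. }
    have a1 : (Cmod s ^ Z.to_nat (n * n + e * n) <= Cmod s ^ Z.abs_nat n)%R.
    { apply: pow_le_anti; first lra. nia. }
    have b1 : (0 <= Cmod s ^ Z.to_nat (n * n + e * n))%R by apply: pow_le; lra.
    rewrite [X in (X <= _)%R](_ : _ = (Cmod (qpoch (- s ^^ (1 + e)) (s ^ 2) (Z.to_nat n)) *
      (Cmod (ip (s ^ 2) (n - a)) * Cmod (ip (s ^ 2) (n + e + a))) * Cmod s ^ Z.to_nat (n * n + e * n))%R);
      last ring.
    apply: Rmult_le_compat => //. by repeat apply: Rmult_le_pos; exact: Cmod_ge_0.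
Qed.

(** An interchange of summation followed by [conjugate_bailey] for each r. The alpha-sequence is
    bilateral, and the map [rho] allows it to live on sparse indices such as 2 r or 2 r + 1. *)
Lemma bailey_lemma (s : Complex.C) (e : Z) (rho : Z -> Z) (alpha : Z -> Complex.C) :
  s <> 0 -> (Cmod s < 1)%R -> (0 <= e <= 1)%Z -> summable alpha ->
  tsum (fun n => s ^^ (n * n + e * n) * (qpoch (- s ^^ (1 + e)) (s ^ 2) (Z.to_nat n) *
    tsum (fun r => alpha r * (ip (s ^ 2) (n - rho r) * ip (s ^ 2) (n + e + rho r))))) =
  qpoch_inf (- s ^^ (1 + e)) (s ^ 2) / qpoch_inf (s ^ 2) (s ^ 2) *
    tsum (fun r => alpha r * s ^^ (rho r * rho r + e * rho r)).
Proof.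
  move=> ns ls he Sa. have [K [pK HK]] := conj_term_bound s e ns ls he.
  have hs : (0 <= Cmod s < 1)%R by split=> //; exact: Cmod_ge_0.
  have [K2 [p2 H2]] := ip_bound _ (Cmod_sqr_lt s ls).
  have conj := fun r => conjugate_bailey s e (rho r) ns ls he. move: conj HK H2.
  set q := s ^ 2. set x := - s ^^ (1 + e) => conj HK H2.
  pose G a n := s ^^ (n * n + e * n) * qpoch x q (Z.to_nat n) * (ip q (n - a) * ip q (n + e + a)).
  have SG a : summable (G a).
  { apply: (summable_le _ (fun n => RtoC K * geo (Cmod s) n)).
    - move=> n. rewrite [X in (_ <= X)%R]Cmod_mult Cmod_R Cmod_geo ?(Rabs_pos_eq K); try lra. exact: HK.
    - apply: summable_scal. exact: summable_geo. }
  pose F (y : Z * Z) := alpha (snd y) * G (rho (snd y)) (fst y).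
  have SF : summable F.
  { apply: (summable_le _ (fun y => RtoC K * (geo (Cmod s) (fst y) * alpha (snd y)))); last first.
    { apply: summable_scal. apply: summable_prod => //. exact: summable_geo. }
    move=> [n r]. have h := HK (rho r) n. have h' := Cmod_ge_0 (alpha r).
    apply: (Rle_trans _ (Cmod (alpha r) * Cmod (G (rho r) n))); first by right; rewrite /F Cmod_mult.
    apply: Rle_trans (Rmult_le_compat_l _ _ _ h' h) _. right.
    rewrite !Cmod_mult Cmod_R [fst _]/= [snd _]/= Cmod_geo ?(Rabs_pos_eq K); lra. }
  transitivity (tsum (fun n => tsum (fun r => F (n, r)))).
  { apply: tsum_ext => n. rewrite Cmult_assoc -tsum_scal.
    - apply: tsum_ext => r. rewrite /F /G /=. ring.
    - apply: (summable_mul_bounded _ _ (K2 * K2)) => // r. rewrite Cmod_mult.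
      by apply: Rmult_le_compat; try exact: Cmod_ge_0. }
  rewrite tsum_swap // -tsum_scal.
  - apply: tsum_ext => r.
    transitivity (alpha r * (s ^^ (rho r * rho r + e * rho r) * (qpoch_inf x q / qpoch_inf q q))); last by ring.
    rewrite -conj -tsum_scal //. exact: SG.
  - apply: (summable_mul_bounded _ _ 1) => // r.
    have h : (0 <= rho r * rho r + e * rho r)%Z.
    { have [h|h] : (0 <= rho r \/ rho r <= -1)%Z by lia. all: nia. }
    rewrite Cmod_Cpowz // -(pow1 (Z.to_nat (rho r * rho r + e * rho r))). apply: pow_incr; lra.
Qed.

(** * Bailey pairs and four Rogers-Slater sums *)

Lemma tsum_involution_0 {I : Type} (f : I -> Complex.C) (d : I -> I) : (forall i, d (d i) = i) ->
  (forall i, f (d i) = - f i) -> summable f -> tsum f = 0.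
Proof.
  move=> dd H S. have E : tsum f = - (1) * tsum f.
  { rewrite -tsum_scal // {1}(tsum_bij f d d) //. apply: tsum_ext => n. rewrite H; ring. }
  have E2 : 2 * tsum f = 2 * 0.
  { transitivity (tsum f + tsum f); first ring. rewrite {1}E; ring. }
  apply: Cmult_cancel_l E2. move=> /(f_equal fst) /=; lra.
Qed.

Lemma tsum_antisym (f : Z -> Complex.C) c : (forall n, f (c - n)%Z = - f n) -> summable f ->
  tsum f = 0.
Proof. apply: (tsum_involution_0 f (fun n => c - n)%Z) => n; lia. Qed.

Lemma sgn_opp n : (- (1)) ^^ (- n) = (- (1)) ^^ n.
Proof.
  have nz := Cm1_nz. transitivity ((- (1)) ^^ (2 * n) * (- (1)) ^^ (- n)); first by rewrite sgn_even; ring.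
  rewrite -Cpowz_add //. f_equal; lia.
Qed.

Lemma sgn_sub_even k n : (- (1)) ^^ (2 * k - n) = (- (1)) ^^ n.
Proof.
  have nz := Cm1_nz. rewrite -Z.add_opp_r Cpowz_add // sgn_even sgn_opp. ring.
Qed.

Lemma sgn_sub_odd k n : (- (1)) ^^ (2 * k - 1 - n) = - (- (1)) ^^ n.
Proof.
  have nz := Cm1_nz. have -> : (2 * k - 1 - n = (2 * (k - 1) - n) + 1)%Z by lia.
  rewrite Cpowz_succ // sgn_sub_even. ring.
Qed.

(** All sums in the Bailey pairs are finite: for r far from 0 one of the two [ip] factors has a
    negative index. *)
Ltac ipsum n := apply: (summable_Zbounded _ (- Z.abs n - 4) (Z.abs n + 4)) => ? ?;
  rewrite ip_prod_0; [ring | lia].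

(* [pairW] to [pairV] are normalised beta-sequences of Bailey pairs of Slater's families C and G;
   the relations between them are Pascal rules, where one of the two resulting sums is shifted or
   reflected and the other one may vanish by antisymmetry. *)
Section CubicPairs.
Context (q : Complex.C).
Hypothesis (nq : q <> 0) (lq : (Cmod q < 1)%R).

Definition pairW n := tsum (fun r => (- (1)) ^^ r * q ^^ (3 * r * r - r) *
  (ip q (n - 2 * r) * ip q (n + 2 * r))).
Definition pairD n := tsum (fun r => (- (1)) ^^ r * q ^^ (3 * r * r + r) *
  (ip q (n - 2 * r) * ip q (n + 1 + 2 * r))).
Definition pairB n := tsum (fun r => (- (1)) ^^ r * q ^^ (3 * r * r + r) *
  (ip q (n - 2 * r - 1) * ip q (n + 1 + 2 * r))).

Lemma pairW_alt n : pairW n = tsum (fun r => (- (1)) ^^ r * q ^^ (3 * r * r + r) *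
  (ip q (n - 2 * r) * ip q (n + 2 * r))).
Proof.
  rewrite /pairW (tsum_reflect _ 0); last by ipsum n.
  apply: tsum_ext => r. rewrite sgn_opp.
  have -> : (3 * (0 - r) * (0 - r) - (0 - r) = 3 * r * r + r)%Z by ring.
  have -> : (n - 2 * (0 - r) = n + 2 * r)%Z by ring.
  have -> : (n + 2 * (0 - r) = n - 2 * r)%Z by ring. ring.
Qed.

Lemma pairD_W n : (1 - q ^^ (2 * n + 1)) * pairD n = pairW n.
Proof.
  rewrite pairW_alt /pairD -tsum_scal; last by ipsum n.
  rewrite (tsum_ext _ (fun r => (- (1)) ^^ r * q ^^ (3 * r * r + r) * (ip q (n - 2 * r) * ip q (n + 2 * r)) +
    (- (1)) ^^ r * q ^^ (3 * r * r + 3 * r + n + 1) * (ip q (n - 2 * r - 1) * ip q (n + 1 + 2 * r)))).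
  - rewrite tsum_plus; [|by ipsum n|by ipsum n].
    rewrite (tsum_antisym (fun r => (- (1)) ^^ r * q ^^ (3 * r * r + 3 * r + n + 1) * _) (-1)); first ring.
    + move=> r. rewrite (sgn_sub_odd 0 r).
      have -> : (3 * (-1 - r) * (-1 - r) + 3 * (-1 - r) + n + 1 = 3 * r * r + 3 * r + n + 1)%Z by ring.
      have -> : (n - 2 * (-1 - r) - 1 = n + 1 + 2 * r)%Z by ring.
      have -> : (n + 1 + 2 * (-1 - r) = n - 2 * r - 1)%Z by ring. ring.
    + by ipsum n.
  - move=> r. have := ip_pascal q (n + 1 + 2 * r) (n - 2 * r) nq lq.
    have -> : (n + 1 + 2 * r + (n - 2 * r) = 2 * n + 1)%Z by ring.
    have -> : (n + 1 + 2 * r - 1 = n + 2 * r)%Z by ring. move=> E.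
    have -> : (3 * r * r + 3 * r + n + 1 = (3 * r * r + r) + (n + 1 + 2 * r))%Z by ring.
    rewrite (Cpowz_add q (3 * r * r + r) (n + 1 + 2 * r)) //.
    transitivity ((- (1)) ^^ r * q ^^ (3 * r * r + r) *
      ((1 - q ^^ (2 * n + 1)) * (ip q (n + 1 + 2 * r) * ip q (n - 2 * r)))); first ring.
    rewrite E. ring.
Qed.

Lemma pairW_succ n : (1 - q ^^ (2 * n + 2)) * pairW (n + 1) = (1 + q ^^ (n + 1)) * pairD n.
Proof.
  rewrite /pairW /pairD -!tsum_scal; try by ipsum n.
  rewrite (tsum_ext _ (fun r => (- (1)) ^^ r * q ^^ (3 * r * r - r) * (ip q (n + 1 - 2 * r) * ip q (n + 2 * r)) +
    q ^^ (n + 1) * ((- (1)) ^^ r * q ^^ (3 * r * r + r) * (ip q (n - 2 * r) * ip q (n + 1 + 2 * r))))).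
  - rewrite tsum_plus; [|by ipsum n|by apply: summable_scal; ipsum n].
    rewrite (tsum_reflect (fun r => _ * (ip q (n + 1 - 2 * r) * _)) 0); last by ipsum n.
    rewrite -tsum_plus.
    + apply: tsum_ext => r. rewrite sgn_opp.
      have -> : (3 * (0 - r) * (0 - r) - (0 - r) = 3 * r * r + r)%Z by ring.
      have -> : (n + 1 - 2 * (0 - r) = n + 1 + 2 * r)%Z by ring.
      have -> : (n + 2 * (0 - r) = n - 2 * r)%Z by ring. ring.
    + by ipsum n.
    + apply: summable_scal. by ipsum n.
  - move=> r. have := ip_pascal q (n + 1 + 2 * r) (n + 1 - 2 * r) nq lq.
    have -> : (n + 1 + 2 * r + (n + 1 - 2 * r) = 2 * n + 2)%Z by ring.
    have -> : (n + 1 + 2 * r - 1 = n + 2 * r)%Z by ring.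
    have -> : (n + 1 - 2 * r - 1 = n - 2 * r)%Z by ring. move=> E.
    have -> : (3 * r * r + r = (3 * r * r - r) + 2 * r)%Z by ring.
    rewrite (Cpowz_add q (3 * r * r - r) (2 * r)) //.
    rewrite (Cpowz_add q (n + 1) (2 * r)) // in E.
    transitivity ((- (1)) ^^ r * q ^^ (3 * r * r - r) *
      ((1 - q ^^ (2 * n + 2)) * (ip q (n + 1 + 2 * r) * ip q (n + 1 - 2 * r)))); first ring.
    rewrite E. ring.
Qed.

(** Pascal's rule applied to [pairD] with its two factors in the opposite order gives [pairB] plus
    q^n [pairW]; comparison with [pairD_W] isolates [pairB]. *)
Lemma pairB_W n : pairB n = (1 - q ^^ n) * pairW n.
Proof.
  have : (1 - q ^^ (2 * n + 1)) * pairD n = pairB n + q ^^ n * pairW n.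
  { rewrite /pairB /pairD /pairW -!tsum_scal; try by ipsum n.
    rewrite -tsum_plus; [|by ipsum n|by apply: summable_scal; ipsum n].
    apply: tsum_ext => r.
    have := ip_pascal q (n - 2 * r) (n + 1 + 2 * r) nq lq.
    have -> : (n - 2 * r + (n + 1 + 2 * r) = 2 * n + 1)%Z by ring.
    have -> : (n + 1 + 2 * r - 1 = n + 2 * r)%Z by ring. move=> E.
    have E1 : q ^^ (3 * r * r + r) * q ^^ (n - 2 * r) = q ^^ n * q ^^ (3 * r * r - r).
    { rewrite -!Cpowz_add //. f_equal; ring. }
    transitivity ((- (1)) ^^ r * q ^^ (3 * r * r + r) *
      ((1 - q ^^ (2 * n + 1)) * (ip q (n - 2 * r) * ip q (n + 1 + 2 * r)))); first ring.
    rewrite E. transitivity ((- (1)) ^^ r * q ^^ (3 * r * r + r) * (ip q (n - 2 * r - 1) * ip q (n + 1 + 2 * r)) +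
      (- (1)) ^^ r * (q ^^ (3 * r * r + r) * q ^^ (n - 2 * r)) * (ip q (n - 2 * r) * ip q (n + 2 * r))); first ring.
    rewrite E1. ring. }
  rewrite pairD_W => E. rewrite {1}E -/(pairW n). replace (pairB n) with (pairB n + q ^^ n * pairW n - q ^^ n * pairW n) by ring.
  rewrite -E. ring.
Qed.

Lemma pairW_0 : pairW 0 = 1.
Proof.
  rewrite /pairW (tsum_single _ 0%Z).
  - transitivity (1 * 1 * (ip q 0 * ip q 0)); first by []. rewrite ip_0. ring.
  - move=> r h. rewrite ip_prod_0; [ring | lia].
Qed.

End CubicPairs.

(** * Bailey pairs with half-integral powers of the base *)

Section HalfPairs.
Context (y : Complex.C).
Hypothesis (ny : y <> 0) (ly : (Cmod y < 1)%R).
Let q := y ^ 2.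

Definition pairY n := tsum (fun r => (- (1)) ^^ r * y ^^ (3 * tri r + r) *
  (ip q (n - r) * ip q (n + r))).
Definition pairX n := tsum (fun r => (- (1)) ^^ r * y ^^ (3 * tri r + 2 * r) *
  (ip q (n - r) * ip q (n + 1 + r))).
Definition pairZ n := tsum (fun r => (- (1)) ^^ r * y ^^ (3 * tri r + r) *
  (ip q (n - r) * ip q (n + 1 + r))).
Definition pairV n := tsum (fun r => (- (1)) ^^ r * y ^^ (3 * tri r) *
  (ip q (n - r) * ip q (n + r))).

Let nq : q <> 0 := Cpow_nz y 2 ny.
Let lq : (Cmod q < 1)%R := Cmod_sqr_lt y ly.

Let qy n : q ^^ n = y ^^ (2 * n).
Proof. exact: Cpowz_pow. Qed.

Lemma pairX_Y n : (1 - q ^^ (2 * n + 1)) * pairX n = (1 - y ^^ (2 * n + 1)) * pairY n.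
Proof.
  rewrite /pairX -tsum_scal; last by ipsum n.
  rewrite (tsum_ext _ (fun r => (- (1)) ^^ r * y ^^ (3 * tri r + 2 * r) * (ip q (n - r) * ip q (n + r)) +
    (- (1)) ^^ r * y ^^ (3 * tri r + 2 * r + 2 * (n + 1 + r)) * (ip q (n - r - 1) * ip q (n + 1 + r)))).
  - rewrite tsum_plus; [|by ipsum n|by ipsum n].
    rewrite (tsum_reflect (fun r => _ * (ip q (n - r) * _)) 0); last by ipsum n.
    rewrite (tsum_shift (fun r => _ * (ip q (n - r - 1) * _)) (-1)); last by ipsum n.
    rewrite /pairY -tsum_scal; last by ipsum n.
    rewrite -tsum_plus; [|by ipsum n|by ipsum n].
    apply: tsum_ext => r. rewrite sgn_opp.
    have -> : (- (1)) ^^ (r + -1) = - (- (1)) ^^ r.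
    { rewrite Cpowz_add; last exact: Cm1_nz. rewrite (sgn_opp 1) Cpowz_1. ring. }
    have -> : (3 * tri (0 - r) + 2 * (0 - r) = 3 * tri r + r)%Z by trilia.
    have -> : (3 * tri (r + -1) + 2 * (r + -1) + 2 * (n + 1 + (r + -1)) = (2 * n + 1) + (3 * tri r + r))%Z by trilia.
    have -> : (n - (0 - r) = n + r)%Z by ring. have -> : (n + (0 - r) = n - r)%Z by ring.
    have -> : (n - (r + -1) - 1 = n - r)%Z by ring. have -> : (n + 1 + (r + -1) = n + r)%Z by ring.
    rewrite (Cpowz_add y (2 * n + 1)) //. ring.
  - move=> r. have := ip_pascal q (n + 1 + r) (n - r) nq lq.
    have -> : (n + 1 + r + (n - r) = 2 * n + 1)%Z by ring.
    have -> : (n + 1 + r - 1 = n + r)%Z by ring. move=> E.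
    rewrite (Cpowz_add y (3 * tri r + 2 * r)) // -qy.
    transitivity ((- (1)) ^^ r * y ^^ (3 * tri r + 2 * r) *
      ((1 - q ^^ (2 * n + 1)) * (ip q (n + 1 + r) * ip q (n - r)))); first ring.
    rewrite E. ring.
Qed.

Lemma pairY_X n : (1 - q ^^ (2 * n + 2)) * pairY (n + 1) = pairX n.
Proof.
  rewrite /pairY -tsum_scal; last by ipsum n.
  rewrite (tsum_ext _ (fun r => (- (1)) ^^ r * y ^^ (3 * tri r + r) * (ip q (n + 1 - r) * ip q (n + r)) +
    (- (1)) ^^ r * y ^^ (3 * tri r + r + 2 * (n + 1 + r)) * (ip q (n - r) * ip q (n + 1 + r)))).
  - rewrite tsum_plus; [|by ipsum n|by ipsum n].
    rewrite (tsum_antisym (fun r => (- (1)) ^^ r * y ^^ (3 * tri r + r + 2 * (n + 1 + r)) * _) (-1)); [| |by ipsum n].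
    + rewrite Cplus_0_r (tsum_reflect _ 0); last by ipsum n.
      apply: tsum_ext => r. rewrite sgn_opp.
      have -> : (3 * tri (0 - r) + (0 - r) = 3 * tri r + 2 * r)%Z by trilia.
      have -> : (n + 1 - (0 - r) = n + 1 + r)%Z by ring.
      have -> : (n + (0 - r) = n - r)%Z by ring. ring.
    + move=> r. rewrite (sgn_sub_odd 0 r).
      have -> : (3 * tri (-1 - r) + (-1 - r) + 2 * (n + 1 + (-1 - r)) = 3 * tri r + r + 2 * (n + 1 + r))%Z by trilia.
      have -> : (n - (-1 - r) = n + 1 + r)%Z by ring.
      have -> : (n + 1 + (-1 - r) = n - r)%Z by ring. ring.
  - move=> r. have := ip_pascal q (n + 1 + r) (n + 1 - r) nq lq.
    have -> : (n + 1 + r + (n + 1 - r) = 2 * n + 2)%Z by ring.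
    have -> : (n + 1 + r - 1 = n + r)%Z by ring. have -> : (n + 1 - r - 1 = n - r)%Z by ring. move=> E.
    rewrite (Cpowz_add y (3 * tri r + r)) // -qy.
    transitivity ((- (1)) ^^ r * y ^^ (3 * tri r + r) *
      ((1 - q ^^ (2 * n + 2)) * (ip q (n + 1 + r) * ip q (n + 1 - r)))); first ring.
    rewrite E. ring.
Qed.

Lemma pairY_0 : pairY 0 = 1.
Proof.
  rewrite /pairY (tsum_single _ 0%Z).
  - transitivity (1 * 1 * (ip q 0 * ip q 0)); first by []. rewrite ip_0. ring.
  - move=> r h. rewrite ip_prod_0; [ring | lia].
Qed.

(** For n > 0, multiplied by 1 - q^(2n) both sides become y^(2n) times [pairX (n - 1)]: the other
    half of Pascal's rule for [pairV] is antisymmetric under r -> 1 - r, which fixes tri r. *)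
Lemma pairV_Y n : (0 <= n)%Z -> pairV n = y ^^ (2 * n) * pairY n.
Proof.
  move=> hn. have [->|h] : (n = 0 \/ 0 < n)%Z by lia.
  { rewrite pairY_0 Cpowz_0 Cmult_1_r /pairV (tsum_single _ 0%Z).
    - transitivity (1 * 1 * (ip q 0 * ip q 0)); first by []. rewrite ip_0. ring.
    - move=> r hr. rewrite ip_prod_0; [ring | lia]. }
  have h2 : (0 < 2 * n)%Z by lia.
  apply: (Cmult_cancel_l _ _ _ (Cpowz_1_minus_nz q (2 * n) nq lq h2)).
  have := pairY_X (n - 1). have -> : (n - 1 + 1 = n)%Z by ring.
  have -> : (2 * (n - 1) + 2 = 2 * n)%Z by ring. move=> E.
  transitivity (y ^^ (2 * n) * ((1 - q ^^ (2 * n)) * pairY n)); last ring.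
  rewrite E /pairV /pairX -!tsum_scal; try by ipsum n.
  rewrite (tsum_ext _ (fun r => (- (1)) ^^ r * y ^^ (3 * tri r) * (ip q (n - r) * ip q (n + r - 1)) +
    y ^^ (2 * n) * ((- (1)) ^^ r * y ^^ (3 * tri r + 2 * r) * (ip q (n - 1 - r) * ip q (n - 1 + 1 + r))))).
  - rewrite tsum_plus; [|by ipsum n|by apply: summable_scal; ipsum n].
    rewrite (tsum_antisym (fun r => (- (1)) ^^ r * y ^^ (3 * tri r) * _) 1); [ring| |by ipsum n].
    move=> r. rewrite (sgn_sub_odd 1 r). have -> : tri (1 - r) = tri r by trilia.
    have -> : (n - (1 - r) = n + r - 1)%Z by ring. have -> : (n + (1 - r) - 1 = n - r)%Z by ring. ring.
  - move=> r. have := ip_pascal q (n + r) (n - r) nq lq.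
    have -> : (n + r + (n - r) = 2 * n)%Z by ring.
    have -> : (n - r - 1 = n - 1 - r)%Z by ring. have -> : (n - 1 + 1 + r = n + r)%Z by ring. move=> E'.
    have E1 : y ^^ (2 * n) * y ^^ (3 * tri r + 2 * r) = y ^^ (3 * tri r) * q ^^ (n + r).
    { rewrite qy -!Cpowz_add //. f_equal; ring. }
    transitivity ((- (1)) ^^ r * y ^^ (3 * tri r) *
      ((1 - q ^^ (2 * n)) * (ip q (n + r) * ip q (n - r)))); first ring.
    rewrite E'. transitivity ((- (1)) ^^ r * y ^^ (3 * tri r) * (ip q (n - r) * ip q (n + r - 1)) +
      (y ^^ (3 * tri r) * q ^^ (n + r)) * ((- (1)) ^^ r * (ip q (n - 1 - r) * ip q (n + r)))); first ring.
    rewrite -E1. ring.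
Qed.

(** Pascal's rule expresses (1 - q^(2n+1)) [pairZ] through [pairY] and [pairV], and [pairV_Y]
    eliminates [pairV]. The result is a pair relative to a = q with the beta-sequence of [pairY], as
    needed when [bailey_lemma] is used with e = 1. *)
Lemma pairZ_Y n : (0 <= n)%Z -> pairZ n = pairY n.
Proof.
  move=> hn. have h : (0 < 2 * n + 1)%Z by lia.
  apply: (Cmult_cancel_l _ _ _ (Cpowz_1_minus_nz q (2 * n + 1) nq lq h)).
  transitivity (pairY n - y ^^ (2 * n + 2) * pairV n); last first.
  { rewrite pairV_Y // qy. have -> : (2 * (2 * n + 1) = (2 * n + 2) + 2 * n)%Z by ring.
    rewrite (Cpowz_add y (2 * n + 2)) //. ring. }
  rewrite /pairZ -tsum_scal; last by ipsum n.
  rewrite (tsum_ext _ (fun r => (- (1)) ^^ r * y ^^ (3 * tri r + r) * (ip q (n - r) * ip q (n + r)) +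
    (- (1)) ^^ r * y ^^ (3 * tri r + r + 2 * (n + 1 + r)) * (ip q (n - r - 1) * ip q (n + 1 + r)))).
  - rewrite tsum_plus; [|by ipsum n|by ipsum n].
    rewrite (tsum_shift (fun r => _ * (ip q (n - r - 1) * _)) (-1)); last by ipsum n.
    replace (pairY n - y ^^ (2 * n + 2) * pairV n) with (pairY n + - y ^^ (2 * n + 2) * pairV n) by ring.
    rewrite /pairV -tsum_scal; last by ipsum n. f_equal. apply: tsum_ext => r.
    have -> : (- (1)) ^^ (r + -1) = - (- (1)) ^^ r.
    { rewrite Cpowz_add; last exact: Cm1_nz. rewrite (sgn_opp 1) Cpowz_1. ring. }
    have -> : (3 * tri (r + -1) + (r + -1) + 2 * (n + 1 + (r + -1)) = (2 * n + 2) + 3 * tri r)%Z by trilia.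
    have -> : (n - (r + -1) - 1 = n - r)%Z by ring. have -> : (n + 1 + (r + -1) = n + r)%Z by ring.
    rewrite (Cpowz_add y (2 * n + 2)) //. ring.
  - move=> r. have := ip_pascal q (n + 1 + r) (n - r) nq lq.
    have -> : (n + 1 + r + (n - r) = 2 * n + 1)%Z by ring.
    have -> : (n + 1 + r - 1 = n + r)%Z by ring. move=> E.
    rewrite (Cpowz_add y (3 * tri r + r)) // -qy.
    transitivity ((- (1)) ^^ r * y ^^ (3 * tri r + r) *
      ((1 - q ^^ (2 * n + 1)) * (ip q (n + 1 + r) * ip q (n - r)))); first ring.
    rewrite E. ring.
Qed.

End HalfPairs.

Lemma Cmod_Cpowz_lt1 q a : q <> 0 -> (Cmod q < 1)%R -> (0 < a)%Z -> (Cmod (q ^^ a) < 1)%R.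
Proof.
  move=> nq lq ha. rewrite Cpowz_pos; last lia.
  have -> : Z.to_nat a = S (Z.to_nat (a - 1)) by lia. rewrite Cpow_S. exact: Cmod_mul_pow_lt.
Qed.

Lemma summable_quad q a b : q <> 0 -> (Cmod q < 1)%R -> (0 < a)%Z ->
  summable (fun r => q ^^ (a * tri r + b * r)).
Proof.
  move=> nq lq ha.
  apply: summable_ext (summable_theta (q ^^ a) (q ^^ b) (Cpowz_nz _ _ nq) (Cpowz_nz _ _ nq)
    (Cmod_Cpowz_lt1 _ _ nq lq ha)) => r.
  by rewrite !Cpowz_mul // Cpowz_add.
Qed.

Lemma summable_quad_sgn q a b : q <> 0 -> (Cmod q < 1)%R -> (0 < a)%Z ->
  summable (fun r => (- (1)) ^^ r * q ^^ (a * tri r + b * r)).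
Proof.
  move=> nq lq ha. apply: (summable_ext _ (fun r => q ^^ (a * tri r + b * r) * (- (1)) ^^ r)).
  - move=> r; ring.
  - apply: (summable_mul_bounded _ _ 1); last exact: summable_quad.
    move=> r. rewrite Cmod_sgn; lra.
Qed.

Section SlaterSums.
Context (s : Complex.C) (ns : s <> 0) (ls : (Cmod s < 1)%R).
Let q := s ^ 2.
Let nq : q <> 0 := Cpow_nz s 2 ns.
Let lq : (Cmod q < 1)%R := Cmod_sqr_lt s ls.
Let qs n : q ^^ n = s ^^ (2 * n).
Proof. exact: Cpowz_pow. Qed.

Let nms : - s <> 0.
Proof. move=> E; apply: ns; replace s with (- - s) by ring; rewrite E; ring. Qed.

Let lms : (Cmod (- s) < 1)%R.
Proof. by rewrite Cmod_opp. Qed.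

Let qms : (- s) ^ 2 = q.
Proof. rewrite /q. ring. Qed.

Lemma one_plus_nz q' n : q' <> 0 -> (Cmod q' < 1)%R -> (0 < n)%Z -> 1 + q' ^^ n <> 0.
Proof.
  move=> nq' lq' hn. replace (1 + q' ^^ n) with (1 - - q' ^^ n) by ring.
  apply: one_minus_nz. rewrite Cmod_opp. exact: Cmod_Cpowz_lt1.
Qed.

Lemma ip_double_step n : (1 - s ^^ (2 * n + 1)) * (1 - s ^^ (2 * n + 2)) * ip s (2 * (n + 1)) = ip s (2 * n).
Proof.
  have E1 := ip_pred s (2 * n + 2) ls. have E2 := ip_pred s (2 * n + 1) ls.
  have e1 : (2 * n + 2 - 1 = 2 * n + 1)%Z by ring. have e2 : (2 * n + 1 - 1 = 2 * n)%Z by ring.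
  rewrite e1 in E1. rewrite e2 in E2. have -> : (2 * (n + 1) = 2 * n + 2)%Z by ring.
  rewrite E2 E1. ring.
Qed.

Lemma pairW_neg n : (n < 0)%Z -> pairW q n = 0.
Proof. move=> h. apply: tsum_zero => r. rewrite ip_prod_0; [ring | lia]. Qed.

(** Both sides obey the same first-order recursion in n, obtained from [pairD_W] and [pairW_succ].
    The factor (-s;s^2)_n is the one that [bailey_lemma] carries for e = 0. *)
Lemma ip_pairW n : ip s (2 * n) = qpoch (- s) q (Z.to_nat n) * pairW q n.
Proof.
  have [h|h] : (n < 0 \/ 0 <= n)%Z by lia.
  { rewrite pairW_neg // ip_neg; [ring | lia]. }
  move: n h. apply: natlike_ind => [|n hn IH].
  { rewrite pairW_0 ip_0 /=. ring. }
  rewrite -Z.add_1_r. have -> : Z.to_nat (n + 1) = S (Z.to_nat n) by lia.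
  rewrite -[qpoch (- s) q (S _)]/(qpoch (- s) q (Z.to_nat n) * (1 - - s * q ^ Z.to_nat n)) -Cpowz_pos //.
  have e : 1 - - s * q ^^ n = 1 + s ^^ (2 * n + 1) by rewrite qs Cpowz_succ //; ring.
  rewrite e.
  have h1 : (0 < n + 1)%Z by lia. have h2 : (0 < 2 * n + 1)%Z by lia. have h3 : (0 < 2 * n + 2)%Z by lia.
  apply: (Cmult_cancel_l _ _ _ (Cpowz_1_minus_nz s _ ns ls h2)).
  apply: (Cmult_cancel_l _ _ _ (Cpowz_1_minus_nz s _ ns ls h3)).
  transitivity (ip s (2 * n)); first by rewrite -(ip_double_step n); ring.
  apply: (Cmult_cancel_l _ _ _ (one_plus_nz q _ nq lq h1)).
  have W1 := pairD_W q nq lq n. have W2 := pairW_succ q nq lq n.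
  have f1 : 1 - q ^^ (2 * n + 1) = (1 - s ^^ (2 * n + 1)) * (1 + s ^^ (2 * n + 1)).
  { rewrite qs. have -> : (2 * (2 * n + 1) = (2 * n + 1) + (2 * n + 1))%Z by ring. rewrite Cpowz_add //. ring. }
  have f2 : 1 - q ^^ (2 * n + 2) = (1 - s ^^ (2 * n + 2)) * (1 + q ^^ (n + 1)).
  { rewrite !qs. have -> : (2 * (2 * n + 2) = (2 * n + 2) + (2 * n + 2))%Z by ring.
    have -> : (2 * (n + 1) = 2 * n + 2)%Z by ring. rewrite Cpowz_add //. ring. }
  rewrite IH. transitivity (qpoch (- s) q (Z.to_nat n) * (1 + q ^^ (n + 1)) * pairW q n); first ring.
  transitivity (qpoch (- s) q (Z.to_nat n) * ((1 - s ^^ (2 * n + 1)) * (1 + s ^^ (2 * n + 1))) *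
    ((1 - s ^^ (2 * n + 2)) * (1 + q ^^ (n + 1)) * pairW q (n + 1))); last ring.
  rewrite -f2 W2 -W1 f1. ring.
Qed.

Let qpoch_succ n : (0 <= n)%Z ->
  qpoch (- s ^^ 2) q (Z.to_nat (n + 1)) = qpoch (- s ^^ 2) q (Z.to_nat n) * (1 + q ^^ (n + 1)).
Proof.
  move=> hn. have -> : Z.to_nat (n + 1) = S (Z.to_nat n) by lia.
  rewrite -[qpoch _ q (S _)]/(qpoch (- s ^^ 2) q (Z.to_nat n) * (1 - - s ^^ 2 * q ^ Z.to_nat n)) -Cpowz_pos //.
  rewrite Cpowz_succ //. have -> : s ^^ 2 = q by rewrite Cpowz_pos. ring.
Qed.

(** The root of the base is taken to be -s: the factor 1 - y^(2n+1) of [pairX_Y] is then 1 +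
    s^(2n+1), which cancels against 1 - s^(4n+2) and leaves the factor 1 - s^(2n+1) of (s;s)_(2n+1).
    The factor (-s^2;s^2)_n fits [bailey_lemma] for e = 1. *)
Lemma ip_pairY n : (0 <= n)%Z -> ip s (2 * n) = qpoch (- s ^^ 2) q (Z.to_nat n) * pairY (- s) n.
Proof.
  move: n. apply: natlike_ind => [|n hn IH].
  { rewrite pairY_0 // ip_0 /=. ring. }
  rewrite -Z.add_1_r qpoch_succ //.
  have h1 : (0 < n + 1)%Z by lia. have h2 : (0 < 2 * n + 1)%Z by lia. have h3 : (0 < 2 * n + 2)%Z by lia.
  apply: (Cmult_cancel_l _ _ _ (Cpowz_1_minus_nz s _ ns ls h2)).
  apply: (Cmult_cancel_l _ _ _ (Cpowz_1_minus_nz s _ ns ls h3)).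
  transitivity (ip s (2 * n)); first by rewrite -(ip_double_step n); ring.
  have X1 := pairX_Y (- s) nms lms n. have X2 := pairY_X (- s) nms lms n. rewrite qms in X1 X2.
  have f0 : (- s) ^^ (2 * n + 1) = - s ^^ (2 * n + 1).
  { rewrite Cpowz_opp_base // Cpowz_succ; last exact: Cm1_nz. rewrite sgn_even. ring. }
  have f1 : 1 - q ^^ (2 * n + 1) = (1 - s ^^ (2 * n + 1)) * (1 + s ^^ (2 * n + 1)).
  { rewrite qs. have -> : (2 * (2 * n + 1) = (2 * n + 1) + (2 * n + 1))%Z by ring. rewrite Cpowz_add //. ring. }
  have f2 : 1 - q ^^ (2 * n + 2) = (1 - s ^^ (2 * n + 2)) * (1 + q ^^ (n + 1)).
  { rewrite !qs. have -> : (2 * (2 * n + 2) = (2 * n + 2) + (2 * n + 2))%Z by ring.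
    have -> : (2 * (n + 1) = 2 * n + 2)%Z by ring. rewrite Cpowz_add //. ring. }
  apply: (Cmult_cancel_l _ _ _ (one_plus_nz s _ ns ls h2)).
  rewrite f0 in X1.
  transitivity (qpoch (- s ^^ 2) q (Z.to_nat n) * ((1 - - s ^^ (2 * n + 1)) * pairY (- s) n)).
  { rewrite IH. ring. }
  rewrite -X1 f1 -X2 f2. ring.
Qed.

Lemma ip_pairX n : (0 <= n)%Z -> ip s (2 * n + 1) = qpoch (- s ^^ 2) q (Z.to_nat n) * pairX (- s) n.
Proof.
  move=> hn. have h2 : (0 < 2 * n + 1)%Z by lia.
  apply: (Cmult_cancel_l _ _ _ (Cpowz_1_minus_nz s _ ns ls h2)).
  rewrite -ip_pred //. have -> : (2 * n + 1 - 1 = 2 * n)%Z by ring.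
  rewrite ip_pairY //.
  have X1 := pairX_Y (- s) nms lms n. rewrite qms in X1.
  have f0 : (- s) ^^ (2 * n + 1) = - s ^^ (2 * n + 1).
  { rewrite Cpowz_opp_base // Cpowz_succ; last exact: Cm1_nz. rewrite sgn_even. ring. }
  have f1 : 1 - q ^^ (2 * n + 1) = (1 - s ^^ (2 * n + 1)) * (1 + s ^^ (2 * n + 1)).
  { rewrite qs. have -> : (2 * (2 * n + 1) = (2 * n + 1) + (2 * n + 1))%Z by ring. rewrite Cpowz_add //. ring. }
  rewrite f0 f1 in X1.
  apply: (Cmult_cancel_l _ _ _ (one_plus_nz s _ ns ls h2)).
  transitivity (qpoch (- s ^^ 2) q (Z.to_nat n) * ((1 - - s ^^ (2 * n + 1)) * pairY (- s) n)); first ring.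
  rewrite -X1. ring.
Qed.

Lemma slater_U1 : tsum (fun n => s ^^ (n * n) * ip s (2 * n)) =
  qpoch_inf (- s) q / qpoch_inf q q * tsum (fun r => (- (1)) ^^ r * s ^^ (20 * tri r + 12 * r)).
Proof.
  have Sa : summable (fun r => (- (1)) ^^ r * q ^^ (3 * r * r - r)).
  { apply: summable_ext (summable_quad_sgn q 6 2 nq lq ltac:(lia)) => r. do 2 f_equal. trilia. }
  have B := bailey_lemma s 0 (fun r => 2 * r)%Z _ ns ls ltac:(lia) Sa.
  have e0 : s ^^ (1 + 0) = s by exact: Cpowz_1. rewrite e0 -/q in B.
  transitivity (qpoch_inf (- s) q / qpoch_inf q q * tsum (fun r => (- (1)) ^^ r * q ^^ (3 * r * r - r) *
    s ^^ (2 * r * (2 * r) + 0 * (2 * r)))).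
  - rewrite -B. apply: tsum_ext => n. rewrite ip_pairW. have -> : (n * n + 0 * n = n * n)%Z by ring.
    do 2 f_equal. apply: tsum_ext => r. by have -> : (n + 0 + 2 * r = n + 2 * r)%Z by ring.
  (* Bailey's lemma produces the exponent 10 r^2 - 2 r; the reflection r -> -r brings it to the
     stated form. *)
  - f_equal. rewrite (tsum_reflect _ 0).
    + apply: tsum_ext => r. rewrite sgn_opp qs -Cmult_assoc -Cpowz_add //. do 2 f_equal. trilia.
    + apply: summable_ext (summable_quad_sgn s 20 8 ns ls ltac:(lia)) => r.
      rewrite qs -Cmult_assoc -Cpowz_add //. do 2 f_equal. trilia.
Qed.

(** The odd index 2n - 1 arises from 1/(s;s)_(2n-1) = (1 - s^(2n))/(s;s)_(2n), so [pairB] applies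
    with alpha placed at the odd indices 2 r + 1. Passing from n to n + 1 then releases one factor
    s, which is cancelled. *)
Lemma slater_V2 : tsum (fun n => s ^^ (n * n + 2 * n) * ip s (2 * n + 1)) =
  qpoch_inf (- s) q / qpoch_inf q q * tsum (fun r => (- (1)) ^^ r * s ^^ (20 * tri r + 16 * r)).
Proof.
  have Sa : summable (fun r => (- (1)) ^^ r * q ^^ (3 * r * r + r)).
  { apply: summable_ext (summable_quad_sgn q 6 4 nq lq ltac:(lia)) => r. do 2 f_equal. trilia. }
  have B := bailey_lemma s 0 (fun r => 2 * r + 1)%Z _ ns ls ltac:(lia) Sa.
  have e0 : s ^^ (1 + 0) = s by exact: Cpowz_1. rewrite e0 -/q in B.
  have E : tsum (fun n => s ^^ (n * n) * ip s (2 * n - 1)) = qpoch_inf (- s) q / qpoch_inf q q *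
    tsum (fun r => (- (1)) ^^ r * q ^^ (3 * r * r + r) * s ^^ ((2 * r + 1) * (2 * r + 1) + 0 * (2 * r + 1))).
  { rewrite -B. apply: tsum_ext => n. rewrite ip_pred // ip_pairW. have -> : (n * n + 0 * n = n * n)%Z by ring.
    f_equal. rewrite -qs. transitivity (qpoch (- s) q (Z.to_nat n) * ((1 - q ^^ n) * pairW q n)); first ring.
    rewrite -(pairB_W q nq lq). f_equal. apply: tsum_ext => r.
    have -> : (n - (2 * r + 1) = n - 2 * r - 1)%Z by ring.
    by have -> : (n + 0 + (2 * r + 1) = n + 1 + 2 * r)%Z by ring. }
  apply: (Cmult_cancel_l s) => //.
  transitivity (tsum (fun n => s ^^ (n * n) * ip s (2 * n - 1))).
  - have [K [pK HK]] := ip_bound s ls.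
    have S0 : summable (fun n => s ^^ (n * n) * ip s (2 * n - 1)).
    { apply: (summable_mul_bounded _ _ K) => //.
      apply: summable_ext (summable_quad s 2 1 ns ls ltac:(lia)) => r. f_equal. trilia. }
    rewrite (tsum_shift (fun n => s ^^ (n * n) * _) 1) // -tsum_scal.
    + apply: tsum_ext => n. have -> : ((n + 1) * (n + 1) = (n * n + 2 * n) + 1)%Z by ring.
      have -> : (2 * (n + 1) - 1 = 2 * n + 1)%Z by ring. rewrite Cpowz_succ //. ring.
    + apply: (summable_mul_bounded _ _ K) => //.
      apply: summable_ext (summable_quad s 2 3 ns ls ltac:(lia)) => r. f_equal. trilia.
  - rewrite E. transitivity (qpoch_inf (- s) q / qpoch_inf q q *
      (s * tsum (fun r => (- (1)) ^^ r * s ^^ (20 * tri r + 16 * r)))); last ring.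
    f_equal. rewrite -tsum_scal; last exact: summable_quad_sgn.
    apply: tsum_ext => r. rewrite qs -Cmult_assoc -Cpowz_add //.
    have -> : (2 * (3 * r * r + r) + ((2 * r + 1) * (2 * r + 1) + 0 * (2 * r + 1)) = 20 * tri r + 16 * r + 1)%Z by trilia.
    rewrite (Cpowz_succ s) //. ring.
Qed.

Let ms_even n : (- s) ^^ (2 * n) = s ^^ (2 * n).
Proof. rewrite Cpowz_opp_base // sgn_even. ring. Qed.

Lemma slater_V1 : tsum (fun n => s ^^ (n * n + n) * ip s (2 * n + 1)) =
  qpoch_inf (- q) q / qpoch_inf q q * tsum (fun r => (- (1)) ^^ r * (- s) ^^ (5 * tri r + 4 * r)).
Proof.
  have Sa : summable (fun r => (- (1)) ^^ r * (- s) ^^ (3 * tri r + 2 * r)).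
  { apply: summable_quad_sgn => //. }
  have B := bailey_lemma s 1 (fun r => r) _ ns ls ltac:(lia) Sa.
  have e0 : s ^^ 2 = q by rewrite Cpowz_pos. rewrite -/q [(1 + 1)%Z]/= e0 in B.
  transitivity (qpoch_inf (- q) q / qpoch_inf q q * tsum (fun r => (- (1)) ^^ r * (- s) ^^ (3 * tri r + 2 * r) *
    s ^^ (r * r + 1 * r))).
  - rewrite -B. apply: tsum_ext => n. have -> : (n * n + 1 * n = n * n + n)%Z by ring. f_equal.
    have [h|h] : (n < 0 \/ 0 <= n)%Z by lia.
    + rewrite ip_neg; last lia. rewrite tsum_zero; first ring.
      move=> r. rewrite ip_prod_0; [ring | lia].
    + rewrite ip_pairX // e0. by rewrite /pairX qms.
  - f_equal. apply: tsum_ext => r.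
    (* The exponent r^2 + r is even, so s may be replaced by -s and merged with the other power. *)
    have -> : (r * r + 1 * r = 2 * (tri r + r))%Z by trilia. rewrite -ms_even -Cmult_assoc -Cpowz_add //.
    do 2 f_equal. ring.
Qed.

Lemma slater_U2 : tsum (fun n => s ^^ (n * n + n) * ip s (2 * n)) =
  qpoch_inf (- q) q / qpoch_inf q q * tsum (fun r => (- (1)) ^^ r * (- s) ^^ (5 * tri r + 3 * r)).
Proof.
  have Sa : summable (fun r => (- (1)) ^^ r * (- s) ^^ (3 * tri r + 1 * r)).
  { apply: summable_quad_sgn => //. }
  have B := bailey_lemma s 1 (fun r => r) _ ns ls ltac:(lia) Sa.
  have e0 : s ^^ 2 = q by rewrite Cpowz_pos. rewrite -/q [(1 + 1)%Z]/= e0 in B.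
  transitivity (qpoch_inf (- q) q / qpoch_inf q q * tsum (fun r => (- (1)) ^^ r * (- s) ^^ (3 * tri r + 1 * r) *
    s ^^ (r * r + 1 * r))).
  - rewrite -B. apply: tsum_ext => n. have -> : (n * n + 1 * n = n * n + n)%Z by ring. f_equal.
    have [h|h] : (n < 0 \/ 0 <= n)%Z by lia.
    + rewrite ip_neg; last lia. rewrite tsum_zero; first ring.
      move=> r. rewrite ip_prod_0; [ring | lia].
    + rewrite ip_pairY // e0 -pairZ_Y //. rewrite /pairZ qms. f_equal. apply: tsum_ext => r.
      by rewrite Z.mul_1_l.
  - f_equal. apply: tsum_ext => r.
    have -> : (r * r + 1 * r = 2 * (tri r + r))%Z by trilia. rewrite -ms_even -Cmult_assoc -Cpowz_add //.
    do 2 f_equal. ring.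
Qed.

End SlaterSums.

(** * Identities between binary theta series *)

(** For 0 < b < a the triple product makes this (q^b, q^(a-b), q^a; q^a)_oo; [TP] is the unsigned
    series, with -q^b and -q^(a-b) instead. *)
Definition TH q (a b : Z) : Complex.C := tsum (fun r => (- (1)) ^^ r * q ^^ (a * tri r + b * r)).
Definition TP q (a b : Z) : Complex.C := tsum (fun r => q ^^ (a * tri r + b * r)).

Lemma Zparity n : exists k, (n = 2 * k \/ n = 2 * k + 1)%Z.
Proof. exists (n / 2)%Z. have := Z.div_mod n 2. have := Z.mod_pos_bound n 2. lia. Qed.

(* [tri] is invariant under [x -> 1 - x], so a sum over either parity class of its argument gives the
   same theta series. *)
Lemma psi_times (b : Complex.C) (c : Z -> Z) (f : Z -> Complex.C) : b <> 0 -> (Cmod b < 1)%R -> summable f ->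
  summable (fun x : Z * Z => f (fst x) * b ^^ tri (2 * snd x + c (fst x))) /\
  tsum (fun x : Z * Z => f (fst x) * b ^^ tri (2 * snd x + c (fst x))) = tsum f * TP b 4 3.
Proof.
  move=> nb lb Sf. have h4 : (0 < 4)%Z by lia. have Sp := summable_quad b 4 3 nb lb h4.
  pose e (x : Z * Z) := (fst x, if Z.even (c (fst x)) then (- snd x - c (fst x) / 2)%Z
    else (snd x + (c (fst x) - 1) / 2)%Z).
  pose d (x : Z * Z) := (fst x, if Z.even (c (fst x)) then (- snd x - c (fst x) / 2)%Z
    else (snd x - (c (fst x) - 1) / 2)%Z).
  have de x : d (e x) = x by case: x => m n; rewrite /d /e /=; case: Z.even; f_equal; lia.
  have ed x : e (d x) = x by case: x => m n; rewrite /d /e /=; case: Z.even; f_equal; lia.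
  have inj : injective_map e by move=> x y E; rewrite -(de x) E de.
  pose G (x : Z * Z) := f (fst x) * b ^^ (4 * tri (snd x) + 3 * snd x).
  have SG : summable G := summable_prod _ _ Sf Sp.
  have E x : f (fst x) * b ^^ tri (2 * snd x + c (fst x)) = G (e x).
  { case: x => m n. rewrite /G /e. cbn [fst snd]. f_equal. f_equal.
    have [k [hk|hk]] := Zparity (c m); rewrite hk.
    - have -> : Z.even (2 * k) = true by rewrite Z.even_mul.
      have -> : (2 * k / 2 = k)%Z by rewrite Z.mul_comm Z.div_mul. trilia.
    - have -> : Z.even (2 * k + 1) = false by rewrite Z.even_add Z.even_mul.
      have -> : ((2 * k + 1 - 1) / 2 = k)%Z by rewrite Z.add_simpl_r Z.mul_comm Z.div_mul. trilia. }
  split.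
  - apply: summable_ext E _. exact: summable_comp.
  - rewrite (tsum_ext _ _ E) -(tsum_bij G e d) //. exact: tsum_prod.
Qed.

Ltac injlia := let E := fresh in
  intros [? ?] [? ?] E; generalize (f_equal fst E) (f_equal snd E); cbn [fst snd];
  intros; f_equal; lia.

Ltac neqlia := let E := fresh in
  intros [? ?] [? ?] E; generalize (f_equal fst E) (f_equal snd E); cbn [fst snd]; lia.

Lemma tsum_split_snd (F : Z * Z -> Complex.C) : summable F ->
  tsum F = tsum (fun x => F (fst x, (2 * snd x)%Z)) + tsum (fun x => F (fst x, (2 * snd x + 1)%Z)).
Proof.
  apply: (tsum_split2 F (fun x => (fst x, (2 * snd x)%Z)) (fun x => (fst x, (2 * snd x + 1)%Z))).
  - injlia.
  - injlia.
  - neqlia.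
  - move=> [a b]. have [k [->|->]] := Zparity b; [left | right]; by exists (a, k).
Qed.

Lemma tsum_split_diag (F : Z * Z -> Complex.C) : summable F ->
  tsum F = tsum (fun x => F ((fst x + snd x)%Z, (fst x - snd x)%Z)) +
    tsum (fun x => F ((fst x + snd x + 1)%Z, (fst x - snd x)%Z)).
Proof.
  apply: (tsum_split2 F (fun x => ((fst x + snd x)%Z, (fst x - snd x)%Z))
    (fun x => ((fst x + snd x + 1)%Z, (fst x - snd x)%Z))).
  - injlia.
  - injlia.
  - neqlia.
  - move=> [a b]. have [k [h|h]] := Zparity (a + b); [left | right].
    + exists (k, (a - k)%Z) => /=; f_equal; lia.
    + exists (k, (a - k - 1)%Z) => /=; f_equal; lia.
Qed.

Section Lattice.
Context (p : Complex.C) (np : p <> 0) (lp : (Cmod p < 1)%R).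

(** Every summand of the lattice sums is brought to this form, so that comparing two summands means
    comparing the integers x and the parities of a. The argument [t] of [mono_eq] and [mono_eq_opp]
    witnesses the parity. *)
Definition mono (a x : Z) : Complex.C := (- (1)) ^^ a * p ^^ x.

Lemma mono_mul a x b y : mono a x * mono b y = mono (a + b) (x + y).
Proof. rewrite /mono !Cpowz_add //; last exact: Cm1_nz. ring. Qed.

Lemma mono_eq t a x b y : (a = b + 2 * t)%Z -> x = y -> mono a x = mono b y.
Proof.
  move=> -> ->. rewrite /mono Cpowz_add; last exact: Cm1_nz. rewrite sgn_even. ring.
Qed.

Lemma mono_eq_opp t a x b y : (a = b + 1 + 2 * t)%Z -> x = y -> mono a x = - mono b y.
Proof.
  move=> -> ->. rewrite /mono Cpowz_add; last exact: Cm1_nz. rewrite sgn_even Cpowz_succ; last exact: Cm1_nz. ring.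
Qed.

Lemma mono_pow x : p ^^ x = mono 0 x.
Proof. rewrite /mono Cpowz_0. ring. Qed.

Lemma mono_base : p = mono 0 1.
Proof. by rewrite -mono_pow Cpowz_1. Qed.

Lemma mono_opp k x : (- p ^ k) ^^ x = mono x (Z.of_nat k * x).
Proof. rewrite Cpowz_opp_base; last exact: Cpow_nz. by rewrite Cpowz_pow. Qed.

Lemma sgn_mono a : (- (1)) ^^ a = mono a 0.
Proof. rewrite /mono Cpowz_0. ring. Qed.

Lemma opp_pow_nz k : - p ^ k <> 0.
Proof. rewrite -Cpowz_nat. exact: Cpowz_m_nz. Qed.

Lemma opp_pow_lt k : (0 < k)%nat -> (Cmod (- p ^ k) < 1)%R.
Proof. move=> h. rewrite Cmod_opp -Cpowz_nat. apply: Cmod_Cpowz_lt1 => //; lia. Qed.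

Ltac mononorm := cbn [fst snd]; rewrite ?mono_opp ?mono_pow ?sgn_mono ?mono_mul; rewrite ?mono_mul.
Ltac mononorm_p := cbn [fst snd]; rewrite ?mono_opp ?mono_pow ?sgn_mono ?mono_mul mono_base; rewrite ?mono_mul.

(* In the four identities below the lattice of the right-hand side is cut into sublattices; on each of
   them an affine change of variables either produces one of the products of the left-hand side or
   pairs off the summands with opposite signs. *)
Lemma lattice_III :
  TH p 24 12 * TH p 40 24 + p * (TP (- p ^ 6) 4 3 * TH (- p ^ 2) 5 4) = TP p 4 3 * TH p 15 9.
Proof.
  have S1 : summable _ := summable_quad_sgn p 15 9 np lp ltac:(lia).
  have [SR ER] := psi_times p (fun m => m + 1)%Z _ np lp S1.
  have S2 : summable _ := summable_quad_sgn (- p ^ 2) 5 4 (opp_pow_nz 2) (opp_pow_lt 2 ltac:(lia)) ltac:(lia).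
  have [SB EB] := psi_times (- p ^ 6) (fun k => k + 2)%Z _ (opp_pow_nz 6) (opp_pow_lt 6 ltac:(lia)) S2.
  have S3 : summable _ := summable_quad_sgn p 24 12 np lp ltac:(lia).
  have S4 : summable _ := summable_quad_sgn p 40 24 np lp ltac:(lia).
  have EA := tsum_prod _ _ S4 S3.
  rewrite -/(TH p 15 9) in ER. rewrite -/(TH (- p ^ 2) 5 4) in EB. rewrite -/(TH p 40 24) -/(TH p 24 12) in EA.
  rewrite [TP p 4 3 * _]Cmult_comm -ER [TP (- p ^ 6) 4 3 * _]Cmult_comm -EB [TH p 24 12 * _]Cmult_comm -EA.
  rewrite [RHS]tsum_split_snd //. f_equal.
  - set F := (fun x : Z * Z => _ * p ^^ tri _) in SR *.
    have SF : summable (fun x => F (snd x, (2 * fst x)%Z)) by apply: summable_comp SR; injlia.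
    rewrite [RHS](tsum_bij _ (fun x : Z * Z => (snd x, fst x)) (fun x => (snd x, fst x))); cbn [fst snd]; try by case.
    2: by apply: (summable_comp F (fun x => (fst x, (2 * snd x)%Z))) SR; injlia.
    rewrite (tsum_split_diag (fun x => F (snd x, (2 * fst x)%Z))) //.
    (* Among the points with even second coordinate, halving that coordinate leaves two classes by
       the parity of the coordinate sum; the odd class cancels in pairs under l -> -1 - l, the even
       class is the product sought. *)
    rewrite [X in _ = _ + X](tsum_involution_0 _ (fun x : Z * Z => (fst x, (- 1 - snd x)%Z))).
    + rewrite Cplus_0_r. apply: tsum_ext => -[k l]. rewrite /F; mononorm. apply: (mono_eq l); trilia.
    + move=> [k l]; cbn [fst snd]. f_equal; lia.
    + move=> [k l]. rewrite /F; mononorm. apply: (mono_eq_opp l); trilia.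
    + apply: (summable_comp (fun x => F (snd x, (2 * fst x)%Z)) (fun x => ((fst x + snd x + 1)%Z, (fst x - snd x)%Z))) SF; injlia.
  - set F := (fun x : Z * Z => _ * p ^^ tri _) in SR *.
    rewrite -tsum_scal //.
    rewrite [RHS](tsum_bij _ (fun x : Z * Z => ((- fst x - 1 - snd x)%Z, snd x)) (fun x => ((- fst x - 1 - snd x)%Z, snd x))); cbn [fst snd];
      try by (move=> [a b]; cbn [fst snd]; f_equal; lia).
    2: by apply: (summable_comp F (fun x => (fst x, (2 * snd x + 1)%Z))) SR; injlia.
    apply: tsum_ext => -[k n]. rewrite /F; mononorm_p.
    apply: (mono_eq ((4 * k + 1 + 2 * n + 3 * tri k + n * n + n * k))); trilia.
Qed.

Lemma lattice_III2 :
  TP (- p ^ 6) 4 3 * TH (- p ^ 2) 5 3 + p * (TH p 24 12 * TH p 40 32) = TP p 4 3 * TH p 15 12.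
Proof.
  have S1 : summable _ := summable_quad_sgn p 15 12 np lp ltac:(lia).
  have [SR ER] := psi_times p (fun m => 1 - m)%Z _ np lp S1.
  have S2 : summable _ := summable_quad_sgn (- p ^ 2) 5 3 (opp_pow_nz 2) (opp_pow_lt 2 ltac:(lia)) ltac:(lia).
  have [SB EB] := psi_times (- p ^ 6) (fun k => k + 1)%Z _ (opp_pow_nz 6) (opp_pow_lt 6 ltac:(lia)) S2.
  have S3 : summable _ := summable_quad_sgn p 24 12 np lp ltac:(lia).
  have S4 : summable _ := summable_quad_sgn p 40 32 np lp ltac:(lia).
  have SA := summable_prod _ _ S4 S3. have EA := tsum_prod _ _ S4 S3.
  rewrite -/(TH p 15 12) in ER. rewrite -/(TH (- p ^ 2) 5 3) in EB. rewrite -/(TH p 40 32) -/(TH p 24 12) in EA.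
  rewrite [TP p 4 3 * _]Cmult_comm -ER [TP (- p ^ 6) 4 3 * _]Cmult_comm -EB [TH p 24 12 * _]Cmult_comm -EA.
  rewrite [RHS]tsum_split_snd //.
  set F := (fun x : Z * Z => _ * p ^^ tri _) in SR *. f_equal.
  - rewrite [RHS](tsum_bij _ (fun x : Z * Z => ((fst x + snd x)%Z, snd x)) (fun x => ((fst x - snd x)%Z, snd x)));
      cbn [fst snd]; try by (move=> [a b]; cbn [fst snd]; f_equal; lia).
    2: by apply: (summable_comp F (fun x => (fst x, (2 * snd x)%Z))) SR; injlia.
    apply: tsum_ext => -[k n]. rewrite /F; mononorm.
    apply: (mono_eq (3 * tri k + 2 * k + n * n + n * k)); trilia.
  - rewrite -tsum_scal //.
    have SF : summable (fun x => F (fst x, (2 * snd x + 1)%Z)).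
    { apply: (summable_comp F (fun x => (fst x, (2 * snd x + 1)%Z))) SR; injlia. }
    (* Here it is the class with even coordinate sum that cancels, again under l -> -1 - l. *)
    rewrite [RHS](tsum_split2 _ (fun x : Z * Z => ((fst x + snd x)%Z, (snd x - fst x - 1)%Z))
      (fun x : Z * Z => ((snd x - fst x)%Z, (fst x + snd x)%Z))) //; [|injlia|injlia|neqlia|]; last first.
    { move=> [a b]. have [k [h|h]] := Zparity (a + b); [right | left].
      - exists ((b - k)%Z, k); cbn [fst snd]; f_equal; lia.
      - exists ((a - k - 1)%Z, (k + 1)%Z); cbn [fst snd]; f_equal; lia. }
    rewrite [X in _ = _ + X](tsum_involution_0 _ (fun x : Z * Z => (fst x, (- 1 - snd x)%Z))).
    + rewrite Cplus_0_r. apply: tsum_ext => -[k l]. rewrite /F; mononorm_p. apply: (mono_eq 0); trilia.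
    + move=> [k l]; cbn [fst snd]. f_equal; lia.
    + move=> [k l]. rewrite /F; mononorm. apply: (mono_eq_opp (- l - 1)); trilia.
    + apply: (summable_comp _ (fun x => ((snd x - fst x)%Z, (fst x + snd x)%Z))) SF; injlia.
Qed.

Lemma lattice_IV :
  2 * p * (TH p 24 20 * TH p 40 24) + TP (- p ^ 2) 3 2 * TH (- p ^ 2) 5 4 =
  TP p 4 3 * (TH p 15 4 + p * TH p 15 14).
Proof.
  have S1 : summable _ := summable_quad_sgn p 15 4 np lp ltac:(lia).
  have S1' : summable _ := summable_quad_sgn p 15 14 np lp ltac:(lia).
  have [SA EA] := psi_times p (fun m => 3 * m + 1)%Z _ np lp S1.
  have [SB EB] := psi_times p (fun m => 3 * m + 1)%Z _ np lp S1'.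
  have S2 : summable _ := summable_quad_sgn (- p ^ 2) 5 4 (opp_pow_nz 2) (opp_pow_lt 2 ltac:(lia)) ltac:(lia).
  have S3 : summable _ := summable_quad (- p ^ 2) 3 2 (opp_pow_nz 2) (opp_pow_lt 2 ltac:(lia)) ltac:(lia).
  have SH := summable_prod _ _ S3 S2. have EH := tsum_prod _ _ S3 S2.
  have S4 : summable _ := summable_quad_sgn p 24 20 np lp ltac:(lia).
  have S5 : summable _ := summable_quad_sgn p 40 24 np lp ltac:(lia).
  have SG := summable_prod _ _ S4 S5. have EG := tsum_prod _ _ S4 S5.
  rewrite -/(TH p 15 4) in EA. rewrite -/(TH p 15 14) in EB. rewrite -/(TP (- p ^ 2) 3 2) -/(TH (- p ^ 2) 5 4) in EH.
  rewrite -/(TH p 24 20) -/(TH p 40 24) in EG.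
  transitivity (TH p 15 4 * TP p 4 3 + p * (TH p 15 14 * TP p 4 3)); last ring.
  rewrite -EA -EB -EH -EG. clear EA EB EH EG.
  set A := (fun x : Z * Z => _ * p ^^ tri _) in SA *.
  set B := (fun x : Z * Z => _ * p ^^ tri _) in SB *.
  set H := (fun x : Z * Z => (- p ^ 2) ^^ _ * _) in SH *.
  set G := (fun x : Z * Z => _) in SG *.
  have SA1 : summable (fun x => A (fst x, (2 * snd x + 1)%Z)).
  { apply: (summable_comp A (fun x => (fst x, (2 * snd x + 1)%Z))) SA; injlia. }
  have SB0 : summable (fun x => B (fst x, (2 * snd x)%Z)).
  { apply: (summable_comp B (fun x => (fst x, (2 * snd x)%Z))) SB; injlia. }
  have SB1 : summable (fun x => B (fst x, (2 * snd x + 1)%Z)).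
  { apply: (summable_comp B (fun x => (fst x, (2 * snd x + 1)%Z))) SB; injlia. }
  have SA10 : summable (fun x => A (fst x, (2 * (2 * snd x) + 1)%Z)).
  { apply: (summable_comp A (fun x => (fst x, (2 * (2 * snd x) + 1)%Z))) SA; injlia. }
  have SA11 : summable (fun x => A (fst x, (2 * (2 * snd x + 1) + 1)%Z)).
  { apply: (summable_comp A (fun x => (fst x, (2 * (2 * snd x + 1) + 1)%Z))) SA; injlia. }
  have SB00 : summable (fun x => B (fst x, (2 * (2 * snd x))%Z)).
  { apply: (summable_comp B (fun x => (fst x, (2 * (2 * snd x))%Z))) SB; injlia. }
  have SB01 : summable (fun x => B (fst x, (2 * (2 * snd x + 1))%Z)).
  { apply: (summable_comp B (fun x => (fst x, (2 * (2 * snd x + 1))%Z))) SB; injlia. }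
  (* By the second coordinate: the even part of A and p times the odd part of B rebuild H; the class
     3 mod 4 of A and p times the class 0 mod 4 of B are p G each, whence the factor 2; the class 1
     mod 4 of A cancels p times the class 2 mod 4 of B. *)
  rewrite (tsum_split_snd A) // (tsum_split_snd B) // (tsum_split_snd (fun x => A (fst x, (2 * snd x + 1)%Z))) //.
  rewrite (tsum_split_snd (fun x => B (fst x, (2 * snd x)%Z))) //. cbn [fst snd].
  have -> : tsum H = tsum (fun x => A (fst x, (2 * snd x)%Z)) + p * tsum (fun x => B (fst x, (2 * snd x + 1)%Z)).
  { rewrite (tsum_split2 H (fun x : Z * Z => ((- 2 * fst x - snd x)%Z, snd x))
      (fun x : Z * Z => ((2 * fst x + snd x + 1)%Z, snd x))) //; [|injlia|injlia|neqlia|]; last first.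
    { move=> [a b]. have [k [h|h]] := Zparity (a + b); [left | right].
      - exists ((- k)%Z, b); cbn [fst snd]; f_equal; lia.
      - exists ((k - b)%Z, b); cbn [fst snd]; f_equal; lia. }
    rewrite -tsum_scal //. f_equal; apply: tsum_ext => -[m k].
    - rewrite /H /A; mononorm. apply: (mono_eq (4 * tri k + 3 * k + 3 * m * m + 3 * m * k - m)); trilia.
    - rewrite /H /B; mononorm_p. apply: (mono_eq (4 * tri k + 3 * m * m + 3 * m * k + 5 * k + 3 * m + 1)); trilia. }
  have -> : tsum (fun x => A (fst x, (2 * (2 * snd x + 1) + 1)%Z)) = p * tsum G.
  { rewrite (tsum_bij _ (fun x : Z * Z => ((snd x - fst x)%Z, (- snd x - 1)%Z))
      (fun x => ((- fst x - snd x - 1)%Z, (- snd x - 1)%Z))) //; cbn [fst snd];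
      try by (move=> [a b]; cbn [fst snd]; f_equal; lia).
    rewrite -tsum_scal //. apply: tsum_ext => -[n k]. rewrite /A /G; mononorm_p. apply: (mono_eq (- n)); trilia. }
  have -> : tsum (fun x => B (fst x, (2 * (2 * snd x))%Z)) = tsum G.
  { rewrite (tsum_bij _ (fun x : Z * Z => ((fst x + snd x)%Z, (- snd x)%Z))
      (fun x => ((fst x + snd x)%Z, (- snd x)%Z))) //; cbn [fst snd];
      try by (move=> [a b]; cbn [fst snd]; f_equal; lia).
    apply: tsum_ext => -[n k]. rewrite /B /G; mononorm. apply: (mono_eq 0); trilia. }
  have -> : tsum (fun x => A (fst x, (2 * (2 * snd x) + 1)%Z)) =
    - p * tsum (fun x => B (fst x, (2 * (2 * snd x + 1))%Z)).
  { rewrite (tsum_bij _ (fun x : Z * Z => ((- fst x - 2 * snd x - 1)%Z, snd x))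
      (fun x => ((- fst x - 2 * snd x - 1)%Z, snd x))) //; cbn [fst snd];
      try by (move=> [a b]; cbn [fst snd]; f_equal; lia).
    rewrite -tsum_scal //. apply: tsum_ext => -[m i]; cbn [fst snd].
    transitivity (- (p * B (m, (2 * (2 * i + 1))%Z))); last ring.
    rewrite /A /B; mononorm_p. apply: (mono_eq_opp (- m - i - 1)); trilia. }
  ring.
Qed.

Lemma lattice_IV2 :
  TP (- p ^ 2) 3 2 * TH (- p ^ 2) 5 3 + 2 * p ^ 3 * (TH p 24 20 * TH p 40 32) =
  TP p 4 3 * (TH p 15 8 - p * TH p 15 13).
Proof.
  have S1 : summable _ := summable_quad_sgn p 15 8 np lp ltac:(lia).
  have S1' : summable _ := summable_quad_sgn p 15 13 np lp ltac:(lia).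
  have [SA EA] := psi_times p (fun m => 3 * m + 1)%Z _ np lp S1.
  have [SB EB] := psi_times p (fun m => 3 * m)%Z _ np lp S1'.
  have S2 : summable _ := summable_quad_sgn (- p ^ 2) 5 3 (opp_pow_nz 2) (opp_pow_lt 2 ltac:(lia)) ltac:(lia).
  have S3 : summable _ := summable_quad (- p ^ 2) 3 2 (opp_pow_nz 2) (opp_pow_lt 2 ltac:(lia)) ltac:(lia).
  have SH := summable_prod _ _ S3 S2. have EH := tsum_prod _ _ S3 S2.
  have S4 : summable _ := summable_quad_sgn p 24 20 np lp ltac:(lia).
  have S5 : summable _ := summable_quad_sgn p 40 32 np lp ltac:(lia).
  have SG := summable_prod _ _ S4 S5. have EG := tsum_prod _ _ S4 S5.
  rewrite -/(TH p 15 8) in EA. rewrite -/(TH p 15 13) in EB. rewrite -/(TP (- p ^ 2) 3 2) -/(TH (- p ^ 2) 5 3) in EH.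
  rewrite -/(TH p 24 20) -/(TH p 40 32) in EG.
  transitivity (TH p 15 8 * TP p 4 3 - p * (TH p 15 13 * TP p 4 3)); last ring.
  rewrite -EA -EB -EH -EG. clear EA EB EH EG.
  set A := (fun x : Z * Z => _ * p ^^ tri _) in SA *.
  set B := (fun x : Z * Z => _ * p ^^ tri _) in SB *.
  set H := (fun x : Z * Z => (- p ^ 2) ^^ _ * _) in SH *.
  set G := (fun x : Z * Z => _) in SG *.
  have SA1 : summable (fun x => A (fst x, (2 * snd x + 1)%Z)).
  { apply: (summable_comp A (fun x => (fst x, (2 * snd x + 1)%Z))) SA; injlia. }
  have SB0 : summable (fun x => B (fst x, (2 * snd x)%Z)).
  { apply: (summable_comp B (fun x => (fst x, (2 * snd x)%Z))) SB; injlia. }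
  have SB1 : summable (fun x => B (fst x, (2 * snd x + 1)%Z)).
  { apply: (summable_comp B (fun x => (fst x, (2 * snd x + 1)%Z))) SB; injlia. }
  have SA10 : summable (fun x => A (fst x, (2 * (2 * snd x) + 1)%Z)).
  { apply: (summable_comp A (fun x => (fst x, (2 * (2 * snd x) + 1)%Z))) SA; injlia. }
  have SA11 : summable (fun x => A (fst x, (2 * (2 * snd x + 1) + 1)%Z)).
  { apply: (summable_comp A (fun x => (fst x, (2 * (2 * snd x + 1) + 1)%Z))) SA; injlia. }
  have SB00 : summable (fun x => B (fst x, (2 * (2 * snd x))%Z)).
  { apply: (summable_comp B (fun x => (fst x, (2 * (2 * snd x))%Z))) SB; injlia. }
  have SB01 : summable (fun x => B (fst x, (2 * (2 * snd x + 1))%Z)).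
  { apply: (summable_comp B (fun x => (fst x, (2 * (2 * snd x + 1))%Z))) SB; injlia. }
  (* The classes play other parts than in [lattice_IV], since B is now subtracted: 1 mod 4 of A and
     minus p times 2 mod 4 of B are p^3 G each, while 3 mod 4 of A cancels against p times 0 mod 4
     of B. The remaining classes again rebuild H. *)
  rewrite (tsum_split_snd A) // (tsum_split_snd B) // (tsum_split_snd (fun x => A (fst x, (2 * snd x + 1)%Z))) //.
  rewrite (tsum_split_snd (fun x => B (fst x, (2 * snd x)%Z))) //. cbn [fst snd].
  have -> : tsum H = tsum (fun x => A (fst x, (2 * snd x)%Z)) - p * tsum (fun x => B (fst x, (2 * snd x + 1)%Z)).
  { rewrite (tsum_split2 H (fun x : Z * Z => ((2 * fst x + snd x)%Z, snd x))
      (fun x : Z * Z => ((- 2 * fst x - snd x - 1)%Z, snd x))) //; [|injlia|injlia|neqlia|]; last first.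
    { move=> [a b]. have [k [h|h]] := Zparity (a + b); [left | right].
      - exists ((k - b)%Z, b); cbn [fst snd]; f_equal; lia.
      - exists ((- k - 1)%Z, b); cbn [fst snd]; f_equal; lia. }
    transitivity (tsum (fun x => A (fst x, (2 * snd x)%Z)) + - p * tsum (fun x => B (fst x, (2 * snd x + 1)%Z)));
      last ring.
    rewrite -tsum_scal //. f_equal; apply: tsum_ext => -[m k]; cbn [fst snd].
    - rewrite /H /A; mononorm. apply: (mono_eq (4 * tri k + 3 * k + 3 * m * m + 3 * m * k)); trilia.
    - transitivity (- (p * B (m, (2 * k + 1)%Z))); last ring.
      rewrite /H /B; mononorm_p. apply: (mono_eq_opp (4 * tri k + 3 * m * m + 3 * m * k + 2 * m + 4 * k)); trilia. }
  have -> : tsum (fun x => A (fst x, (2 * (2 * snd x) + 1)%Z)) = p ^ 3 * tsum G.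
  { rewrite (tsum_bij _ (fun x : Z * Z => ((fst x - snd x)%Z, snd x))
      (fun x => ((fst x + snd x)%Z, snd x))) //; cbn [fst snd];
      try by (move=> [a b]; cbn [fst snd]; f_equal; lia).
    rewrite -tsum_scal //. apply: tsum_ext => -[n k]. rewrite -Cpowz_nat /A /G; mononorm.
    apply: (mono_eq (- k)); trilia. }
  have E1 : p * tsum (fun x => B (fst x, (2 * (2 * snd x + 1))%Z)) = - p ^ 3 * tsum G.
  { rewrite (tsum_bij _ (fun x : Z * Z => ((- fst x - snd x - 1)%Z, snd x))
      (fun x => ((- fst x - snd x - 1)%Z, snd x))) //; cbn [fst snd];
      try by (move=> [a b]; cbn [fst snd]; f_equal; lia).
    rewrite -!tsum_scal //.
    - apply: tsum_ext => -[n k]; cbn [fst snd]. transitivity (- (p ^ 3 * G (n, k))); last ring.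
      rewrite -Cpowz_nat /B /G; mononorm_p. apply: (mono_eq_opp (- n - k - 1)); trilia.
    - apply: (summable_comp _ (fun x : Z * Z => ((- fst x - snd x - 1)%Z, snd x))) SB01; injlia. }
  have -> : tsum (fun x => A (fst x, (2 * (2 * snd x + 1) + 1)%Z)) =
    p * tsum (fun x => B (fst x, (2 * (2 * snd x))%Z)).
  { rewrite [in RHS](tsum_bij _ (fun x : Z * Z => ((- fst x - 2 * snd x - 2)%Z, (snd x + 1)%Z))
      (fun x => ((- fst x - 2 * snd x)%Z, (snd x - 1)%Z))) //; cbn [fst snd];
      try by (move=> [a b]; cbn [fst snd]; f_equal; lia).
    rewrite -tsum_scal.
    - apply: tsum_ext => -[m i]. rewrite /A /B; mononorm_p. apply: (mono_eq (m + i + 1)); trilia.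
    - apply: (summable_comp (fun x => B (fst x, (2 * (2 * snd x))%Z)) (fun x : Z * Z => ((- fst x - 2 * snd x - 2)%Z, (snd x + 1)%Z))) SB00; injlia. }
  rewrite Cplus_comm. transitivity (tsum (fun x => A (fst x, (2 * snd x)%Z)) -
    p * tsum (fun x => B (fst x, (2 * snd x + 1)%Z)) + p ^ 3 * tsum G - - p ^ 3 * tsum G); first ring.
  rewrite -E1. ring.
Qed.

End Lattice.

(** * Product forms and dissections *)

Lemma jacobi_TH (x : Complex.C) (b c : nat) : x <> 0 -> (Cmod x < 1)%R -> (0 < b)%nat -> (0 < c)%nat ->
  TH x (Z.of_nat (b + c)) (Z.of_nat b) =
  qpoch_inf (x ^ b) (x ^ (b + c)) * qpoch_inf (x ^ c) (x ^ (b + c)) * qpoch_inf (x ^ (b + c)) (x ^ (b + c)).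
Proof.
  move=> nx lx hb hc.
  have l k : (0 < k)%nat -> (Cmod (x ^ k) < 1)%R.
  { move=> hk. rewrite -Cpowz_nat. apply: Cmod_Cpowz_lt1 => //; lia. }
  rewrite Cpow_add_r -(jacobi_triple (x ^ b) (x ^ c)); try exact: Cpow_nz; try exact: l.
  - apply: tsum_ext => n. rewrite -Cpow_add_r Cpowz_pow // (Cpowz_opp_base (x ^ b)); last exact: Cpow_nz.
    rewrite Cpowz_pow // Cpowz_add //. ring.
  - rewrite -Cpow_add_r. apply: l; lia.
Qed.

Lemma jacobi_TP (x : Complex.C) (b c : nat) : x <> 0 -> (Cmod x < 1)%R -> (0 < b)%nat -> (0 < c)%nat ->
  TP x (Z.of_nat (b + c)) (Z.of_nat b) =
  qpoch_inf (- x ^ b) (x ^ (b + c)) * qpoch_inf (- x ^ c) (x ^ (b + c)) * qpoch_inf (x ^ (b + c)) (x ^ (b + c)).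
Proof.
  move=> nx lx hb hc.
  have l k : (0 < k)%nat -> (Cmod (x ^ k) < 1)%R.
  { move=> hk. rewrite -Cpowz_nat. apply: Cmod_Cpowz_lt1 => //; lia. }
  have nn k : - x ^ k <> 0 by rewrite -Cpowz_nat; exact: Cpowz_m_nz.
  have E : x ^ (b + c) = (- x ^ b) * (- x ^ c) by rewrite Cpow_add_r; ring.
  rewrite E -(jacobi_triple (- x ^ b) (- x ^ c)) //.
  - apply: tsum_ext => n. rewrite -E Cpowz_pow //. replace (- - x ^ b) with (x ^ b) by ring.
    by rewrite Cpowz_pow // Cpowz_add.
  - rewrite Cmod_opp. exact: l.
  - rewrite -E. apply: l; lia.
Qed.

Section Products.
Context (p : Complex.C) (np : p <> 0) (lp : (Cmod p < 1)%R).

Definition QQ (a b : nat) : Complex.C := qpoch_inf (p ^ a) (p ^ b).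
Definition NN (a b : nat) : Complex.C := qpoch_inf (- p ^ a) (p ^ b).

Let l k : (0 < k)%nat -> (Cmod (p ^ k) < 1)%R.
Proof. move=> hk. rewrite -Cpowz_nat. apply: Cmod_Cpowz_lt1 => //; lia. Qed.

Let npk k : p ^ k <> 0.
Proof. exact: Cpow_nz. Qed.

Let nmk k : - p ^ k <> 0.
Proof. rewrite -Cpowz_nat; exact: Cpowz_m_nz. Qed.

Lemma QQ_split a b k : (0 < b)%nat -> (0 < k)%nat -> QQ a b = cprod (fun i => QQ (a + b * i) (b * k)) k.
Proof.
  move=> hb hk. rewrite /QQ (qpoch_inf_split _ _ k) //; last exact: l.
  apply: cprod_ext => i. by rewrite -!Cpow_mult_r -Cpow_add_r.
Qed.

Lemma NN_split a b k : (0 < b)%nat -> (0 < k)%nat -> NN a b = cprod (fun i => NN (a + b * i) (b * k)) k.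
Proof.
  move=> hb hk. rewrite /NN (qpoch_inf_split _ _ k) //; last exact: l.
  apply: cprod_ext => i. rewrite -!Cpow_mult_r Cpow_add_r. f_equal. ring.
Qed.

Lemma QQ_split2 a b : (0 < b)%nat -> QQ a b = QQ a (b * 2) * QQ (a + b) (b * 2).
Proof.
  move=> hb. rewrite (QQ_split a b 2) //= ?Nat.mul_0_r ?Nat.mul_1_r ?Nat.add_0_r; [ring | lia].
Qed.

Lemma NN_split2 a b : (0 < b)%nat -> NN a b = NN a (b * 2) * NN (a + b) (b * 2).
Proof.
  move=> hb. rewrite (NN_split a b 2) //= ?Nat.mul_0_r ?Nat.mul_1_r ?Nat.add_0_r; [ring | lia].
Qed.

Lemma QQ_split3 a b : (0 < b)%nat -> QQ a b = QQ a (b * 3) * QQ (a + b) (b * 3) * QQ (a + b * 2) (b * 3).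
Proof.
  move=> hb. rewrite (QQ_split a b 3) //= ?Nat.mul_0_r ?Nat.mul_1_r ?Nat.add_0_r; [ring | lia].
Qed.

Lemma NN_split3 a b : (0 < b)%nat -> NN a b = NN a (b * 3) * NN (a + b) (b * 3) * NN (a + b * 2) (b * 3).
Proof.
  move=> hb. rewrite (NN_split a b 3) //= ?Nat.mul_0_r ?Nat.mul_1_r ?Nat.add_0_r; [ring | lia].
Qed.

Lemma QQ_NN a b : (0 < b)%nat -> QQ a b * NN a b = QQ (a * 2) (b * 2).
Proof.
  move=> hb. rewrite /QQ /NN qpoch_inf_sqr //; last exact: l. by rewrite -!Cpow_mult_r.
Qed.

Lemma QQ_nz a b : (0 < a)%nat -> (0 < b)%nat -> QQ a b <> 0.
Proof. move=> ha hb. apply: qpoch_inf_nz => //; exact: l. Qed.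

Lemma NN_nz a b : (0 < a)%nat -> (0 < b)%nat -> NN a b <> 0.
Proof. move=> ha hb. apply: qpoch_inf_nz => //; rewrite ?Cmod_opp; exact: l. Qed.

(** Euler's theorem that partitions into distinct parts and into odd parts are equinumerous. *)
Lemma euler_odd a : (0 < a)%nat -> NN a a * QQ a (a * 2) = 1.
Proof.
  move=> ha. have h := QQ_NN a a ha. rewrite QQ_split2 // in h.
  have e : (a + a = a * 2)%nat by lia. rewrite e in h.
  have ha2 : (0 < a * 2)%nat by lia.
  apply: (Cmult_cancel_l _ _ _ (QQ_nz (a * 2) (a * 2) ha2 ha2)).
  transitivity (QQ a (a * 2) * QQ (a * 2) (a * 2) * NN a a); first ring. rewrite h. ring.
Qed.

Lemma TP_4_3 : TP p 4 3 = NN 1 2 * QQ 4 4.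
Proof.
  have := jacobi_TP p 3 1 np lp ltac:(lia) ltac:(lia).
  rewrite -/(NN 3 4) -/(NN 1 4) -/(QQ 4 4). move=> E.
  rewrite [TP p 4 3]E (NN_split2 1 2 ltac:(lia)) -[NN (1 + 2) _]/(NN 3 4) -[NN 1 (2 * 2)]/(NN 1 4). ring.
Qed.

(** [prod_a] to [prod_d] convert the components of the 3-dissections of [TP q 4 4] and [TP q 4 2]
    into the theta series of the lattice identities. The extra factors [QQ 4 8] and [NN 2 4] are
    those left by the products in the Slater sums. *)
Lemma prod_a : TP p 12 8 * QQ 4 8 = TH p 24 12.
Proof.
  have := jacobi_TP p 8 4 np lp ltac:(lia) ltac:(lia). rewrite -/(NN 8 12) -/(NN 4 12) -/(QQ 12 12) => E1.
  have := jacobi_TH p 12 12 np lp ltac:(lia) ltac:(lia). rewrite -/(QQ 12 24) -/(QQ 24 24) => E2.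
  rewrite [TP p 12 8]E1 [TH p 24 12]E2.
  have e1 := NN_split3 4 4 ltac:(lia). have e2 := euler_odd 4 ltac:(lia).
  have e3 := euler_odd 12 ltac:(lia). have e4 := QQ_split2 12 12 ltac:(lia).
  rewrite -[NN 4 (4 * 3)]/(NN 4 12) -[NN (4 + 4) _]/(NN 8 12) -[NN (4 + 4 * 2) _]/(NN 12 12) in e1.
  rewrite -[QQ 4 (4 * 2)]/(QQ 4 8) in e2. rewrite -[QQ 12 (12 * 2)]/(QQ 12 24) in e3.
  rewrite -[QQ 12 (12 * 2)]/(QQ 12 24) -[QQ (12 + 12) _]/(QQ 24 24) in e4.
  transitivity (NN 8 12 * NN 4 12 * QQ 12 12 * QQ 4 8 * (NN 12 12 * QQ 12 24)); first by rewrite e3; ring.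
  transitivity (QQ 12 12 * QQ 12 24 * (NN 4 4 * QQ 4 8)); first by rewrite e1; ring.
  rewrite e2 e4. ring.
Qed.

Lemma prod_b : TP p 48 36 * QQ 4 8 = TH p 24 20.
Proof.
  have := jacobi_TP p 36 12 np lp ltac:(lia) ltac:(lia). rewrite -/(NN 36 48) -/(NN 12 48) -/(QQ 48 48) => E1.
  have := jacobi_TH p 20 4 np lp ltac:(lia) ltac:(lia). rewrite -/(QQ 20 24) -/(QQ 4 24) -/(QQ 24 24) => E2.
  rewrite [TP p 48 36]E1 [TH p 24 20]E2.
  have e1 := NN_split2 12 24 ltac:(lia). have e2 := QQ_split3 4 8 ltac:(lia).
  have e3 := QQ_NN 12 24 ltac:(lia). have e4 := QQ_split2 24 24 ltac:(lia).
  rewrite -[NN 12 (24 * 2)]/(NN 12 48) -[NN (12 + 24) _]/(NN 36 48) in e1.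
  rewrite -[QQ 4 (8 * 3)]/(QQ 4 24) -[QQ (4 + 8) _]/(QQ 12 24) -[QQ (4 + 8 * 2) _]/(QQ 20 24) in e2.
  rewrite -[QQ (12 * 2) _]/(QQ 24 48) in e3.
  rewrite -[QQ 24 (24 * 2)]/(QQ 24 48) -[QQ (24 + 24) _]/(QQ 48 48) in e4.
  rewrite e2. transitivity (QQ 20 24 * QQ 4 24 * QQ 48 48 * (QQ 12 24 * NN 12 24)); first by rewrite e1; ring.
  rewrite e3 e4. ring.
Qed.

Lemma prod_c : TP p 12 10 = TP (- p ^ 6) 4 3 * NN 2 4.
Proof.
  have := jacobi_TP p 10 2 np lp ltac:(lia) ltac:(lia). rewrite -/(NN 10 12) -/(NN 2 12) -/(QQ 12 12) => E1.
  have E2 : TP (- p ^ 6) 4 3 = TH p 24 18.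
  { apply: tsum_ext => n. rewrite Cpowz_opp_base // Cpowz_pow //.
    (* The exponent has the parity of n, so the unsigned series in -p^6 is a signed series in
       p^6. *)
    have -> : (- (1)) ^^ (4 * tri n + 3 * n) = (- (1)) ^^ n.
    { have -> : (4 * tri n + 3 * n = 2 * (2 * tri n + n) + n)%Z by ring.
      rewrite Cpowz_add; last exact: Cm1_nz. rewrite sgn_even; ring. }
    do 2 f_equal. lia. }
  have := jacobi_TH p 18 6 np lp ltac:(lia) ltac:(lia). rewrite -/(QQ 18 24) -/(QQ 6 24) -/(QQ 24 24) => E3.
  rewrite E2 [TP p 12 10]E1 [TH p 24 18]E3.
  have e1 := NN_split3 2 4 ltac:(lia). have e2 := QQ_split2 6 12 ltac:(lia).
  have e3 := QQ_NN 6 12 ltac:(lia). have e4 := QQ_split2 12 12 ltac:(lia).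
  rewrite -[NN 2 (4 * 3)]/(NN 2 12) -[NN (2 + 4) _]/(NN 6 12) -[NN (2 + 4 * 2) _]/(NN 10 12) in e1.
  rewrite -[QQ 6 (12 * 2)]/(QQ 6 24) -[QQ (6 + 12) _]/(QQ 18 24) in e2.
  rewrite -[QQ (6 * 2) _]/(QQ 12 24) in e3.
  rewrite -[QQ 12 (12 * 2)]/(QQ 12 24) -[QQ (12 + 12) _]/(QQ 24 24) in e4.
  rewrite e1 e4 -e3 e2. ring.
Qed.

Lemma prod_d : TP p 12 6 = TP (- p ^ 2) 3 2 * NN 2 4.
Proof.
  have := jacobi_TP p 6 6 np lp ltac:(lia) ltac:(lia). rewrite -/(NN 6 12) -/(QQ 12 12) => E1.
  have n2 := nmk 2. have l2 : (Cmod (- p ^ 2) < 1)%R by rewrite Cmod_opp; apply: l; lia.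
  have E2 : TP (- p ^ 2) 3 2 = QQ 2 12 * NN 8 12 * (NN 4 12 * QQ 10 12) * (NN 6 12 * QQ 12 12).
  { have uv : - p ^ 4 * p ^ 2 = - p ^ 6 by ring.
    have n6 := nmk 6. have l6 : (Cmod (- p ^ 6) < 1)%R by rewrite Cmod_opp; apply: l; lia.
    have := jacobi_triple (- p ^ 4) (p ^ 2) (nmk 4) (npk 2) (l 2 ltac:(lia)). rewrite uv => /(_ l6) E.
    transitivity (tsum (fun n => (- p ^ 6) ^^ tri n * (- - p ^ 4) ^^ n)).
    - apply: tsum_ext => n. replace (- - p ^ 4) with (p ^ 4) by ring.
      rewrite (Cpowz_opp_base (p ^ 2)) // (Cpowz_opp_base (p ^ 6)) // !Cpowz_pow //.
      have -> : (- (1)) ^^ (3 * tri n + 2 * n) = (- (1)) ^^ tri n.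
      { have -> : (3 * tri n + 2 * n = 2 * (tri n + n) + tri n)%Z by ring.
        rewrite Cpowz_add; last exact: Cm1_nz. rewrite sgn_even; ring. }
      rewrite -Cmult_assoc -Cpowz_add //. do 2 f_equal. lia.
    (* The triple product in base -p^6 is split into even and odd factors, which returns everything
       to the base p^12. *)
    - have sp (a : Complex.C) : a <> 0 -> qpoch_inf a (- p ^ 6) = qpoch_inf a (p ^ 12) * qpoch_inf (- a * p ^ 6) (p ^ 12).
      { move=> na. rewrite (qpoch_inf_split a (- p ^ 6) 2) //=; last lia.
        replace (- (p * (p * (p * (p * (p * (p * 1)))))) * (- (p * (p * (p * (p * (p * (p * 1)))))) * 1)) with (p ^ 12) by (simpl; ring).
        rewrite Cmult_1_l. f_equal; f_equal; simpl; ring. }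
      rewrite E !sp // /QQ /NN.
      replace (- - p ^ 4 * p ^ 6) with (p ^ 10) by ring. replace (- p ^ 2 * p ^ 6) with (- p ^ 8) by ring.
      replace (- - p ^ 6 * p ^ 6) with (p ^ 12) by ring. ring. }
  rewrite [TP p 12 6]E1 E2.
  have e1 := NN_split3 2 4 ltac:(lia). have e2 := NN_split3 4 4 ltac:(lia).
  have e3 := QQ_NN 2 12 ltac:(lia). have e4 := QQ_NN 10 12 ltac:(lia).
  have e5 := QQ_split3 4 8 ltac:(lia). have e6 := euler_odd 4 ltac:(lia). have e7 := euler_odd 12 ltac:(lia).
  rewrite -[NN 2 (4 * 3)]/(NN 2 12) -[NN (2 + 4) _]/(NN 6 12) -[NN (2 + 4 * 2) _]/(NN 10 12) in e1.
  rewrite -[NN 4 (4 * 3)]/(NN 4 12) -[NN (4 + 4) _]/(NN 8 12) -[NN (4 + 4 * 2) _]/(NN 12 12) in e2.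
  rewrite -[QQ (2 * 2) _]/(QQ 4 24) in e3. rewrite -[QQ (10 * 2) _]/(QQ 20 24) in e4.
  rewrite -[QQ 4 (8 * 3)]/(QQ 4 24) -[QQ (4 + 8) _]/(QQ 12 24) -[QQ (4 + 8 * 2) _]/(QQ 20 24) in e5.
  rewrite -[QQ 4 (4 * 2)]/(QQ 4 8) in e6. rewrite -[QQ 12 (12 * 2)]/(QQ 12 24) in e7.
  have key : NN 4 12 * NN 8 12 * (QQ 2 12 * NN 2 12) * (QQ 10 12 * NN 10 12) = 1.
  { rewrite e3 e4. transitivity (NN 4 12 * NN 8 12 * QQ 4 24 * QQ 20 24 * (NN 12 12 * QQ 12 24)); first by rewrite e7; ring.
    rewrite -e6 e2 e5. ring. }
  rewrite e1. transitivity (NN 6 12 * NN 6 12 * QQ 12 12 *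
    (NN 4 12 * NN 8 12 * (QQ 2 12 * NN 2 12) * (QQ 10 12 * NN 10 12))); last ring.
  rewrite key. ring.
Qed.

End Products.

Lemma tsum_split3 (f : Z -> Complex.C) : summable f ->
  tsum f = tsum (fun m => f (3 * m)%Z) + tsum (fun m => f (3 * m + 1)%Z) + tsum (fun m => f (3 * m + 2)%Z).
Proof.
  move=> Sf. pose e1 (k : Z + Z) := match k with inl m => 3 * m + 1 | inr m => 3 * m + 2 end%Z.
  have i0 : injective_map (fun m => 3 * m)%Z by move=> x y; lia.
  have i1 : injective_map e1 by case=> x [y|y]; rewrite /e1 => h; first [exfalso; lia | f_equal; lia].
  have S1 : summable (fun k => f (e1 k)) by exact: summable_comp.
  rewrite (tsum_split2 f (fun m => 3 * m)%Z e1) //.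
  - rewrite (tsum_split2 (fun k => f (e1 k)) inl inr) //=; first ring.
    + by move=> x y [].
    + by move=> x y [].
    + case=> m; [left | right]; by exists m.
  - move=> j [k|k]; rewrite /e1; lia.
  - move=> i. have h := Z.div_mod i 3. have h' := Z.mod_pos_bound i 3.
    have [E|[E|E]] : (i mod 3 = 0 \/ i mod 3 = 1 \/ i mod 3 = 2)%Z by lia.
    + left; exists (i / 3)%Z; lia.
    + right; exists (inl (i / 3)%Z); rewrite /e1; lia.
    + right; exists (inr (i / 3)%Z); rewrite /e1; lia.
Qed.

Section Dissections.
Context (q : Complex.C) (nq : q <> 0) (lq : (Cmod q < 1)%R).
Let p := q ^ 3.
Let np : p <> 0 := Cpow_nz q 3 nq.
Let lp : (Cmod p < 1)%R.
Proof. rewrite /p -Cpowz_nat. apply: Cmod_Cpowz_lt1 => //; lia. Qed.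
Let pq n : p ^^ n = q ^^ (3 * n).
Proof. exact: Cpowz_pow. Qed.

(** The exponent 2 r (r + 1) is invariant under r -> -1 - r, which swaps the classes 0 and 2 modulo
    3 and maps the class 1 to itself. Within class 1 the same symmetry identifies the even and the
    odd half; this gives both factors 2. *)
Lemma dissect_E : TP q 4 4 = 2 * TP p 12 8 + 2 * q * p * TP p 48 36.
Proof.
  rewrite /TP (tsum_split3 (fun r => q ^^ (4 * tri r + 4 * r))); last exact: summable_quad.
  have -> : tsum (fun m => q ^^ (4 * tri (3 * m) + 4 * (3 * m))) = tsum (fun r => p ^^ (12 * tri r + 8 * r)).
  { apply: tsum_ext => m. rewrite pq. f_equal. trilia. }
  have -> : tsum (fun m => q ^^ (4 * tri (3 * m + 2) + 4 * (3 * m + 2))) = tsum (fun r => p ^^ (12 * tri r + 8 * r)).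
  { rewrite [RHS](tsum_reflect _ (-1)); last exact: summable_quad.
    apply: tsum_ext => m. rewrite pq. f_equal. trilia. }
  have S1 : summable (fun m => p ^^ (12 * tri m + 12 * m)) by exact: summable_quad.
  have -> : tsum (fun m => q ^^ (4 * tri (3 * m + 1) + 4 * (3 * m + 1))) =
    q * p * tsum (fun m => p ^^ (12 * tri m + 12 * m)).
  { rewrite -tsum_scal //. apply: tsum_ext => m. transitivity (q ^^ 1 * p ^^ 1 * p ^^ (12 * tri m + 12 * m)); last by rewrite !Cpowz_1.
    rewrite !pq -!Cpowz_add //. f_equal. trilia. }
  have -> : tsum (fun m => p ^^ (12 * tri m + 12 * m)) = 2 * tsum (fun r => p ^^ (48 * tri r + 36 * r)).
  { rewrite (tsum_split2 _ (fun j => 2 * j)%Z (fun j => 2 * j + 1)%Z) //.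
    - transitivity (tsum (fun r => p ^^ (48 * tri r + 36 * r)) + tsum (fun r => p ^^ (48 * tri r + 36 * r))); last ring.
      f_equal; last (rewrite [RHS](tsum_reflect _ (-1)); last exact: summable_quad);
        apply: tsum_ext => m; f_equal; trilia.
    - move=> x y; lia.
    - move=> x y; lia.
    - move=> x y; lia.
    - move=> i. have [k [->|->]] := Zparity i; [left | right]; by exists k. }
  ring.
Qed.

(** The exponent is 2 r^2, so r -> -r identifies the classes 1 and 2 modulo 3. *)
Lemma dissect_T : TP q 4 2 = TP p 12 6 + 2 * q ^ 2 * TP p 12 10.
Proof.
  rewrite /TP (tsum_split3 (fun r => q ^^ (4 * tri r + 2 * r))); last exact: summable_quad.
  have S1 : summable (fun m => p ^^ (12 * tri m + 10 * m)) by exact: summable_quad.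
  have -> : tsum (fun m => q ^^ (4 * tri (3 * m) + 2 * (3 * m))) = tsum (fun r => p ^^ (12 * tri r + 6 * r)).
  { apply: tsum_ext => m. rewrite pq. f_equal. trilia. }
  have -> : tsum (fun m => q ^^ (4 * tri (3 * m + 1) + 2 * (3 * m + 1))) =
    q ^ 2 * tsum (fun r => p ^^ (12 * tri r + 10 * r)).
  { rewrite -tsum_scal //. apply: tsum_ext => m. rewrite -Cpowz_nat pq -!Cpowz_add //. f_equal. trilia. }
  have -> : tsum (fun m => q ^^ (4 * tri (3 * m + 2) + 2 * (3 * m + 2))) =
    q ^ 2 * tsum (fun r => p ^^ (12 * tri r + 10 * r)).
  { rewrite -tsum_scal // [RHS](tsum_reflect _ (-1)); last exact: summable_scal.
    apply: tsum_ext => m. rewrite -Cpowz_nat pq -!Cpowz_add //. f_equal. trilia. }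
  ring.
Qed.

Let sgn3 m c : (- (1)) ^^ (3 * m + c) = (- (1)) ^^ (m + c).
Proof.
  have -> : (3 * m + c = 2 * m + (m + c))%Z by ring.
  rewrite Cpowz_add; last exact: Cm1_nz. rewrite sgn_even; ring.
Qed.

Lemma dissect_theta1 : TH q 5 4 = TH p 15 9 - q * (TH p 15 4 + p * TH p 15 14).
Proof.
  have ns := Cm1_nz.
  rewrite /TH (tsum_split3 (fun r => _ * q ^^ (5 * tri r + 4 * r))); last exact: summable_quad_sgn.
  have S1 : summable (fun m => (- (1)) ^^ m * p ^^ (15 * tri m + 4 * m)) by exact: summable_quad_sgn.
  have S2 : summable (fun m => (- (1)) ^^ m * p ^^ (15 * tri m + 14 * m)) by exact: summable_quad_sgn.
  have -> : tsum (fun m => (- (1)) ^^ (3 * m) * q ^^ (5 * tri (3 * m) + 4 * (3 * m))) =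
    tsum (fun r => (- (1)) ^^ r * p ^^ (15 * tri r + 9 * r)).
  { apply: tsum_ext => m. have := sgn3 m 0. rewrite !Z.add_0_r => ->. rewrite pq. do 2 f_equal. trilia. }
  have -> : tsum (fun m => (- (1)) ^^ (3 * m + 1) * q ^^ (5 * tri (3 * m + 1) + 4 * (3 * m + 1))) =
    - (q * p) * tsum (fun r => (- (1)) ^^ r * p ^^ (15 * tri r + 14 * r)).
  { rewrite -tsum_scal //. apply: tsum_ext => m. rewrite sgn3 Cpowz_succ // !pq.
    transitivity (- (q ^^ 1 * p ^^ 1) * ((- (1)) ^^ m * q ^^ (3 * (15 * tri m + 14 * m)))); last by rewrite !Cpowz_1.
    transitivity (- (- (1)) ^^ m * (q ^^ 1 * p ^^ 1 * q ^^ (3 * (15 * tri m + 14 * m)))); last ring.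
    rewrite pq -!Cpowz_add //.
    have -> : (5 * tri (3 * m + 1) + 4 * (3 * m + 1) = 1 + 3 * 1 + 3 * (15 * tri m + 14 * m))%Z by trilia. ring. }
  have -> : tsum (fun m => (- (1)) ^^ (3 * m + 2) * q ^^ (5 * tri (3 * m + 2) + 4 * (3 * m + 2))) =
    - q * tsum (fun r => (- (1)) ^^ r * p ^^ (15 * tri r + 4 * r)).
  { rewrite -tsum_scal // [RHS](tsum_shift _ 1); last exact: summable_scal. apply: tsum_ext => m.
    have -> : (- (1)) ^^ (3 * m + 2) = (- (1)) ^^ m.
    { rewrite sgn3 Cpowz_add // (sgn_even 1). ring. }
    rewrite !pq Cpowz_succ //.
    transitivity ((- (1)) ^^ m * (q ^^ 1 * q ^^ (3 * (15 * tri (m + 1) + 4 * (m + 1))))); last by rewrite !Cpowz_1; ring.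
    rewrite -!Cpowz_add //. do 2 f_equal. trilia. }
  ring.
Qed.

Lemma dissect_theta2 : TH q 5 3 = TH p 15 8 - p * TH p 15 13 - q ^ 2 * TH p 15 12.
Proof.
  have ns := Cm1_nz.
  rewrite /TH (tsum_split3 (fun r => _ * q ^^ (5 * tri r + 3 * r))); last exact: summable_quad_sgn.
  have S1 : summable (fun m => (- (1)) ^^ m * p ^^ (15 * tri m + 13 * m)) by exact: summable_quad_sgn.
  have S2 : summable (fun m => (- (1)) ^^ m * p ^^ (15 * tri m + 12 * m)) by exact: summable_quad_sgn.
  have -> : tsum (fun m => (- (1)) ^^ (3 * m) * q ^^ (5 * tri (3 * m) + 3 * (3 * m))) =
    tsum (fun r => (- (1)) ^^ r * p ^^ (15 * tri r + 8 * r)).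
  { apply: tsum_ext => m. have := sgn3 m 0. rewrite !Z.add_0_r => ->. rewrite pq. do 2 f_equal. trilia. }
  have -> : tsum (fun m => (- (1)) ^^ (3 * m + 1) * q ^^ (5 * tri (3 * m + 1) + 3 * (3 * m + 1))) =
    - p * tsum (fun r => (- (1)) ^^ r * p ^^ (15 * tri r + 13 * r)).
  { rewrite -tsum_scal //. apply: tsum_ext => m. rewrite sgn3 Cpowz_succ //.
    transitivity (- (- (1)) ^^ m * (p ^^ 1 * p ^^ (15 * tri m + 13 * m))); last by rewrite !Cpowz_1; ring.
    rewrite !pq -!Cpowz_add //.
    have -> : (5 * tri (3 * m + 1) + 3 * (3 * m + 1) = 3 * 1 + 3 * (15 * tri m + 13 * m))%Z by trilia. ring. }
  have -> : tsum (fun m => (- (1)) ^^ (3 * m + 2) * q ^^ (5 * tri (3 * m + 2) + 3 * (3 * m + 2))) =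
    - q ^ 2 * tsum (fun r => (- (1)) ^^ r * p ^^ (15 * tri r + 12 * r)).
  { rewrite -tsum_scal // [RHS](tsum_reflect _ (-1)); last exact: summable_scal. apply: tsum_ext => m.
    have -> : (- (1)) ^^ (3 * m + 2) = (- (1)) ^^ m.
    { rewrite sgn3 Cpowz_add // (sgn_even 1). ring. }
    rewrite (sgn_sub_odd 0 m) -Cpowz_nat !pq.
    transitivity ((- (1)) ^^ m * (q ^^ Z.of_nat 2 * q ^^ (3 * (15 * tri (-1 - m) + 12 * (-1 - m))))); last by ring.
    rewrite -!Cpowz_add //. do 2 f_equal. trilia. }
  ring.
Qed.

End Dissections.

(** * The double sums *)

Section DoubleSums.
Context (q : Complex.C) (nq : q <> 0) (lq : (Cmod q < 1)%R) (a : Z) (ha : (0 <= a <= 2)%Z).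
Let p := q ^ 3.
Let s := p ^ 2.
Let np : p <> 0 := Cpow_nz q 3 nq.
Let lp : (Cmod p < 1)%R.
Proof. rewrite /p -Cpowz_nat. apply: Cmod_Cpowz_lt1 => //; lia. Qed.
Let pq n : p ^^ n = q ^^ (3 * n).
Proof. exact: Cpowz_pow. Qed.

Definition nahm_exp (i j : Z) : Z := (tri (i - j) + a * (i - j) + 3 * tri (j + 1))%Z.

(** Pairs are stored as (j, i), so that [tsum_split_snd] splits by the parity of i. *)
Definition nahm_term (x : Z * Z) : Complex.C :=
  q ^^ nahm_exp (snd x) (fst x) * (ip p (snd x) * ip p (fst x)).

(** Completing squares gives 2 |k - J| - 10 and 3 |J| - 4 for the two parts, and |k| <= |k - J| +
    |J| combines them. The coefficient 2 of |k| matters: one |k| pays for the index m, which lies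
    between 0 and k in [summable_triple]. *)
Lemma nahm_exp_ge k J : (2 * Z.abs k + Z.abs J - 14 <= nahm_exp k J)%Z.
Proof.
  rewrite /nahm_exp.
  have h1 : (2 * Z.abs (k - J) - 10 <= tri (k - J) + a * (k - J))%Z.
  { have := tri2 (k - J). set d := (k - J)%Z. clearbody d. set t := tri d. clearbody t => E.
    have r1 := Z.square_nonneg (2 * d + 3 + 2 * a). have r2 := Z.square_nonneg (2 * d - 5 + 2 * a).
    have [h|h] : (d <= 0 \/ 0 < d)%Z by lia.
    - have -> : Z.abs d = (- d)%Z by lia. nia.
    - have -> : Z.abs d = d by lia. nia. }
  have h2 : (3 * Z.abs J - 4 <= 3 * tri (J + 1))%Z.
  { have := tri2 (J + 1). set t := tri (J + 1). clearbody t => E.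
    have r1 := Z.square_nonneg (2 * J + 3). have r2 := Z.square_nonneg (2 * J - 1).
    have [h|h] : (J <= 0 \/ 0 < J)%Z by lia.
    - have -> : Z.abs J = (- J)%Z by lia. nia.
    - have -> : Z.abs J = J by lia. nia. }
  lia.
Qed.

(** The summand after Euler's expansion, in the coordinates ((J, k), m) with J = j + m and k = i +
    m; [unshear] passes from ((j, i), m) to them. *)
Let triple (y : (Z * Z) * Z) : Complex.C :=
  q ^^ nahm_exp (snd (fst y)) (fst (fst y)) *
    ((- (1)) ^^ snd y * (ip p (snd (fst y) - snd y) * ip p (snd y))).

Lemma summable_triple : summable triple.
Proof.
  have hq : (0 <= Cmod q < 1)%R by split=> //; exact: Cmod_ge_0.
  have [K [pK HK]] := ip_bound p lp.
  have S3 := summable_prod _ _ (summable_geo2 _ hq) (summable_geo _ hq).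
  have n14 := Cpowz_nz q 14 nq.
  have p14 : (0 < Cmod (q ^^ 14))%R by apply Cmod_gt_0.
  apply: summable_le (summable_scal (RtoC (K * K) * / q ^^ 14) _ S3).
  move=> [[J k] m]; rewrite /triple; cbn [fst snd].
  have [h|h] : (k - m < 0 \/ m < 0 \/ 0 <= m <= k)%Z by lia.
  { rewrite (ip_prod_0 p (k - m)); last by left. rewrite !Cmult_0_r Cmod_0. exact: Cmod_ge_0. }
  case: h => h.
  { rewrite (ip_prod_0 p (k - m)); last by right. rewrite !Cmult_0_r Cmod_0. exact: Cmod_ge_0. }
  have hE := nahm_exp_ge k J.
  rewrite !Cmod_mult Cmod_sgn Cmod_inv // Cmod_R Rabs_pos_eq; last by apply: Rmult_le_pos; lra.
  rewrite !Cmod_geo; try lra. rewrite -!pow_add.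
  have e1 : (Cmod (q ^^ nahm_exp k J) * Cmod (q ^^ 14) <= Cmod q ^ (Z.abs_nat J + Z.abs_nat k + Z.abs_nat m))%R.
  { rewrite -Cmod_mult -Cpowz_add // Cmod_Cpowz //; last lia. apply: pow_le_anti; first lra. lia. }
  have e2 : (Cmod (q ^^ nahm_exp k J) <= / Cmod (q ^^ 14) * Cmod q ^ (Z.abs_nat J + Z.abs_nat k + Z.abs_nat m))%R.
  { apply: (Rmult_le_reg_l (Cmod (q ^^ 14))) => //. rewrite -Rmult_assoc Rinv_r ?Rmult_1_l; lra. }
  have e3 : (1 * (Cmod (ip p (k - m)) * Cmod (ip p m)) <= K * K)%R.
  { rewrite Rmult_1_l. by apply: Rmult_le_compat; try exact: Cmod_ge_0. }
  rewrite Rmult_comm [X in (_ <= X)%R]Rmult_assoc.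
  apply: Rmult_le_compat => //; last exact: Cmod_ge_0.
  rewrite Rmult_1_l. by apply: Rmult_le_pos; exact: Cmod_ge_0.
Qed.

Let unshear (y : (Z * Z) * Z) : (Z * Z) * Z :=
  (((fst (fst y) + snd y)%Z, (snd (fst y) + snd y)%Z), snd y).
Let shear (y : (Z * Z) * Z) : (Z * Z) * Z :=
  (((fst (fst y) - snd y)%Z, (snd (fst y) - snd y)%Z), snd y).

Let shearK y : shear (unshear y) = y.
Proof. case: y => [[j i] m]. rewrite /shear /unshear; cbn [fst snd]. do 2 f_equal; lia. Qed.
Let unshearK y : unshear (shear y) = y.
Proof. case: y => [[j i] m]. rewrite /shear /unshear; cbn [fst snd]. do 2 f_equal; lia. Qed.

Let unshear_inj : injective_map unshear.
Proof. move=> x y E. by rewrite -(shearK x) E shearK. Qed.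

(** The powers p^(tri m + (j+1) m) of Euler's series complete 3 tri (j + 1) to 3 tri (j + m + 1),
    and i - j is unchanged, so [nahm_exp] reappears at the shifted indices. *)
Let triple_row (x : Z * Z) : tsum (fun m => triple (unshear (x, m))) = qpoch_inf p p * nahm_term x.
Proof.
  case: x => j i. rewrite /nahm_term; cbn [fst snd].
  transitivity (q ^^ nahm_exp i j * ip p i * tsum (euler_term p (- p ^^ (j + 1)))); last first.
  { rewrite euler_ip //. ring. }
  rewrite -tsum_scal; last by apply: summable_euler => //; exact: Cpowz_m_nz.
  apply: tsum_ext => m. rewrite /triple /unshear /euler_term; cbn [fst snd].
  have -> : (i + m - m = i)%Z by ring.
  rewrite (Cpowz_opp_base (p ^^ (j + 1))); last exact: Cpowz_nz. rewrite Cpowz_mul // !pq.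
  have -> : nahm_exp (i + m) (j + m) = (nahm_exp i j + 3 * tri m + 3 * ((j + 1) * m))%Z.
  { rewrite /nahm_exp. have -> : (i + m - (j + m) = i - j)%Z by ring.
    have -> : (j + m + 1 = (j + 1) + m)%Z by ring. trilia. }
  rewrite !Cpowz_add //. ring.
Qed.

Lemma summable_nahm : summable nahm_term.
Proof.
  have S := summable_rows _ (summable_comp triple unshear unshear_inj summable_triple).
  have nz := qpoch_inf_nz p p np np lp lp.
  apply: summable_ext (summable_scal (/ qpoch_inf p p) _ S) => x.
  rewrite triple_row. field. exact: nz.
Qed.

(* Expanding [1/(p;p)_j] by Euler and shifting [i], [j] by the new index makes the inner sum the
   Gauss sum [sum_m (-1)^m / ((p)_{k-m} (p)_m)], which is [1/(p^2;p^2)_{k/2}] or [0]. *)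
Lemma nahm_sum_gauss : qpoch_inf p p * tsum nahm_term =
  tsum (fun x : Z * Z => q ^^ nahm_exp (2 * snd x) (fst x) * ip s (snd x)) /\
  summable (fun x : Z * Z => q ^^ nahm_exp (2 * snd x) (fst x) * ip s (snd x)).
Proof.
  have S := summable_triple. have Srow := summable_rows _ S.
  have E x : tsum (fun m => triple (x, m)) = q ^^ nahm_exp (snd x) (fst x) * gauss_sum p (snd x).
  { rewrite /triple /gauss_sum -tsum_scal //. exact: summable_gauss. }
  pose G (x : Z * Z) := q ^^ nahm_exp (snd x) (fst x) * gauss_sum p (snd x).
  have SG : summable G by apply: summable_ext Srow => x; rewrite E.
  have e x : G (fst x, (2 * snd x)%Z) = q ^^ nahm_exp (2 * snd x) (fst x) * ip s (snd x).
  { by rewrite /G /s -gauss_sum_even. }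
  split; last first.
  { apply: (summable_ext _ (fun x => G (fst x, (2 * snd x)%Z))); first by move=> x; rewrite e.
    apply: (summable_comp G (fun x => (fst x, (2 * snd x)%Z))) SG; injlia. }
  rewrite -tsum_scal; last exact: summable_nahm.
  transitivity (tsum triple).
  - rewrite (tsum_bij triple unshear shear shearK unshearK S) [RHS]tsum_fubini; last exact: (summable_comp triple unshear unshear_inj S).
    apply: tsum_ext => x. by rewrite triple_row.
  - rewrite tsum_fubini // (tsum_ext _ _ E) -/G tsum_split_snd //.
    rewrite [X in _ + X]tsum_zero.
    + rewrite Cplus_0_r. exact: tsum_ext.
    + move=> x. rewrite /G gauss_sum_odd //. ring.
Qed.

End DoubleSums.

(** * Separation of variables and evaluation of the double sums *)

Section Nahm.
Context (q : Complex.C) (nq : q <> 0) (lq : (Cmod q < 1)%R).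
Let p := q ^ 3.
Let s := p ^ 2.
Let np : p <> 0 := Cpow_nz q 3 nq.
Let lp : (Cmod p < 1)%R.
Proof. rewrite /p -Cpowz_nat. apply: Cmod_Cpowz_lt1 => //; lia. Qed.
Let ns : s <> 0 := Cpow_nz p 2 np.
Let ls : (Cmod s < 1)%R := Cmod_sqr_lt p lp.
Let sq n : s ^^ n = q ^^ (6 * n).
Proof. rewrite /s Cpowz_pow // /p Cpowz_pow //. f_equal. lia. Qed.

Let summable_ip_quad (c d : Z) (f : Z -> Z) : (0 < c)%Z ->
  summable (fun n => s ^^ (c * tri n + d * n) * ip s (f n)).
Proof.
  move=> hc. have [K [pK HK]] := ip_bound s ls.
  apply: (summable_mul_bounded _ _ K) => //. exact: summable_quad.
Qed.

(** After [nahm_sum_gauss] the first index is 2 k. For k = 2 n and k = 2 n + 1 it is 4 n or 4 n + 2,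
    and the shift of J by n removes the mixed term, leaving a theta series in q times a series in s
    = q^6. *)
Lemma nahm_sum1 : qpoch_inf p p * tsum (nahm_term q 0) =
  TP q 4 4 * tsum (fun n => s ^^ (n * n) * ip s (2 * n)) +
  q * (TP q 4 2 * tsum (fun n => s ^^ (n * n + n) * ip s (2 * n + 1))).
Proof.
  have h0 : (0 <= 0 <= 2)%Z by lia.
  have [E S] := nahm_sum_gauss q nq lq 0 h0. rewrite -/p -/s in E S. rewrite E.
  set F := (fun x : Z * Z => _) in S *.
  rewrite tsum_split_snd //. f_equal.
  - rewrite (tsum_bij _ (fun x : Z * Z => ((fst x + snd x)%Z, snd x)) (fun x => ((fst x - snd x)%Z, snd x)));
      cbn [fst snd]; try by (move=> [b c]; cbn [fst snd]; f_equal; lia).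
    2: by apply: (summable_comp F (fun x => (fst x, (2 * snd x)%Z))) S; injlia.
    rewrite /TP -tsum_prod.
    + apply: tsum_ext => -[J k]. rewrite /F; cbn [fst snd]. rewrite Cmult_assoc sq -Cpowz_add //.
      do 2 f_equal. rewrite /nahm_exp. trilia.
    + exact: summable_quad.
    + apply: summable_ext (summable_ip_quad 2 1 (fun n => 2 * n)%Z ltac:(lia)) => n. do 2 f_equal. trilia.
  - rewrite (tsum_bij _ (fun x : Z * Z => ((fst x + snd x)%Z, snd x)) (fun x => ((fst x - snd x)%Z, snd x)));
      cbn [fst snd]; try by (move=> [b c]; cbn [fst snd]; f_equal; lia).
    2: by apply: (summable_comp F (fun x => (fst x, (2 * snd x + 1)%Z))) S; injlia.
    have S1 : summable (fun n => q ^^ (4 * tri n + 2 * n)) by exact: summable_quad.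
    have S2 : summable (fun n => s ^^ (n * n + n) * ip s (2 * n + 1)).
    { apply: summable_ext (summable_ip_quad 2 2 (fun n => 2 * n + 1)%Z ltac:(lia)) => n. do 2 f_equal. trilia. }
    rewrite /TP -(tsum_prod _ _ S1 S2) -tsum_scal; last exact: summable_prod S1 S2.
    apply: tsum_ext => -[J k]. rewrite /F; cbn [fst snd].
    rewrite -{2}(Cpowz_1 q) !Cmult_assoc sq -!Cpowz_add //.
    do 2 f_equal. rewrite /nahm_exp. trilia.
Qed.

Lemma nahm_sum2 : qpoch_inf p p * tsum (nahm_term q 2) =
  TP q 4 2 * tsum (fun n => s ^^ (n * n + n) * ip s (2 * n)) +
  q ^ 5 * (TP q 4 4 * tsum (fun n => s ^^ (n * n + 2 * n) * ip s (2 * n + 1))).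
Proof.
  have h0 : (0 <= 2 <= 2)%Z by lia.
  have [E S] := nahm_sum_gauss q nq lq 2 h0. rewrite -/p -/s in E S. rewrite E.
  set F := (fun x : Z * Z => _) in S *.
  rewrite tsum_split_snd //. f_equal.
  - rewrite (tsum_bij _ (fun x : Z * Z => ((fst x + snd x)%Z, snd x)) (fun x => ((fst x - snd x)%Z, snd x)));
      cbn [fst snd]; try by (move=> [b c]; cbn [fst snd]; f_equal; lia).
    2: by apply: (summable_comp F (fun x => (fst x, (2 * snd x)%Z))) S; injlia.
    rewrite /TP -tsum_prod.
    + apply: tsum_ext => -[J k]. rewrite /F; cbn [fst snd]. rewrite Cmult_assoc sq -Cpowz_add //.
      do 2 f_equal. rewrite /nahm_exp. trilia.
    + exact: summable_quad.
    + apply: summable_ext (summable_ip_quad 2 2 (fun n => 2 * n)%Z ltac:(lia)) => n. do 2 f_equal. trilia.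
  (* The linear term differs from that of [nahm_sum1]; reflecting the theta index as well yields
     [TP q 4 4] exactly. *)
  - rewrite (tsum_bij _ (fun x : Z * Z => ((snd x - fst x)%Z, snd x)) (fun x => ((snd x - fst x)%Z, snd x)));
      cbn [fst snd]; try by (move=> [b c]; cbn [fst snd]; f_equal; lia).
    2: by apply: (summable_comp F (fun x => (fst x, (2 * snd x + 1)%Z))) S; injlia.
    have S1 : summable (fun n => q ^^ (4 * tri n + 4 * n)) by exact: summable_quad.
    have S2 : summable (fun n => s ^^ (n * n + 2 * n) * ip s (2 * n + 1)).
    { apply: summable_ext (summable_ip_quad 2 3 (fun n => 2 * n + 1)%Z ltac:(lia)) => n. do 2 f_equal. trilia. }
    rewrite /TP -(tsum_prod _ _ S1 S2) -tsum_scal; last exact: summable_prod S1 S2.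
    apply: tsum_ext => -[J k]. rewrite /F; cbn [fst snd].
    rewrite -(Cpowz_nat q 5) !Cmult_assoc sq -!Cpowz_add //.
    do 2 f_equal. rewrite /nahm_exp. trilia.
Qed.

Let sub4 : s ^ 2 = p ^ 4.
Proof. rewrite /s; ring. Qed.

Let TH_s a b : TH s a b = TH p (2 * a) (2 * b).
Proof. apply: tsum_ext => r. rewrite /s Cpowz_pow //. do 2 f_equal. lia. Qed.

(** After the dissections, the part with exponents divisible by 3 is twice [lattice_III] and the
    part congruent to 1 is q times [lattice_IV]. *)
Lemma theta_identity1 :
  TP q 4 4 * (QQ p 4 8 * TH p 40 24) + q * (TP q 4 2 * (/ NN p 2 4 * TH (- s) 5 4)) =
  TP p 4 3 * (3 * TH p 15 9 - TH q 5 4).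
Proof.
  have nN := NN_nz p np lp 2 4 ltac:(lia) ltac:(lia).
  have nQ := QQ_nz p np lp 4 8 ltac:(lia) ltac:(lia).
  rewrite (dissect_E q nq lq) (dissect_T q nq lq) (dissect_theta1 q nq lq) -/p.
  have A := prod_a p np lp. have B := prod_b p np lp. have C := prod_c p np lp. have D := prod_d p np lp.
  have I3 := lattice_III p np lp. have I4 := lattice_IV p np lp.
  rewrite C D. rewrite -/s in I3 I4 *.
  transitivity (2 * (TP p 12 8 * QQ p 4 8) * TH p 40 24 + 2 * q * p * (TP p 48 36 * QQ p 4 8) * TH p 40 24 +
    q * TP (- s) 3 2 * TH (- s) 5 4 + 2 * q ^ 3 * TP (- p ^ 6) 4 3 * TH (- s) 5 4).
  { field. exact: nN. }
  (* By [dissect_theta1], 3 [TH p 15 9] - [TH q 5 4] contains [TH p 15 9] exactly twice. *)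
  rewrite A B. transitivity (2 * (TP p 4 3 * TH p 15 9) + q * (TP p 4 3 * (TH p 15 4 + p * TH p 15 14))); last ring.
  rewrite -I3 -I4 /p. ring.
Qed.

(** Here the residues modulo 3 are 2, settled by 2 q^2 times [lattice_III2], and 0, settled by
    [lattice_IV2]. *)
Lemma theta_identity2 :
  TP q 4 2 * (/ NN p 2 4 * TH (- s) 5 3) + q ^ 5 * (TP q 4 4 * (QQ p 4 8 * TH p 40 32)) =
  TP p 4 3 * (3 * q ^ 2 * TH p 15 12 + TH q 5 3).
Proof.
  have nN := NN_nz p np lp 2 4 ltac:(lia) ltac:(lia).
  rewrite (dissect_E q nq lq) (dissect_T q nq lq) (dissect_theta2 q nq lq) -/p.
  have A := prod_a p np lp. have B := prod_b p np lp. have C := prod_c p np lp. have D := prod_d p np lp.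
  have I3 := lattice_III2 p np lp. have I4 := lattice_IV2 p np lp.
  rewrite C D. rewrite -/s in I3 I4 *.
  transitivity (TP (- s) 3 2 * TH (- s) 5 3 + 2 * q ^ 2 * TP (- p ^ 6) 4 3 * TH (- s) 5 3 +
    2 * q ^ 5 * (TP p 12 8 * QQ p 4 8) * TH p 40 32 + 2 * q ^ 6 * p * (TP p 48 36 * QQ p 4 8) * TH p 40 32).
  { field. exact: nN. }
  rewrite A B. transitivity (2 * q ^ 2 * (TP p 4 3 * TH p 15 12) + TP p 4 3 * (TH p 15 8 - p * TH p 15 13)); last ring.
  rewrite -I3 -I4 /p. ring.
Qed.

(* The products of the Slater sums combine with [(p;p)_oo] through
   [(s;s^2)(-s;s^2) = (s^2;s^4)] and [(-w;w)(w;w^2) = 1], where [w = s^2 = p^4]. *)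
Let clear_products (S A B g h X : Complex.C) :
  QQ p 1 1 * S = A * (NN p 2 4 / QQ p 4 4 * g) + B * (NN p 4 4 / QQ p 4 4 * h) ->
  A * (QQ p 4 8 * g) + B * (/ NN p 2 4 * h) = TP p 4 3 * X ->
  S = QQ p 2 2 / QQ p 1 1 ^ 2 * X.
Proof.
  move=> E1 E2.
  have nz a b : (0 < a)%nat -> (0 < b)%nat -> QQ p a b <> 0 by exact: QQ_nz.
  have n11 := nz 1%nat 1%nat ltac:(lia) ltac:(lia). have n12 := nz 1%nat 2%nat ltac:(lia) ltac:(lia).
  have n22 := nz 2%nat 2%nat ltac:(lia) ltac:(lia). have n44 := nz 4%nat 4%nat ltac:(lia) ltac:(lia).
  have n24 := NN_nz p np lp 2 4 ltac:(lia) ltac:(lia). have m12 := NN_nz p np lp 1 2 ltac:(lia) ltac:(lia).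
  have e1 := QQ_NN p np lp 1 2 ltac:(lia). have e2 := QQ_NN p np lp 2 4 ltac:(lia).
  have e3 := euler_odd p np lp 4 ltac:(lia). have e4 := QQ_split2 p np lp 1 1 ltac:(lia).
  rewrite -[QQ p (1 * 2) _]/(QQ p 2 4) in e1. rewrite -[QQ p (2 * 2) _]/(QQ p 4 8) in e2.
  rewrite -[QQ p 4 (4 * 2)]/(QQ p 4 8) in e3.
  rewrite -[QQ p 1 (1 * 2)]/(QQ p 1 2) -[QQ p (1 + 1) _]/(QQ p 2 2) in e4.
  rewrite TP_4_3 // in E2.
  have key : NN p 1 2 * QQ p 4 4 * (QQ p 1 2 * QQ p 1 1 * S) = NN p 1 2 * QQ p 4 4 * X.
  { rewrite -E2. transitivity (QQ p 4 4 * (QQ p 1 2 * NN p 1 2) * (QQ p 1 1 * S)); first ring.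
    rewrite E1 e1. transitivity (A * ((QQ p 2 4 * NN p 2 4) * g) + B * (/ NN p 2 4 * (NN p 4 4 * (QQ p 2 4 * NN p 2 4)) * h)).
    - field. by split.
    - rewrite e2 e3. ring. }
  have key2 := Cmult_cancel_l _ _ _ (Cmult_neq_0 _ _ m12 n44) key.
  rewrite -key2 e4. field. by split.
Qed.

Let QQ_s4 : qpoch_inf (s ^ 2) (s ^ 2) = QQ p 4 4.
Proof. by rewrite sub4. Qed.

Lemma nahm_value1 : tsum (nahm_term q 0) = QQ p 2 2 / QQ p 1 1 ^ 2 * (3 * TH p 15 9 - TH q 5 4).
Proof.
  have E := nahm_sum1. rewrite slater_U1 // slater_V1 // QQ_s4 sub4 -/(TH s 20 12) -/(TH (- s) 5 4) TH_s
    -[TH p (2 * 20) _]/(TH p 40 24) in E.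
  apply: (clear_products _ (TP q 4 4) (q * TP q 4 2) (TH p 40 24) (TH (- s) 5 4)).
  - rewrite /QQ /NN !Cpow_1_r. rewrite E /QQ /s. ring.
  - rewrite -theta_identity1. ring.
Qed.

Lemma nahm_value2 : tsum (nahm_term q 2) = QQ p 2 2 / QQ p 1 1 ^ 2 * (3 * q ^ 2 * TH p 15 12 + TH q 5 3).
Proof.
  have E := nahm_sum2. rewrite slater_U2 // slater_V2 // QQ_s4 sub4 -/(TH s 20 16) -/(TH (- s) 5 3) TH_s
    -[TH p (2 * 20) _]/(TH p 40 32) in E.
  apply: (clear_products _ (q ^ 5 * TP q 4 4) (TP q 4 2) (TH p 40 32) (TH (- s) 5 3)).
  - rewrite /QQ /NN !Cpow_1_r. rewrite E /QQ /s. ring.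
  - rewrite -theta_identity2. ring.
Qed.

Lemma QQ_cube a b : QQ p a b = QQ q (3 * a) (3 * b).
Proof. by rewrite /QQ /p -!Cpow_mult_r. Qed.

Lemma nahm_product1 : tsum (nahm_term q 0) =
  3 * (QQ q 6 6 * (QQ q 18 45 * QQ q 27 45 * QQ q 45 45)) / QQ q 3 3 ^ 2 -
  QQ q 4 10 * QQ q 6 10 * QQ q 10 10 *
    (QQ q 1 30 * QQ q 5 30 * QQ q 11 30 * QQ q 19 30 * QQ q 25 30 * QQ q 29 30) /
    (QQ q 3 3 * (QQ q 3 30 * QQ q 27 30)).
Proof.
  have nz a b : (0 < a)%nat -> (0 < b)%nat -> QQ q a b <> 0 by exact: QQ_nz.
  have T1 := jacobi_TH p 9 6 np lp ltac:(lia) ltac:(lia).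
  rewrite -/(QQ p 9 15) -/(QQ p 6 15) -/(QQ p 15 15) !QQ_cube in T1.
  have T2 := jacobi_TH q 4 1 nq lq ltac:(lia) ltac:(lia).
  rewrite -/(QQ q 4 5) -/(QQ q 1 5) -/(QQ q 5 5) in T2.
  rewrite nahm_value1 !QQ_cube [TH p 15 9]T1 [TH q 5 4]T2.
  (* The moduli are refined from 5 through 10 to 30, and (q^3;q^6)_oo is split modulo 30 as well, so
     that the common factors cancel by field arithmetic. *)
  rewrite (QQ_split2 q nq lq 4 5 ltac:(lia)) (QQ_split2 q nq lq 1 5 ltac:(lia)) (QQ_split2 q nq lq 5 5 ltac:(lia)).
  cbn [Nat.mul Nat.add].
  rewrite (QQ_split3 q nq lq 1 10 ltac:(lia)) (QQ_split3 q nq lq 9 10 ltac:(lia)) (QQ_split3 q nq lq 5 10 ltac:(lia)).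
  rewrite (QQ_split2 q nq lq 3 3 ltac:(lia)). cbn [Nat.mul Nat.add].
  rewrite (QQ_split q nq lq 3 6 5 ltac:(lia) ltac:(lia)). cbn [cprod Nat.mul Nat.add].
  field. repeat split; apply: nz; lia.
Qed.

Lemma nahm_product2 : tsum (nahm_term q 2) =
  3 * q ^ 2 * (QQ q 6 6 * (QQ q 9 45 * QQ q 36 45 * QQ q 45 45)) / QQ q 3 3 ^ 2 +
  QQ q 2 10 * QQ q 8 10 * QQ q 10 10 *
    (QQ q 5 30 * QQ q 7 30 * QQ q 13 30 * QQ q 17 30 * QQ q 23 30 * QQ q 25 30) /
    (QQ q 3 3 * (QQ q 9 30 * QQ q 21 30)).
Proof.
  have nz a b : (0 < a)%nat -> (0 < b)%nat -> QQ q a b <> 0 by exact: QQ_nz.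
  have T1 := jacobi_TH p 12 3 np lp ltac:(lia) ltac:(lia).
  rewrite -/(QQ p 12 15) -/(QQ p 3 15) -/(QQ p 15 15) !QQ_cube in T1.
  have T2 := jacobi_TH q 3 2 nq lq ltac:(lia) ltac:(lia).
  rewrite -/(QQ q 3 5) -/(QQ q 2 5) -/(QQ q 5 5) in T2.
  rewrite nahm_value2 !QQ_cube [TH p 15 12]T1 [TH q 5 3]T2.
  rewrite (QQ_split2 q nq lq 3 5 ltac:(lia)) (QQ_split2 q nq lq 2 5 ltac:(lia)) (QQ_split2 q nq lq 5 5 ltac:(lia)).
  cbn [Nat.mul Nat.add].
  rewrite (QQ_split3 q nq lq 3 10 ltac:(lia)) (QQ_split3 q nq lq 7 10 ltac:(lia)) (QQ_split3 q nq lq 5 10 ltac:(lia)).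
  rewrite (QQ_split2 q nq lq 3 3 ltac:(lia)). cbn [Nat.mul Nat.add].
  rewrite (QQ_split q nq lq 3 6 5 ltac:(lia) ltac:(lia)). cbn [cprod Nat.mul Nat.add].
  field. repeat split; apply: nz; lia.
Qed.

(** The sum over Z^2 is supported on pairs of natural numbers; [d] also exchanges the coordinates to
    match the order used in [nahm_term]. *)
Lemma nahm_partial_cv (e : nat -> nat -> Z) (a : Z) : (0 <= a <= 2)%Z ->
  (forall i j, e i j = nahm_exp a (Z.of_nat i) (Z.of_nat j)) ->
  Ccv (sq_partial (term e q)) (tsum (nahm_term q a)).
Proof.
  move=> ha E. have S := summable_nahm q nq lq a ha.
  pose d (x : nat * nat) := (Z.of_nat (snd x), Z.of_nat (fst x)).
  have inj : injective_map d.
  { move=> [i j] [k l] h. have := f_equal fst h. have := f_equal snd h. rewrite /d /=. move=> *; f_equal; lia. }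
  have T x : nahm_term q a (d x) = term e q (fst x) (snd x).
  { case: x => i j. rewrite /nahm_term /term /d E; cbn [fst snd].
    rewrite !ip_nonneg; try lia. rewrite !Nat2Z.id -/p. field. split; exact: qpoch_nz. }
  have Sd := summable_comp _ d inj S.
  rewrite (tsum_extend _ d inj _ Sd).
  - rewrite (tsum_ext _ _ T). apply: sq_partial_cv. apply: summable_ext Sd => x. by rewrite T.
  - move=> [j i] h. rewrite /nahm_term; cbn [fst snd].
    have [hi|hi] : ((i < 0 \/ j < 0) \/ (0 <= i /\ 0 <= j))%Z by lia.
    + rewrite ip_prod_0 //. ring.
    + exfalso. apply: (h (Z.to_nat i, Z.to_nat j)). rewrite /d; cbn [fst snd]. f_equal; lia.
Qed.

End Nahm.

(** * The exponents on natural indices and the case q = 0 *)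

Lemma e1_nahm i j : e1 i j = nahm_exp 0 (Z.of_nat i) (Z.of_nat j).
Proof.
  rewrite /e1 /nahm_exp. have -> : ((Z.of_nat i * Z.of_nat i - Z.of_nat i) / 2 = tri (Z.of_nat i))%Z.
  { rewrite /tri. f_equal. ring. }
  trilia.
Qed.

Lemma e2_nahm i j : e2 i j = nahm_exp 2 (Z.of_nat i) (Z.of_nat j).
Proof.
  rewrite /e2 /nahm_exp.
  have -> : ((Z.of_nat i * Z.of_nat i + 3 * Z.of_nat i) / 2 = tri (Z.of_nat i) + 2 * Z.of_nat i)%Z.
  { have -> : (Z.of_nat i * Z.of_nat i + 3 * Z.of_nat i = (tri (Z.of_nat i) + 2 * Z.of_nat i) * 2)%Z by trilia.
    by rewrite Z.div_mul. }
  trilia.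
Qed.

Lemma qpoch_inf_0 (b : Complex.C) : qpoch_inf 0 b = 1.
Proof.
  apply: Clim_eq. apply: (Ccv_ext (fun _ => 1)); last exact: Ccv_const.
  elim=> [|n IH] //=. rewrite -IH. ring.
Qed.

Lemma Cpow_0_l n : (0 < n)%nat -> 0 ^ n = 0.
Proof. case: n => [|n] h; [lia | rewrite Cpow_S; ring]. Qed.

(** At q = 0 all finite products equal 1 and 0^n = 0 for n > 0, so the sum counts the pairs at which
    the exponent vanishes. *)
Lemma sq_partial_0 (e : nat -> nat -> Z) (l : list (nat * nat)) : NoDup l ->
  (forall i j, ~ In (i, j) l -> (0 < e i j)%Z) ->
  (forall x, In x l -> e (fst x) (snd x) = 0%Z) ->
  Ccv (sq_partial (term e 0)) (lsum (fun _ => 1) l).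
Proof.
  move=> nd Hpos Hz. have q0 n : qpoch (0 ^ 3) (0 ^ 3) n = 1.
  { rewrite Cpow_0_l; last lia. elim: n => [|n IH] //=. rewrite IH. ring. }
  pose F (x : nat * nat) := term e 0 (fst x) (snd x).
  have F0 x : ~ In x l -> F x = 0.
  { case: x => i j /Hpos h. rewrite /F /term !q0 Cpowz_pos; last by cbn [fst snd]; lia.
    rewrite Cpow_0_l; [field | cbn [fst snd]; lia]. }
  have F1 : lsum F l = lsum (fun _ => 1) l.
  { apply: lsum_ext_in => x /Hz h. rewrite /F /term !q0 h Cpowz_0. field. }
  rewrite -F1 -(has_sum_tsum _ _ (has_sum_finite F l nd F0)).
  apply: sq_partial_cv. exact: summable_finite F0.
Qed.
Theorem theorem1p4 (q : Complex.C) (hq : (Cmod q < 1)%R) :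
  filterlim (sq_partial (term e1 q)) eventually
    (locally
      (3 * (qpoch_inf (q^6) (q^6)
             * (qpoch_inf (q^18) (q^45) * qpoch_inf (q^27) (q^45) * qpoch_inf (q^45) (q^45)))
         / (qpoch_inf (q^3) (q^3) ^ 2)
       - (qpoch_inf (q^4) (q^10) * qpoch_inf (q^6) (q^10) * qpoch_inf (q^10) (q^10))
         * (qpoch_inf q (q^30) * qpoch_inf (q^5) (q^30) * qpoch_inf (q^11) (q^30)
            * qpoch_inf (q^19) (q^30) * qpoch_inf (q^25) (q^30) * qpoch_inf (q^29) (q^30))
         / (qpoch_inf (q^3) (q^3) * (qpoch_inf (q^3) (q^30) * qpoch_inf (q^27) (q^30)))))
  /\
  filterlim (sq_partial (term e2 q)) eventually
    (locally
      (3 * q^2 * (qpoch_inf (q^6) (q^6)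
             * (qpoch_inf (q^9) (q^45) * qpoch_inf (q^36) (q^45) * qpoch_inf (q^45) (q^45)))
         / (qpoch_inf (q^3) (q^3) ^ 2)
       + (qpoch_inf (q^2) (q^10) * qpoch_inf (q^8) (q^10) * qpoch_inf (q^10) (q^10))
         * (qpoch_inf (q^5) (q^30) * qpoch_inf (q^7) (q^30) * qpoch_inf (q^13) (q^30)
            * qpoch_inf (q^17) (q^30) * qpoch_inf (q^23) (q^30) * qpoch_inf (q^25) (q^30))
         / (qpoch_inf (q^3) (q^3) * (qpoch_inf (q^9) (q^30) * qpoch_inf (q^21) (q^30))))).
Proof.
  case: (classic (q = 0)) => [->|nq].
  - rewrite !Cpow_0_l ?qpoch_inf_0; try lia. split.
    (* The exponent of S_1 vanishes at (0,0) and (1,0) only, matching the value 3 - 1 of the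
       right-hand side. *)
    + replace (locally _) with (locally (lsum (fun _ : nat * nat => 1) ((0%nat, 0%nat) :: (1%nat, 0%nat) :: nil))).
      * apply: Ccv_filterlim. apply: sq_partial_0.
        -- constructor; last by constructor=> //; constructor. by case=> // -[].
        -- move=> i j h. rewrite e1_nahm /nahm_exp.
           have [hj|[hj hi]] : (0 < j \/ j = 0 /\ 1 < i)%nat.
           { case: j h => [|j] h; last by left; lia. right. split=> //.
             case: i h => [|[|i]] h; [case: h; by left | case: h; by right; left | lia]. }
           ++ have := tri_nonneg (Z.of_nat i - Z.of_nat j). have := tri2 (Z.of_nat j + 1). nia.
           ++ subst j. have := tri2 (Z.of_nat i - Z.of_nat 0). have := tri_nonneg (Z.of_nat 0 + 1). nia.
        -- by move=> x [<-|[<-|[]]].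
      * f_equal. rewrite /=. field.
    (* The exponent of S_2 vanishes at (0,0) only; the term with 3 q^2 disappears and the other one
       is 1. *)
    + replace (locally _) with (locally (lsum (fun _ : nat * nat => 1) ((0%nat, 0%nat) :: nil))).
      * apply: Ccv_filterlim. apply: sq_partial_0.
        -- by constructor=> //; constructor.
        -- move=> i j h. rewrite e2_nahm /nahm_exp.
           have [hj|[hj hi]] : (0 < j \/ j = 0 /\ 0 < i)%nat.
           { case: j h => [|j] h; last by left; lia. right. split=> //.
             case: i h => [|i] h; [case: h; by left | lia]. }
           ++ have := tri2 (Z.of_nat i - Z.of_nat j). have := tri2 (Z.of_nat j + 1). nia.
           ++ subst j. have := tri2 (Z.of_nat i - Z.of_nat 0). have := tri_nonneg (Z.of_nat 0 + 1). nia.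
        -- by move=> x [<-|[]].
      * f_equal. rewrite /=. field.
  - have H1 := nahm_partial_cv q nq hq e1 0 ltac:(lia) e1_nahm.
    have H2 := nahm_partial_cv q nq hq e2 2 ltac:(lia) e2_nahm.
    rewrite nahm_product1 // /QQ Cpow_1_r in H1. rewrite nahm_product2 // /QQ in H2.
    split; exact: Ccv_filterlim.
Qed.
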